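(* Let $\mathcal G$ be a rank 3 w-colored graph and let $\mathfrak T$ denote the invariant defined in the context. Let $e$ be a stranded edge of $\mathcal G$. (1) If $e$ is an ordinary edge of $\mathcal G$, then $$\mathfrak T_{\mathcal G}=\mathfrak T_{\mathcal G\vee e}+\mathfrak T_{\mathcal G/e}.$$ (2) If $e$ is a bridge, then $\mathfrak T_{\mathcal G\vee e}=z^8s(wq)^3t^2\,\mathfrak T_{\mathcal G/e}$ and $$\mathfrak T_{\mathcal G}=[(x-1)z^8s(wq)^3t^2+1]\,\mathfrak T_{\mathcal G/e}.$$ (3) If $e$ is a trivial $p$-inner loop, $p\in\{0,1,2\}$, then $$\mathfrak T_{\mathcal G}=\mathfrak T_{\mathcal G\vee e}+(y-1)z^{4p-7}\,\mathfrak T_{\mathcal G/e}.$$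
   Context: All objects are finite. **Stranded vertices and edges.** A rank $D$ stranded pre-vertex ($D\ge 1$) is a set $S$ of $2n$ elements (vertex points) with two partitions of $S$: one into non-empty parts of size at most $D$ (pre-edges), one into pairs (chords). For $n=0$ it is called a trivial circle (of any rank). Its vertex graph has the pre-edges as vertices and one edge per chord, joining the pre-edges containing the two points of the chord. It is connected if $S$ cannot be split into two non-empty parts such that no pre-edge and no chord meets both; a stranded vertex is a connected stranded pre-vertex. Its coordination is its number of pre-edges. A stranded edge of rank $d\ge1$ is a set of $2d$ elements (edge points) with a partition into two sets of size $d$ (ends) and a partition into $d$ pairs (strands), each strand containing one point from each end. **HESG.** A rank $D$ half-edged stranded graph (HESG) consists of a set $V$ of disjoint rank $D$ stranded vertices, a set $E\sqcup \mathfrak f^0$ of disjoint stranded edges of rank at most $D$, and a map $\phi$ from edge points to vertex points, defined on both ends of every element of $E$ and on exactly one end of each element of $\mathfrak f^0$, which is injective, maps each of these ends bijectively onto some pre-edge, and is surjective onto all vertex points. Elements of $\mathfrak f^0$ are stranded half-edges (sHEs); the points of the unattached end of an sHE are its external points. Collapsing stranded vertices to points and stranded edges to lines gives the underlying graph (with half-edges); connectedness, loops, bridges and ordinary edges (neither bridge nor loop) are understood in it. Trivial circles count as stranded vertices and as connected components. **Faces.** Identifying each attached edge point with its image under $\phi$, the chords and strands form a disjoint union of cycles and paths (between external points). Each cycle is a closed face, each path an open face; moreover each trivial circle has, by convention, one closed face. **Cut and c-subgraphs.** $\mathcal G\vee e$ is obtained by deleting the stranded edge $e$ and attaching an sHE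 of the same rank (and color) at each of the two pre-edges where $e$ was attached. A spanning c-subgraph $A\Subset\mathcal G$ is obtained by cutting all edges in some subset of $E$ (all vertices and sHEs are kept). **Contraction.** Let $e$ be a stranded edge, $s$ its set of strands and $c$ the set of chords these strands meet. The components of $s\cup c$ are cycles (inner faces of $e$) and paths. If there are exactly $p$ inner faces, $e$ is called $p$-inner; strands not in an inner face are outer strands. $\mathcal G/e$ is obtained by replacing $e$ and its end vertices (or end vertex, for a loop) by $p$ trivial circles and a new pre-vertex $v'$, whose pre-edges are those of the end vertices not attached to $e$ (with all other edges and sHEs still attached), and whose chords are the chords of the end vertices not in $c$ together with one new chord for each path of $s\cup c$, joining the ends of that path. If $v'$ is disconnected it is split into its connected parts; if $e$ has no outer strands there is no $v'$. **Colors.** A rank $D$ half-edged colored tensor graph (HEcTG) is a rank $D$ HESG in which every stranded vertex has coordination $D+1$, every pre-edge has $D$ points, every vertex graph is $K_{D+1}$, all edges and sHEs have rank $D$, the underlying graph is bipartite, and the edges and sHEs are colored by $\{0,\dots,D\}$ so that no two meeting at a vertex have the same color. A pre-edge has the color of the edge or sHE attached to it; a vertex point has color $(i,j)$ with $i$ the color of its pre-edge and $j$ that of the pre-edge containing the other end of its chord; the chord then has color pair $\{i,j\}$. In an edge of color $i$ the two end points of each strand are required to have the same color pair $(i,j)$, and the strand gets the color pair $\{i,j\}$ (similarly for sHEs). A rank $D$ w-colored graph is a rank $D$ HESG obtained from a rank $D$ HEcTG by zero or more successive stranded edge contractions. It inherits colors of edges, sHEs, pre-edges and color pairs of points, strands,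 chords (a new chord gets the common pair of the path it replaces) and faces (a trivial circle gets the pair of its inner face). **Bubbles (rank 3).** For three distinct colors $a,b,c$, keep only the points whose color $(i,j)$ has $i,j\in\{a,b,c\}$, with the chords and strands on them. The connected components (two points being connected when joined by a chord or a strand, or in the same pre-edge, or in the same end of an edge or sHE) are the 3-bubbles of colors $abc$. A bubble is open if it contains external points of sHEs, otherwise closed. Trivial circles are not counted as bubbles. Each bubble is a ribbon graph, with half-ribbons if open. **Boundary (rank 3).** The boundary graph $\partial\mathcal G$ has one vertex per sHE and one edge per open face, joining the sHEs containing the two end points of the face. A vertex has the color of its sHE, an edge the color pair of its open face; $\partial\mathcal G$ is 3-regular. Its faces are, for each set $\{a,b,c\}$ of three distinct colors, the cycles which are the connected components of the subgraph formed by the edges with color pair contained in $\{a,b,c\}$. **Trivial loops (rank 3 w-colored).** Let $e$ be a loop at $v$. The sector of an outer strand of $e$ is the set of chords and pre-edge points of $v$ forming the connected component of the pre-vertex $v'$ (in the contraction of $e$) to which that strand is incident. The loop $e$ is trivial if it is 3-inner, or 2-inner, or if it is 1-inner with exactly 2 sectors (contraction of $e$ leads to 2 connected component vertex graphs) or 0-inner with exactly 3 sectors (contraction of $e$ leads to 3 connected component vertex graphs) such that there are no stranded edges linking different sectors. **Invariant.** For a rank 3 w-colored graph write $k$ for the number of connected components, $V$, $E$, $f$ for the numbers of stranded vertices, stranded edges, sHEs, $F_{\rm int}$ for the number of closed faces, $B_{\rm int}$, $B_{\rm ext}$ for the numbers of closed and open 3-bubbles, $C_\partial$, $E_\partial$,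 $F_\partial$ for the numbers of connected components, edges and faces of its boundary graph, $r=V-k$, $n=E+k-V$. Then $$\mathfrak T_{\mathcal G}(x,y,z,s,w,q,t)=\sum_{A\Subset\mathcal G}(x-1)^{r(\mathcal G)-r(A)}(y-1)^{n(A)}z^{5k(A)-[3(V-E(A))+2(F_{\rm int}(A)-B_{\rm int}(A)-B_{\rm ext}(A))]}\,s^{C_\partial(A)}w^{F_\partial(A)}q^{E_\partial(A)}t^{f(A)},$$ with $V=V(\mathcal G)=V(A)$. Identities are understood in Laurent polynomials when negative powers of $z$ occur.
   Formalization: In the definition of trivial loop, ''no stranded edges linking different sectors'' is taken to exclude chains of stranded edges through other vertices too, for both 1-inner and 0-inner loops; excluding only single edges would make (3) false. *)

(* Defs.v *)
From mathcomp Require Import all_boot all_order all_algebra.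
From mathcomp Require Import mpoly.

Set Implicit Arguments.
Unset Strict Implicit.
Unset Printing Implicit Defensive.

Import GRing.Theory.

Definition meets (U : finType) (A B : {set U}) : bool := ~~ [disjoint A & B].

Definition joined (U : finType) (P : {set {set U}}) : rel U :=
  fun x y => [exists B in P, (x \in B) && (y \in B)].

(* Connected components of [A] for a symmetric relation [r] on [A]. *)
Definition comps (U : finType) (r : rel U) (A : {set U}) : {set {set U}} :=
  equivalence_partition
    (connect (fun x y => [&& x \in A, y \in A & r x y])) A.

(* Stranded graphs are drawn on the points of an ambient finite type [T], of
   which [vpts] are the vertex points in use (contraction discards points and
   creates none).

   Attached edge points are identified with their images under phi, so that
   - an element of [edges] is the set of all the points of a stranded edge, its
     ends being the two pre-edges it contains;
   - an element of [shes] (stranded half-edges) is the set of the points of its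
     attached end, a pre-edge.  The strands of an sHE match its external points
     with its attached points; the external point opposite to [x] is
     represented by [x] itself.
   [strands] collects the strands of the elements of [edges] only.

   A disjoint union of stranded vertices is a stranded pre-vertex, from which
   the vertices are recovered as the connected components, together with some
   number [ncirc] of trivial circles. *)
Record sgraph (T : finType) := SGraph {
  vpts : {set T};
  pedges : {set {set T}};
  chords : {set {set T}};
  edges : {set {set T}};
  shes : {set {set T}};
  strands : {set {set T}};
  ncirc : nat
}.

Section Graphs.

Variable T : finType.
Implicit Types (G : sgraph T) (e : {set T}) (C : {set {set T}}).

Definition ends G e : {set {set T}} := [set p in pedges G | p \subset e].

Record hesg (D : nat) G : Prop := Hesg {
  pedges_partition : partition (pedges G) (vpts G);
  pedges_rank : forall p, p \in pedges G -> #|p| <= D;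
  chords_partition : partition (chords G) (vpts G);
  chords_pair : forall c, c \in chords G -> #|c| = 2;
  attached_partition : partition (edges G :|: shes G) (vpts G);
  edges_ends : forall e, e \in edges G -> #|ends G e| = 2 /\ cover (ends G e) = e;
  shes_end : shes G \subset pedges G;
  strands_partition : partition (strands G) (cover (edges G));
  strands_edge : forall s, s \in strands G -> exists2 e, e \in edges G &
    s \subset e /\ (forall p, p \in ends G e -> #|s :&: p| = 1)
}.

(* The stranded vertices that are not trivial circles, as sets of points. *)
Definition vertices G : {set {set T}} :=
  comps (joined (pedges G :|: chords G)) (vpts G).

(* The underlying graph, without the trivial circles (isolated vertices). *)
Definition end_vertices G e : {set {set T}} :=
  [set v in vertices G | meets v e].

Definition ug_adj G : rel {set T} :=
  fun v w => [exists e in edges G,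
    (v \in end_vertices G e) && (w \in end_vertices G e)].

Definition ug_comps G : {set {set {set T}}} := comps (ug_adj G) (vertices G).

Definition num_vertices G : nat := (#|vertices G| + ncirc G).
Definition num_edges G : nat := #|edges G|.
Definition num_shes G : nat := #|shes G|.
Definition num_comps G : nat := (#|ug_comps G| + ncirc G).

(* The faces other than those of the trivial circles, as sets of points. *)
Definition faces G : {set {set T}} :=
  comps (joined (chords G :|: strands G)) (vpts G).

Definition open_faces G : {set {set T}} :=
  [set K in faces G | meets K (cover (shes G))].

Definition num_closed_faces G : nat :=
  (#|faces G :\: open_faces G| + ncirc G).

(* All the edges in [C] are cut; each end of such an edge becomes an sHE. *)
Definition cut G C : sgraph T := {|
  vpts := vpts G;
  pedges := pedges G;
  chords := chords G;
  edges := edges G :\: C;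
  shes := shes G :|: \bigcup_(e in C) ends G e;
  strands := [set s in strands G | [forall e in C, ~~ (s \subset e)]];
  ncirc := ncirc G
|}.

Definition edge_strands G e : {set {set T}} := [set s in strands G | s \subset e].
Definition edge_chords G e : {set {set T}} :=
  [set c in chords G | meets c (cover (edge_strands G e))].

Definition edge_comps G e : {set {set T}} :=
  let sc := edge_strands G e :|: edge_chords G e in comps (joined sc) (cover sc).

(* The points of [e] are those lying both on a strand and on a chord of the
   union; the other points are the ends of the paths. *)
Definition inner_faces G e : {set {set T}} :=
  [set K in edge_comps G e | K \subset e].
Definition outer_paths G e : {set {set T}} :=
  [set K in edge_comps G e | ~~ (K \subset e)].

Definition inner_number G e : nat := #|inner_faces G e|.

(* The splitting of the new pre-vertex into its connected parts is automatic,
   vertices being the connected components. *)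
Definition contract G e : sgraph T := {|
  vpts := vpts G :\: e;
  pedges := pedges G :\: ends G e;
  chords := (chords G :\: edge_chords G e)
            :|: [set K :\: e | K in outer_paths G e];
  edges := edges G :\ e;
  shes := shes G;
  strands := strands G :\: edge_strands G e;
  ncirc := (ncirc G + inner_number G e)
|}.

Definition loop G e : bool := #|end_vertices G e| == 1.
Definition bridge G e : bool := (num_comps G < num_comps (cut G [set e])).
Definition ordinary G e : bool := ~~ bridge G e && ~~ loop G e.

(* A colouring of an edge-coloured graph is recorded by the colours [(i, j)] of
   its points: the colour of an edge, an sHE or a pre-edge is the first
   component of the colour of any of its points. *)
Record hectg (D : nat) (col : T -> 'I_D.+1 * 'I_D.+1) G : Prop := Hectg {
  hectg_hesg : hesg D G;
  hectg_ncirc : ncirc G = 0;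
  hectg_coordination : forall v, v \in vertices G -> #|ends G v| = D.+1;
  hectg_pedges : forall p, p \in pedges G -> #|p| = D;
  (* [hectg_noloop] and [hectg_complete]: the vertex graphs are K_{D+1} *)
  hectg_noloop : forall c p,
    c \in chords G -> p \in pedges G -> ~~ (c \subset p);
  hectg_complete : forall v p p', v \in vertices G ->
    p \in ends G v -> p' \in ends G v -> p != p' ->
    #|[set c in chords G | meets c p && meets c p']| = 1;
  hectg_bipartite : exists S : {set {set T}}, forall e, e \in edges G ->
    #|end_vertices G e :&: S| = 1 /\ #|end_vertices G e :\: S| = 1;
  hectg_color : forall h x y, h \in edges G :|: shes G ->
    x \in h -> y \in h -> (col x).1 = (col y).1;
  hectg_proper : forall v h h' x y, v \in vertices G ->
    h \in edges G :|: shes G -> h' \in edges G :|: shes G -> h != h' ->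
    meets v h -> meets v h' -> x \in h -> y \in h' -> (col x).1 <> (col y).1;
  hectg_chord : forall c x y, c \in chords G ->
    x \in c -> y \in c -> x != y -> (col x).2 = (col y).1;
  hectg_strand : forall s x y, s \in strands G ->
    x \in s -> y \in s -> col x = col y
}.

(* Remaining points, hence remaining edges, sHEs and pre-edges, keep their
   colours under contraction. *)
Inductive wcolored (D : nat) (col : T -> 'I_D.+1 * 'I_D.+1) : sgraph T -> Prop :=
| wcolored_hectg G : hectg col G -> wcolored col G
| wcolored_contract G e :
    wcolored col G -> e \in edges G -> wcolored col (contract G e).

Definition sectors G e : {set {set T}} :=
  [set w in vertices (contract G e) | [exists K in outer_paths G e, meets K w]].

(* Stranded edges (other than [e]) link two sectors when a chain of them does,
   possibly through further vertices: excluding only single edges from one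
   sector to another would make the recursion for trivial loops false. *)
Definition sectors_unlinked G e : Prop :=
  forall w w', w \in sectors G e -> w' \in sectors G e -> w != w' ->
  ~~ connect (ug_adj (contract G e)) w w'.

Definition trivial_loop G e : Prop :=
  loop G e /\
  [\/ inner_number G e = 3,
      inner_number G e = 2,
      [/\ inner_number G e = 1, #|sectors G e| = 2 & sectors_unlinked G e]
    | [/\ inner_number G e = 0, #|sectors G e| = 3 & sectors_unlinked G e]].

Section Rank3.

Variable col : T -> 'I_4 * 'I_4.
Implicit Types t : {set 'I_4}.

Definition color_points t G : {set T} :=
  [set x in vpts G | ((col x).1 \in t) && ((col x).2 \in t)].

Definition bubbles t G : {set {set T}} :=
  comps (joined (chords G :|: strands G :|: pedges G)) (color_points t G).

Definition open_bubbles t G : {set {set T}} :=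
  [set K in bubbles t G | meets K (cover (shes G))].

Definition num_open_bubbles G : nat :=
  (\sum_(t : {set 'I_4} | #|t| == 3) #|open_bubbles t G|).
Definition num_closed_bubbles G : nat :=
  (\sum_(t : {set 'I_4} | #|t| == 3) #|bubbles t G :\: open_bubbles t G|).

(* The boundary graph: its vertices are the sHEs, its edges the open faces, a
   face being incident to the (two) sHEs it meets. *)
Definition bd_adj (F : {set {set T}}) : rel {set T} :=
  fun p q => [exists K in F, meets K p && meets K q].

Definition bd_edges t G : {set {set T}} :=
  [set K in open_faces G | K \subset color_points t G].

Definition bd_faces t G : {set {set {set T}}} :=
  comps (bd_adj (bd_edges t G))
        [set p in shes G | [exists K in bd_edges t G, meets K p]].

Definition num_bd_comps G : nat := #|comps (bd_adj (open_faces G)) (shes G)|.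
Definition num_bd_edges G : nat := #|open_faces G|.
Definition num_bd_faces G : nat :=
  (\sum_(t : {set 'I_4} | #|t| == 3) #|bd_faces t G|).

End Rank3.

End Graphs.

Local Open Scope ring_scope.

(* Laurent polynomials are taken in the field of fractions of
   Z[x, y, z, s, w, q, t]. *)
Definition ratfun : fieldType := {fraction {mpoly int[7]}}.

Definition indet (i : 'I_7) : ratfun := tofrac ('X_i : {mpoly int[7]}).

Definition Tx : ratfun := indet (inord 0).
Definition Ty : ratfun := indet (inord 1).
Definition Tz : ratfun := indet (inord 2).
Definition Ts : ratfun := indet (inord 3).
Definition Tw : ratfun := indet (inord 4).
Definition Tq : ratfun := indet (inord 5).
Definition Tt : ratfun := indet (inord 6).

Section Invariant.

Variables (T : finType) (col : T -> 'I_4 * 'I_4).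
Implicit Types G A : sgraph T.

Definition rk G : int := (num_vertices G)%:Z - (num_comps G)%:Z.
Definition nullity G : int :=
  (num_edges G)%:Z + (num_comps G)%:Z - (num_vertices G)%:Z.

Definition z_exponent A : int :=
  5 * (num_comps A)%:Z
  - (3 * ((num_vertices A)%:Z - (num_edges A)%:Z)
     + 2 * ((num_closed_faces A)%:Z - (num_closed_bubbles col A)%:Z
            - (num_open_bubbles col A)%:Z)).

Definition Tmonomial G A : ratfun :=
  (Tx - 1) ^ (rk G - rk A) * (Ty - 1) ^ nullity A * Tz ^ z_exponent A
  * Ts ^+ num_bd_comps A * Tw ^+ num_bd_faces col A
  * Tq ^+ num_bd_edges A * Tt ^+ num_shes A.

Definition Tinv G : ratfun :=
  \sum_(C in powerset (edges G)) Tmonomial G (cut G C).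

End Invariant.

(* Main.v *)
(** Everything is counted on points: vertices, connected components, faces,
    bubbles and boundary components are all classes of points under
    connectivity through some family of blocks (chords, pre-edges, strands,
    edges).  Cutting or contracting [e] changes the blocks only at [e], so the
    classes that stay away from [e] and its chords are literally the same sets
    before and after, and it remains to count the few classes that come near
    [e].

    Two facts control the latter.  First, an edge whose two end points of a
    given colour pair are also joined by a chord has an inner face there;
    otherwise the three strands give three outer paths, each made of one strand
    and two chords.  Secondly, a parity argument: the points whose colours lie
    in a given set of three colours meet each pre-edge in 0 or 2 points and are
    matched by chords and strands.  Hence a set of points closed under chords
    and under the pre-edges (or half-edges and strands) other than the pre-edge
    [p] contains all points of [p] or none.  So removing a pre-edge does not
    disconnect its vertex, all faces through a bridge are open, and the three
    boundary edges through a bridge lie in one boundary component on each side.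

    This gives the variation of every exponent of a term: for a non-loop,
    contraction only lowers [V] and [E] by one; for a trivial loop it adds 2 to
    [V] and [k], and 3 - 2p to the number of bubbles; cutting a bridge adds 1 to
    [k] and to the boundary components, 2 to the half-edges, and 3 to the
    bubbles and to the boundary edges and faces. *)

Require Import Defs.
From mathcomp Require Import all_boot all_order all_algebra.
From mathcomp Require Import zify ring.
From mathcomp Require mpoly.

Set Implicit Arguments.
Unset Strict Implicit.
Unset Printing Implicit Defensive.


(** * Components of a relation, and matchings *)

(** The recursion holds term by term. The sets of cut edges that avoid [e] index both sums, and
    cutting such a set commutes with contracting [e], so it is enough to compare one graph with its
    own contraction and with its own cut at [e]. The obstacle is that contraction destroys the local
    colour structure: a new vertex may have several pre-edges of one colour, and a new chord may
    join points of the same colour pair. The invariant [wf] keeps what survives: within a pre-edge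
    the second colours are distinct, strands preserve the ordered pair, and chords preserve the
    unordered one. All counts are derived from this. Vertices, components and bubbles are treated by
    one argument with two parameters: a family [Q] of blocks added to the chords, and a set [t] of
    allowed colours ([setT] for vertices and components, a triple for bubbles). For a bridge, the
    relation between cut and contraction is not proved directly: the same sum is evaluated in two
    ways, and the nonzero factor x - 1 is cancelled. *)

Section Components.

Variable U : finType.
Implicit Types (r : rel U) (A D K S : {set U}) (P : {set {set U}}).

(** This is the relation inside [comps], so that [compsE] holds by computation. It is reflexive even
    at points outside [A]; [cls] discards those. *)
Definition conn r A : rel U :=
  connect (fun x y => [&& x \in A, y \in A & r x y]).

Definition cls r A x : {set U} := [set y in A | conn r A x y].

Lemma compsE r A : comps r A = [set cls r A x | x in A].
Proof. by []. Qed.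

Lemma joined_sym P : symmetric (joined P).
Proof.
by move=> x y; apply: eq_existsb => B; rewrite [(x \in B) && _]andbC.
Qed.

Lemma joinedP P x y :
  reflect (exists2 B, B \in P & x \in B /\ y \in B) (joined P x y).
Proof.
apply: (iffP existsP) => [[B /and3P[PB Bx By]] | [B PB [Bx By]]]; exists B => //.
by apply/and3P.
Qed.

Lemma joined_setU P Q x y : joined (P :|: Q) x y = joined P x y || joined Q x y.
Proof.
apply/joinedP/orP => [[B] | [] /joinedP[B PB BB]].
- by rewrite inE => /orP[] PB BB; [left | right]; apply/joinedP; exists B.
- by exists B; rewrite // inE PB.
- by exists B; rewrite // inE PB orbT.
Qed.

Lemma meetsP A D : reflect (exists2 x, x \in A & x \in D) (meets A D).
Proof.
rewrite /meets -setI_eq0; apply: (iffP (set0Pn _)) => [[x]|[x Ax Dx]].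
  by rewrite inE => /andP[]; exists x.
by exists x; rewrite inE Ax.
Qed.

Lemma conn_refl r A x : conn r A x x.
Proof. exact: connect0. Qed.

Lemma conn_trans r A y x z : conn r A x y -> conn r A y z -> conn r A x z.
Proof. exact: connect_trans. Qed.

Lemma conn1 r A x y : x \in A -> y \in A -> r x y -> conn r A x y.
Proof. by move=> Ax Ay rxy; apply: connect1; rewrite Ax Ay. Qed.

(** Induction along a path, phrased with a set [K] closed under single steps. Most connectivity
    proofs below amount to finding the right [K]. *)
Lemma conn_closed r A K x y :
  (forall u v, u \in A -> v \in A -> r u v -> u \in K -> v \in K) ->
  conn r A x y -> x \in K -> y \in K.
Proof.
move=> clK /connectP[s]; elim: s x => [|z s IHs] x /=; first by move=> _ ->.
move=> /andP[/and3P[Ax Az rxz] pth] ey Kx.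
by apply: IHs pth ey _; apply: clK rxz Kx.
Qed.

Lemma conn_in r A x y : conn r A x y -> x \in A -> y \in A.
Proof. by apply: conn_closed => u v. Qed.

Lemma conn_sub r r' A A' :
  (forall u v, u \in A -> v \in A -> r u v -> conn r' A' u v) ->
  subrel (conn r A) (conn r' A').
Proof.
move=> sub; apply: connect_sub => u v /and3P[Au Av ruv]; exact: sub.
Qed.

Lemma conn_sym r A : symmetric r -> symmetric (conn r A).
Proof.
move=> sym; apply: sym_connect_sym => x y.
by rewrite sym andbCA.
Qed.

Lemma eq_conn r r' A :
  (forall u v, u \in A -> v \in A -> r u v = r' u v) -> conn r A =2 conn r' A.
Proof.
move=> eq_r; apply: eq_connect => u v; apply: andb_id2l => Au.
by apply: andb_id2l => Av; apply: eq_r.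
Qed.

Lemma eq_cls r A r' A' x : A = A' -> conn r A =2 conn r' A' ->
  cls r A x = cls r' A' x.
Proof. by move=> -> e; apply/setP=> y; rewrite !inE e. Qed.

Lemma eq_comps_conn r r' A : conn r A =2 conn r' A -> comps r A = comps r' A.
Proof. by move=> e; rewrite !compsE; apply: eq_imset => x; apply: eq_cls. Qed.

Lemma mem_cls r A x : x \in A -> x \in cls r A x.
Proof. by move=> Ax; rewrite inE Ax conn_refl. Qed.

Lemma eq_in_cls r A x y : symmetric r -> x \in A -> y \in A ->
  (cls r A x == cls r A y) = conn r A x y.
Proof.
move=> sym Ax Ay; apply/eqP/idP => [e|cxy].
  by move: (mem_cls r Ay); rewrite -e inE => /andP[].
apply/setP=> z; rewrite !inE; congr (_ && _).
apply/idP/idP; last exact: conn_trans.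
by apply: conn_trans; rewrite conn_sym.
Qed.

Lemma cls_eq r A x y : symmetric r -> x \in A -> y \in cls r A x ->
  cls r A y = cls r A x.
Proof.
move=> sym Ax; rewrite inE => /andP[Ay cxy].
by apply/esym/eqP; rewrite eq_in_cls.
Qed.

Lemma comps_cls r A K x : symmetric r -> K \in comps r A -> x \in K ->
  x \in A /\ K = cls r A x.
Proof.
move=> sym /imsetP[y Ay ->] yx; split; last by rewrite (cls_eq sym Ay yx).
by move: yx; rewrite inE => /andP[].
Qed.

Lemma mem_comps r A x : x \in A -> cls r A x \in comps r A.
Proof. exact: imset_f. Qed.

(* [D] is the zone in which the two relations may differ. *)
Lemma comps_clean r r' A A' D : symmetric r -> symmetric r' ->
  A :\: D = A' :\: D ->
  (forall x y, x \notin D -> x \in A ->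
    ((y \in A) && r x y) = ((y \in A') && r' x y)) ->
  [set K in comps r A | ~~ meets K D] = [set K in comps r' A' | ~~ meets K D].
Proof.
move=> sym sym' eqA eq_r.
(* The hypotheses are symmetric in the two sides, so one inclusion is proved for arbitrary relations
   and used twice. A class that avoids [D] is left by no step of the other relation either, hence it
   is the same set for both. *)
have key r1 r2 A1 A2 : symmetric r1 -> A1 :\: D = A2 :\: D ->
  (forall x y, x \notin D -> x \in A1 ->
    ((y \in A1) && r1 x y) = ((y \in A2) && r2 x y)) ->
  [set K in comps r1 A1 | ~~ meets K D] \subset comps r2 A2.
- move=> sym1 eqA1 eq_r1; apply/subsetP=> _ /setIdP[/imsetP[x A1x ->] noD].
  have offD y : y \in cls r1 A1 x -> y \notin D.
    by move=> xy; apply: contra noD => Dy; apply/meetsP; exists y.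
  have Dx : x \notin D by apply: offD; rewrite mem_cls.
  have A2x : x \in A2.
    by move/setP/(_ x): eqA1; rewrite !inE Dx A1x => /esym.
  rewrite compsE; apply/imsetP; exists x => //.
  have sub21 y : conn r2 A2 x y -> y \in cls r1 A1 x.
    move=> cxy; apply: (conn_closed _ cxy); last exact: mem_cls.
    move=> u v A2u A2v r2uv xu; have Du := offD _ xu.
    move: xu; rewrite !inE => /andP[A1u cu].
    have /andP[A1v r1uv] : (v \in A1) && r1 u v by rewrite eq_r1 // A2v.
    by rewrite A1v (conn_trans cu) // conn1.
  apply/setP=> y; apply/idP/idP => [xy|]; last first.
    by case/setIdP=> _ /sub21.
  move: (xy); rewrite inE => /andP[A1y cxy].
  apply: (conn_closed _ cxy); last exact: mem_cls.
  move=> u v A1u A1v r1uv; rewrite inE => /andP[A2u cu].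
  have Du : u \notin D by apply/offD/sub21.
  have /andP[A2v r2uv] : (v \in A2) && r2 u v by rewrite -eq_r1 // A1v.
  by rewrite inE A2v (conn_trans cu) // conn1.
apply/eqP; rewrite eqEsubset; apply/andP; split.
  apply/subsetP=> K KD; rewrite inE (subsetP (key _ _ _ _ sym eqA eq_r)) //.
  by move: KD; rewrite inE => /andP[].
apply/subsetP=> K KD; rewrite inE; apply/andP; split; last first.
  by move: KD; rewrite inE => /andP[].
apply: (subsetP (key _ _ _ _ sym' (esym eqA) _)) KD => x y Dx A'x.
by rewrite eq_r //; move/setP/(_ x): eqA; rewrite !inE Dx A'x.
Qed.

(** [S] is a system of representatives for the classes reaching [D]. The counts of the classes near
    an edge are obtained by exhibiting such an [S]. *)
Lemma card_comps_meets r A D S : symmetric r -> S \subset A ->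
  {in S, forall x, exists2 d, d \in D & conn r A x d} ->
  {in S &, forall x y, conn r A x y -> x = y} ->
  (forall d, d \in D -> d \in A -> exists2 x, x \in S & conn r A x d) ->
  #|[set K in comps r A | meets K D]| = #|S|.
Proof.
move=> sym /subsetP sSA SD injS onto.
rewrite -(@card_in_imset _ _ (cls r A) S); last first.
  move=> x y Sx Sy /eqP; rewrite eq_in_cls ?sSA //; exact: injS.
congr #|pred_of_set _|; apply/setP=> K; apply/setIdP/imsetP.
  move=> [cK /meetsP[d Kd Dd]]; have [Ad ->] := comps_cls sym cK Kd.
  have [x Sx cxd] := onto d Dd Ad; exists x => //.
  by apply/eqP; rewrite eq_sym eq_in_cls // sSA.
move=> [x Sx ->]; split; first by apply/mem_comps/sSA.
have [d Dd cxd] := SD x Sx; apply/meetsP; exists d => //.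
by rewrite inE (conn_in cxd) ?sSA.
Qed.

Lemma card_compsD r A D :
  #|comps r A| = (#|[set K in comps r A | ~~ meets K D]|
                  + #|[set K in comps r A | meets K D]|)%N.
Proof.
rewrite -(cardsID [set K | meets K D] (comps r A)) addnC.
by congr (_ + _)%N; apply: eq_card => K; rewrite !inE // andbC.
Qed.

End Components.

(* [g] induces a bijection between the two sets of components. *)
Lemma card_comps_map (U U' : finType) (r : rel U) (A : {set U})
    (r' : rel U') (A' : {set U'}) (g : U -> U') :
  symmetric r -> symmetric r' ->
  {in A, forall x, g x \in A'} ->
  {in A &, forall x y, conn r A x y = conn r' A' (g x) (g y)} ->
  {in A', forall y, exists2 x, x \in A & conn r' A' (g x) y} ->
  #|comps r A| = #|comps r' A'|.
Proof.
move=> sym sym' gA gconn gonto.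
pose h (K : {set U}) := [set y in A' | [exists x in K, conn r' A' (g x) y]].
have hE x : x \in A -> h (cls r A x) = cls r' A' (g x).
  move=> Ax; apply/setP=> y; rewrite !inE; apply: andb_id2l => A'y.
  apply/existsP/idP => [[z]|cy]; last by exists x; rewrite mem_cls.
  rewrite inE => /andP[/andP[Az cxz]]; apply: conn_trans.
  by rewrite -gconn.
have -> : comps r' A' = h @: comps r A.
  apply/setP=> K; apply/idP/imsetP => [/imsetP[y A'y ->]|[_ /imsetP[x Ax ->] ->]].
    have [x Ax cxy] := gonto y A'y; exists (cls r A x); first exact: mem_comps.
    by rewrite hE //; apply/eqP; rewrite eq_sym eq_in_cls // gA.
  by rewrite hE // mem_comps // gA.
apply/esym/card_in_imset => _ _ /imsetP[x Ax ->] /imsetP[y Ay ->].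
by rewrite !hE // => /eqP; rewrite eq_in_cls ?gA // -gconn // -eq_in_cls // => /eqP.
Qed.

(** * Partitions into pairs, seen as involutions, and parity of their unions *)

Section Mate.

Variable U : finType.
Implicit Types (A D K Z : {set U}) (P : {set {set U}}).

(** Partner of [x] in a partition into pairs. Off the partitioned set [pblock] is empty and the
    default [x] is returned, which makes the map an involution of the whole type. *)
Definition mate P (x : U) : U :=
  if [pick y in pblock P x | y != x] is Some y then y else x.

Lemma partition_block P D B x : partition P D -> B \in P -> x \in B -> x \in D.
Proof.
by move=> /and3P[/eqP<- _ _] PB Bx; apply/bigcupP; exists B.
Qed.

Lemma partition_subset P D B : partition P D -> B \in P -> B \subset D.
Proof. by move=> pP PB; apply/subsetP => x; apply: partition_block PB. Qed.

Section Pairs.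

Variables (P : {set {set U}}) (D : {set U}).
Hypotheses (pP : partition P D) (P2 : forall B, B \in P -> #|B| = 2).

Lemma mate_notin x : x \notin D -> mate P x = x.
Proof.
move=> Dx; rewrite /mate; case: pickP => // y /andP[] /[swap] _.
rewrite /pblock; case: pickP => /= [B /andP[PB Bx]|]; last by rewrite inE.
by rewrite (partition_block pP PB Bx) in Dx.
Qed.

Lemma mate_block x : x \in D -> pblock P x = [set x; mate P x] /\ mate P x != x.
Proof.
move=> Dx; have [/eqP cP tP _] := and3P pP.
have Bx : x \in pblock P x by rewrite mem_pblock cP.
have PB : pblock P x \in P by rewrite pblock_mem ?cP.
have /eqP/cards2P[a [b [nab eB]]] := P2 PB.
rewrite /mate eB; move: Bx; rewrite eB => /set2P xab.
case: pickP => [y /andP[/set2P yab yx]|no].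
  split=> //; case: xab yab yx => -> [] ->; rewrite ?eqxx // => _; exact: setUC.
by case: xab no => -> => [/(_ b)|/(_ a)]; rewrite !inE eqxx ?orbT //= ?nab // eq_sym nab.
Qed.

Lemma mate_neq x : x \in D -> mate P x != x.
Proof. by case/mate_block. Qed.

Lemma mate_pair x : x \in D -> [set x; mate P x] \in P.
Proof.
move=> Dx; have [<- _] := mate_block Dx; have [/eqP cP _ _] := and3P pP.
by rewrite pblock_mem ?cP.
Qed.

Lemma mate_in x : (mate P x \in D) = (x \in D).
Proof.
case: (boolP (x \in D)) => [Dx|Dx]; last by rewrite mate_notin // (negPf Dx).
by apply: (partition_block pP (mate_pair Dx)); rewrite !inE eqxx orbT.
Qed.

Lemma block_mate B x : B \in P -> x \in B -> B = [set x; mate P x].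
Proof.
move=> PB Bx; have [_ tP _] := and3P pP.
by have [<- _] := mate_block (partition_block pP PB Bx); rewrite (def_pblock tP PB Bx).
Qed.

Lemma mateK : involutive (mate P).
Proof.
move=> x; case: (boolP (x \in D)) => [Dx|Dx]; last by rewrite !(mate_notin Dx).
have mB : mate P x \in [set x; mate P x] by rewrite !inE eqxx orbT.
have xB : x \in [set x; mate P x] by rewrite !inE eqxx.
move: xB; rewrite {1}(block_mate (mate_pair Dx) mB) !inE eq_sym.
by rewrite (negPf (mate_neq Dx)) => /eqP.
Qed.

Lemma joined_mate x y :
  joined P x y = (x \in D) && ((y == x) || (y == mate P x)).
Proof.
apply/joinedP/andP => [[B PB [Bx By]]|[Dx yx]].
  split; first exact: (partition_block pP PB Bx).
  by move: By; rewrite (block_mate PB Bx) !inE.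
by exists [set x; mate P x]; rewrite ?mate_pair // !inE eqxx.
Qed.

End Pairs.

(** Converse of [mate]. The chords of a contraction are obtained in this form, from an explicit
    involution. *)
Lemma invol_partition (f : U -> U) D :
  {in D, forall x, f x \in D} -> {in D, forall x, f (f x) = x} ->
  {in D, forall x, f x != x} ->
  partition [set [set x; f x] | x in D] D /\
  (forall B, B \in [set [set x; f x] | x in D] -> #|B| = 2).
Proof.
move=> fD fK fN; split; last first.
  by move=> _ /imsetP[x Dx ->]; rewrite cards2 eq_sym fN.
apply/and3P; split.
- apply/eqP/setP=> x; apply/bigcupP/idP => [[_ /imsetP[y Dy ->]]|Dx].
    by rewrite !inE => /orP[]/eqP->; rewrite ?fD.
  by exists [set x; f x]; [apply/imsetP; exists x | rewrite !inE eqxx].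
- apply/trivIsetP=> _ _ /imsetP[x Dx ->] /imsetP[y Dy ->].
  apply: contraR => /meetsP[z]; rewrite !inE => /orP[]/eqP-> /orP[]/eqP.
  + by move->.
  + by move->; rewrite fK // setUC.
  + by move<-; rewrite fK // setUC.
  + by move/(congr1 f); rewrite !fK // => ->.
- apply/imsetP=> -[x Dx] /setP/(_ x); rewrite !inE eqxx; by [].
Qed.

Lemma card_trivIset_cover P Z : trivIset P -> Z \subset cover P ->
  #|Z| = (\sum_(B in P) #|B :&: Z|)%N.
Proof.
move=> tP /subsetP sZ; rewrite -sum1_card (eq_bigl (fun x => (x \in cover P) && (x \in Z))).
  rewrite big_trivIset_cond //; apply: eq_bigr => B _.
  by rewrite -sum1_card; apply: eq_bigl => x; rewrite inE.
by move=> x; apply/idP/andP => [Zx|[]//]; rewrite sZ.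
Qed.

Lemma even_trivIset P Z : trivIset P -> Z \subset cover P ->
  (forall B, B \in P -> ~~ odd #|B :&: Z|) -> ~~ odd #|Z|.
Proof.
move=> tP sZ ev; rewrite (card_trivIset_cover tP sZ).
apply: (big_ind (fun n => ~~ odd n)) => // m n; rewrite oddD.
by move=> /negPf-> /negPf->.
Qed.

Lemma partitionD P D (Q : {set {set U}}) : partition P D -> Q \subset P ->
  partition (P :\: Q) (D :\: cover Q).
Proof.
move=> /and3P[/eqP cP tP P0] /subsetP sQ; apply/and3P; split.
- apply/eqP/setP=> x; rewrite inE; apply/bigcupP/andP.
    move=> [B /setDP[PB QB] Bx]; split; last by rewrite -cP; apply/bigcupP; exists B.
    apply: contra QB => /bigcupP[C QC Cx].
    by rewrite -(def_pblock tP PB Bx) (def_pblock tP (sQ _ QC) Cx).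
  move=> [Qx]; rewrite -cP => /bigcupP[B PB Bx]; exists B => //.
  by rewrite inE PB andbT; apply: contra Qx => QB; apply/bigcupP; exists B.
- by apply: trivIsetS tP; apply: subsetDl.
- by rewrite inE (negPf P0) andbF.
Qed.

End Mate.

(** * Well-formed coloured stranded graphs *)

Section WellFormed.

Variables (T : finType) (col : T -> 'I_4 * 'I_4).
Implicit Types (G : sgraph T) (e p q : {set T}) (C : {set {set T}}).

Definition colors (x : T) : {set 'I_4} := [set (col x).1; (col x).2].

(* What is left of [hectg] after contractions.  The new chords may join points
   of equal colours [(i, j)], so a chord only preserves [colors]. *)
Record wf G : Prop := Wf {
  wf_pedges : partition (pedges G) (vpts G);
  wf_chords : partition (chords G) (vpts G);
  wf_chords2 : forall c, c \in chords G -> #|c| = 2;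
  wf_trivIset : trivIset (edges G);
  wf_ends : forall e, e \in edges G -> #|ends G e| = 2 /\ cover (ends G e) = e;
  wf_shes : shes G \subset pedges G;
  wf_disjoint : [disjoint cover (edges G) & cover (shes G)];
  wf_cover : cover (edges G) :|: cover (shes G) = vpts G;
  wf_strands : partition (strands G) (cover (edges G));
  wf_strand : forall s, s \in strands G -> exists2 e, e \in edges G &
    s \subset e /\ (forall p, p \in ends G e -> #|s :&: p| = 1);
  wf_col1 : forall p x y, p \in pedges G -> x \in p -> y \in p ->
    (col x).1 = (col y).1;
  wf_col2 : forall p x y, p \in pedges G -> x \in p -> y \in p ->
    (col x).2 = (col y).2 -> x = y;
  wf_card : forall p, p \in pedges G -> #|p| = 3;
  wf_neq : forall x, x \in vpts G -> (col x).1 != (col x).2;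
  wf_chord_colors : forall c x y, c \in chords G -> x \in c -> y \in c ->
    colors x = colors y;
  wf_strand_col : forall s x y, s \in strands G -> x \in s -> y \in s ->
    col x = col y
}.

Lemma color_pointsE t G : color_points col t G = [set x in vpts G | colors x \subset t].
Proof. by apply/setP=> x; rewrite !inE subUset !sub1set. Qed.

Lemma partition_nonempty (U : finType) (P : {set {set U}}) D B :
  partition P D -> B \in P -> exists x, x \in B.
Proof.
move=> /and3P[_ _ P0] PB; apply/set0Pn; apply: contraNneq P0 => <-; exact: PB.
Qed.

Lemma partition_eq (U : finType) (P : {set {set U}}) D A B x :
  partition P D -> A \in P -> B \in P -> x \in A -> x \in B -> A = B.
Proof.
by move=> /and3P[_ tP _] PA PB Ax Bx; rewrite -(def_pblock tP PA Ax) (def_pblock tP PB Bx).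
Qed.

Lemma partition_sub_eq (U : finType) (P : {set {set U}}) D A B :
  partition P D -> A \in P -> B \in P -> A \subset B -> A = B.
Proof.
move=> pP PA PB /subsetP sAB; have [x Ax] := partition_nonempty pP PA.
exact: partition_eq pP PA PB Ax (sAB _ Ax).
Qed.

Lemma colors_inj x y : (col x).1 = (col y).1 -> (col x).1 != (col x).2 ->
  (col y).1 != (col y).2 -> colors x = colors y -> col x = col y.
Proof.
rewrite /colors; case: (col x) (col y) => [i a] [j b] /= <- ia ib /setP e.
congr pair; apply/eqP; move: (e a); rewrite !inE eqxx orbT => /esym.
by rewrite eq_sym (negPf ia).
Qed.

Section HectgWf.

Variable G : sgraph T.
Hypothesis hG : hectg (D := 3) col G.
Let hesgG := hectg_hesg hG.
Let pP := pedges_partition hesgG.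
Let cP := chords_partition hesgG.
Let c2 := chords_pair hesgG.
Let aP := attached_partition hesgG.

Lemma pedge_attached p : p \in pedges G ->
  exists2 h, h \in edges G :|: shes G & p \subset h.
Proof.
move=> Pp; have [x px] := partition_nonempty pP Pp.
have : x \in vpts G := partition_block pP Pp px.
have [/eqP<- _ _] := and3P aP; case/bigcupP=> h hh hx; exists h => //.
move: hh; rewrite inE => /orP[hE|/(subsetP (shes_end hesgG)) hp]; last first.
  by rewrite (partition_eq pP Pp hp px hx).
have [_ cE] := edges_ends hesgG hE.
move: hx; rewrite -[in x \in h]cE => /bigcupP[q /setIdP[qp qh] qx].
by rewrite (partition_eq pP Pp qp px qx).
Qed.

Lemma vertex_sub v B : B \in pedges G :|: chords G -> v \in vertices G ->
  meets v B -> B \subset v.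
Proof.
move=> PB Vv /meetsP[x vx Bx].
have [Vx ->] := comps_cls (@joined_sym _ _) Vv vx.
have BV : B \subset vpts G.
  by move: PB; rewrite inE => /orP[] PB; apply: partition_subset PB.
apply/subsetP=> y By; rewrite inE (subsetP BV) //=.
by rewrite conn1 ?(subsetP BV) //; apply/joinedP; exists B.
Qed.

(** Properness compares distinct edges or sHEs, so it remains to exclude that both pre-edges are
    attached to the same one. That would be an edge with both ends at [v], and bipartiteness gives
    every edge two end vertices. *)
Lemma vertex_color v p p' x y : v \in vertices G -> p \in pedges G ->
  p' \in pedges G -> p \subset v -> p' \subset v -> p != p' ->
  x \in p -> y \in p' -> (col x).1 <> (col y).1.
Proof.
move=> Vv Pp Pp' pv pv' npp px py.
have [h hh ph] := pedge_attached Pp; have [h' hh' ph'] := pedge_attached Pp'.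
apply: (hectg_proper hG Vv hh hh'); last first.
- exact: (subsetP ph').
- exact: (subsetP ph).
- by apply/meetsP; exists y; [apply: (subsetP pv') | apply: (subsetP ph')].
- by apply/meetsP; exists x; [apply: (subsetP pv) | apply: (subsetP ph)].
apply/eqP=> eh; subst h'.
move: hh; rewrite inE => /orP[hE|/(subsetP (shes_end hesgG)) hp]; last first.
  case/eqP: npp; rewrite (partition_eq pP Pp hp px (subsetP ph _ px)).
  by rewrite (partition_eq pP Pp' hp py (subsetP ph' _ py)).
have [e2 cE] := edges_ends hesgG hE.
have endE : ends G h = [set p; p'].
  apply/esym/eqP; rewrite eqEcard e2 cards2 npp leqnn andbT.
  by apply/subsetP=> r /set2P[]->; rewrite inE ?Pp ?Pp'.
have hv : h \subset v.
  by rewrite -cE endE; apply/bigcupsP => r /set2P[]->.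
have [S SP] := hectg_bipartite hG.
have [S1 S2] := SP h hE; have := cardsID S (end_vertices G h).
rewrite S1 S2 => /esym/eqP; rewrite -[_ == _]negbK => /negP; apply.
suff : #|end_vertices G h| <= 1 by case: #|_| => [|[]].
rewrite -(cards1 v); apply/subset_leq_card/subsetP => w /setIdP[Vw /meetsP[z wz hz]].
have vz := subsetP hv _ hz.
have [_ ->] := comps_cls (@joined_sym _ _) Vw wz.
by have [_ <-] := comps_cls (@joined_sym _ _) Vv vz; rewrite inE.
Qed.

Lemma hectg_pedge_chord p c : p \in pedges G -> c \in chords G -> meets c p ->
  exists v x y p', [/\ v \in vertices G, c = [set x; y], x \in p,
    p' \in pedges G & [/\ y \in p', p != p', p \subset v, p' \subset v & (col x).2 = (col y).1]].
Proof.
move=> Pp Cc /meetsP[x cx px]; have Vx := partition_block cP Cc cx.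
have cE := block_mate cP c2 Cc cx; set y := mate _ x in cE.
have Vy : y \in vpts G by rewrite (mate_in cP c2).
have [] := and3P pP; move=> /eqP covp _ _.
have := Vy; rewrite -covp => /bigcupP[p' Pp' py].
exists (cls (joined (pedges G :|: chords G)) (vpts G) x), x, y, p'.
have Vv := mem_comps (joined (pedges G :|: chords G)) Vx.
have cv : c \subset cls (joined (pedges G :|: chords G)) (vpts G) x.
  by apply: vertex_sub; rewrite ?inE ?Cc ?orbT //; apply/meetsP; exists x; rewrite ?mem_cls.
have vy : y \in cls (joined (pedges G :|: chords G)) (vpts G) x.
  by apply: (subsetP cv); rewrite cE !inE eqxx orbT.
split=> //; split=> //.
- apply: contraL (hectg_noloop hG Cc Pp) => /eqP epp; rewrite negbK cE.
  by apply/subsetP=> z /set2P[]->; rewrite // epp.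
- by apply: vertex_sub; rewrite ?inE ?Pp //; apply/meetsP; exists x; rewrite ?mem_cls.
- by apply: vertex_sub; rewrite ?inE ?Pp' //; apply/meetsP; exists y.
- apply: (hectg_chord hG Cc) => //; first by rewrite cE !inE eqxx orbT.
  by rewrite eq_sym (mate_neq cP c2).
Qed.

Lemma hectg_wf : wf G.
Proof.
have endsP f : f \in edges G -> #|ends G f| = 2 /\ cover (ends G f) = f.
  exact: (edges_ends hesgG).
have [/eqP acov atriv _] := and3P aP.
split=> //.
- by apply: trivIsetS atriv; apply: subsetUl.
- exact: shes_end hesgG.
- rewrite -setI_eq0; apply/eqP/setP=> x; rewrite !inE; apply/negP=> /andP[].
  move=> /bigcupP[f fE fx] /bigcupP[h hh hx].
  have ef : f = h by apply: (partition_eq aP) fx hx; rewrite inE ?fE ?hh ?orbT.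
  have Ph := subsetP (shes_end hesgG) _ hh.
  have [f2 _] := endsP f fE; suff : #|ends G f| <= 1 by rewrite f2.
  rewrite -(cards1 h); apply/subset_leq_card/subsetP=> p /setIdP[Pp pf].
  by rewrite inE (partition_sub_eq pP Pp Ph) // -ef.
- by rewrite -acov /cover bigcup_setU.
- exact: strands_partition hesgG.
- exact: strands_edge hesgG.
- move=> p x y Pp px py; have [h hh ph] := pedge_attached Pp.
  by apply: (hectg_color hG hh); apply: (subsetP ph).
(* Equal second colours make the chords at [x] and [x2] lead to pre-edges of one colour at the same
   vertex, hence to the same pre-edge. The vertex graph has a single edge between two given
   pre-edges, so the two chords coincide, and a chord has only one point in [p]. *)
- move=> p x x2 Pp px px2 e2; apply/eqP; apply: contraT => nx.
  have Vx := partition_block pP Pp px; have Vx2 := partition_block pP Pp px2.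
  have Cx := mate_pair cP c2 Vx; have Cx2 := mate_pair cP c2 Vx2.
  have mx : meets [set x; mate (chords G) x] p.
    by apply/meetsP; exists x; rewrite // !inE eqxx.
  have mx2 : meets [set x2; mate (chords G) x2] p.
    by apply/meetsP; exists x2; rewrite // !inE eqxx.
  have [v [x' [y [p' [Vv cE px' Pp' [p'y npp' pv p'v e12]]]]]] := hectg_pedge_chord Pp Cx mx.
  have [v2 [x2' [y2 [p2' [Vv2 cE2 px2' Pp2' [p2'y npp2' pv2 p2'v2 e122]]]]]] := hectg_pedge_chord Pp Cx2 mx2.
  have uniqp z z' c : c \in chords G -> z \in c -> z' \in c -> z \in p -> z' \in p -> z = z'.
    move=> Cc cz cz' pz pz'; apply/eqP/negP => /negP nz.
    have /negP[] := hectg_noloop hG Cc Pp.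
    have /eqP/cards2P[a [b [nab cab]]] := c2 Cc.
    move: cz cz' nz; rewrite cab !inE => /orP[]/eqP ez /orP[]/eqP ez'; subst z z';
      rewrite ?eqxx // => _; apply/subsetP=> w /set2P[]->; assumption.
  have ex : x' = x.
    by apply: (uniqp _ _ _ Cx) => //; [rewrite cE|]; rewrite !inE eqxx.
  have ex2 : x2' = x2.
    by apply: (uniqp _ _ _ Cx2) => //; [rewrite cE2|]; rewrite !inE eqxx.
  subst x' x2'.
  have ev : v = v2.
    have [_ ->] := comps_cls (@joined_sym _ _) Vv (subsetP pv _ px).
    by have [_ <-] := comps_cls (@joined_sym _ _) Vv2 (subsetP pv2 _ px).
  subst v2; have epp : p' = p2'.
    apply/eqP; apply: contraT => npp.
    case: (vertex_color Vv Pp' Pp2' p'v p2'v2 npp p'y p2'y).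
    by rewrite -e12 -e122.
  subst p2'.
  have := hectg_complete hG Vv (p := p) (p' := p').
  rewrite !inE Pp Pp' pv p'v => /(_ isT isT npp') /eqP/cards1P[c cs].
  have inc z w : [set z; w] \in chords G -> z \in p -> w \in p' -> [set z; w] = c.
    move=> Cc pz p'w; apply/set1P; rewrite -cs inE Cc /=.
    by apply/andP; split; apply/meetsP; [exists z | exists w]; rewrite // !inE eqxx ?orbT.
  rewrite cE in Cx; rewrite cE2 in Cx2.
  case/eqP: nx; apply: (uniqp _ _ _ Cx) => //; first by rewrite !inE eqxx.
  by rewrite (inc _ _ Cx px p'y) -(inc _ _ Cx2 px2 p2'y) !inE eqxx.
- exact: (hectg_pedges hG).
(* The chord at [x] leads to another pre-edge of the same vertex, whose colour is different by
   [vertex_color]. *)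
- move=> x Vx; have [] := and3P pP; move=> /eqP covp _ _.
  have := Vx; rewrite -covp => /bigcupP[p Pp px].
  have Cx := mate_pair cP c2 Vx.
  have mx : meets [set x; mate (chords G) x] p.
    by apply/meetsP; exists x; rewrite // !inE eqxx.
  have [v [x' [y [p' [Vv cE px' Pp' [p'y npp' pv p'v e12]]]]]] := hectg_pedge_chord Pp Cx mx.
  have := vertex_color Vv Pp Pp' pv p'v npp' px' p'y; rewrite -e12 => /eqP.
  have : x \in [set x'; y] by rewrite -cE !inE eqxx.
  case/set2P=> exy; subst x => //.
  case/eqP: npp'; exact: partition_eq pP Pp Pp' px p'y.
- move=> c x y Cc cx cy; case: (eqVneq x y) => [->//|nxy].
  apply/setP=> i; rewrite !inE (hectg_chord hG Cc cx cy nxy).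
  by rewrite -(hectg_chord hG Cc cy cx) 1?eq_sym // orbC.
- exact: (hectg_strand hG).
Qed.

End HectgWf.

Lemma subset_cover_trivIset (U : finType) (P C : {set {set U}}) B x :
  trivIset P -> C \subset P -> B \in P -> x \in B -> (x \in cover C) = (B \in C).
Proof.
move=> tP /subsetP sC PB Bx; apply/bigcupP/idP => [[B' CB' B'x]|]; last by exists B.
by rewrite -(def_pblock tP PB Bx) (def_pblock tP (sC _ CB') B'x).
Qed.

(** * Well-formed graphs under cutting *)

Section Edge.

Variable G : sgraph T.
Hypothesis wfG : wf G.

Lemma wf_strands2 s : s \in strands G -> #|s| = 2.
Proof.
move=> Ss; have [e eE [se ep]] := wf_strand wfG Ss.
have [/eqP/cards2P[p [q [npq epq]]] cE] := wf_ends wfG eE.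
have Pp : p \in ends G e by rewrite epq !inE eqxx.
have Pq : q \in ends G e by rewrite epq !inE eqxx orbT.
have -> : s = (s :&: p) :|: (s :&: q).
  rewrite -setIUr; apply/esym/setIidPl; apply: subset_trans se _.
  by rewrite -cE epq; apply/subsetP=> x /bigcupP[r /set2P[]->]; rewrite inE => ->; rewrite ?orbT.
rewrite cardsU (ep _ Pp) (ep _ Pq); suff -> : s :&: p :&: (s :&: q) = set0 by rewrite cards0.
apply/eqP/set0Pn=> -[x]; rewrite !inE => /andP[/andP[_ px] /andP[_ qx]].
move: Pp Pq; rewrite !inE => /andP[Pp _] /andP[Pq _].
by case/eqP: npq; apply: partition_eq (wf_pedges wfG) Pp Pq px qx.
Qed.

Lemma edge_two_ends e : e \in edges G -> exists p q,
  [/\ p \in pedges G, q \in pedges G, p != q, ends G e = [set p; q] & e = p :|: q].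
Proof.
move=> eE; have [/eqP/cards2P[p [q [npq epq]]] cE] := wf_ends wfG eE.
exists p, q.
have /setIdP[Pp _] : p \in ends G e by rewrite epq !inE eqxx.
have /setIdP[Pq _] : q \in ends G e by rewrite epq !inE eqxx orbT.
split=> //; rewrite -cE epq; apply/setP=> x; apply/bigcupP/setUP.
  by case=> r /set2P[]->; [left | right].
by case; [exists p | exists q]; rewrite // !inE eqxx ?orbT.
Qed.

Lemma cover_ends C : C \subset edges G -> cover (\bigcup_(e in C) ends G e) = cover C.
Proof.
move=> /subsetP CE; apply/setP=> x; apply/bigcupP/bigcupP=> [[p /bigcupP[e Ce pe] px]|[e Ce ex]].
  by exists e => //; move: pe; rewrite inE => /andP[_ /subsetP]; apply.
have [_ cE] := wf_ends wfG (CE _ Ce).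
move: ex; rewrite -[in x \in e]cE => /bigcupP[p pe px]; exists p => //.
by apply/bigcupP; exists e.
Qed.

Lemma cover_setU (P Q : {set {set T}}) : cover (P :|: Q) = cover P :|: cover Q.
Proof. by rewrite /cover bigcup_setU. Qed.

Lemma cover_edgesD C : C \subset edges G ->
  cover (edges G :\: C) = cover (edges G) :\: cover C.
Proof.
move=> CE; apply/setP=> x; rewrite inE; apply/bigcupP/andP => [[e /setDP[eE nC] ex]|[nC]].
  rewrite (subset_cover_trivIset (wf_trivIset wfG) CE eE ex) nC; split=> //.
  by apply/bigcupP; exists e.
move=> /bigcupP[e eE ex]; exists e => //; rewrite inE eE andbT.
by rewrite -(subset_cover_trivIset (wf_trivIset wfG) CE eE ex).
Qed.

Lemma cut_wf C : C \subset edges G -> wf (cut G C).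
Proof.
move=> CE; have sC := subsetP CE.
(* A strand lies in a single edge, so the strands removed are those inside the union of the cut
   edges. They form a subfamily of a partition whose union is known, as [partitionD] requires. *)
have SE : [set s in strands G | [forall e in C, ~~ (s \subset e)]] =
    strands G :\: [set s in strands G | s \subset cover C].
  apply/setP=> s; rewrite !inE; case: (boolP (s \in strands G)) => Ss; rewrite ?andbF //=.
  rewrite andbT -[LHS]negbK negb_forall; congr (~~ _); apply/existsP/subsetP.
    move=> [e]; rewrite negb_imply negbK => /andP[Ce /subsetP se] x sx.
    by apply/bigcupP; exists e; rewrite ?se.
  move=> sCov; have [f fE [sf _]] := wf_strand wfG Ss; exists f.
  rewrite negb_imply negbK sf andbT.
  have [x sx] := partition_nonempty (wf_strands wfG) Ss.
  by rewrite -(subset_cover_trivIset (wf_trivIset wfG) CE fE (subsetP sf _ sx)) sCov.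
have covS : cover [set s in strands G | s \subset cover C] = cover C.
  apply/setP=> x; apply/bigcupP/idP => [[s /setIdP[_ /subsetP ss] /ss]//|xC].
  have [/eqP cS _ _] := and3P (wf_strands wfG).
  have [e Ce ex] := bigcupP xC.
  have : x \in cover (strands G) by rewrite cS; apply/bigcupP; exists e; rewrite ?sC.
  case/bigcupP=> s Ss sx; exists s => //; rewrite inE Ss.
  have [f fE [sf _]] := wf_strand wfG Ss.
  have fx := subsetP sf _ sx.
  apply: subset_trans sf _; apply: (bigcup_max f) => //.
  by rewrite -(subset_cover_trivIset (wf_trivIset wfG) CE fE fx).
split; try by case: wfG.
- by apply: trivIsetS (wf_trivIset wfG); apply: subsetDl.
- by move=> e /setDP[eE _]; apply: (wf_ends wfG).
- rewrite /= subUset (wf_shes wfG); apply/bigcupsP=> e Ce.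
  by apply/subsetP=> p /setIdP[].
- rewrite /= cover_setU cover_ends // cover_edgesD //.
  apply/pred0P=> x /=; rewrite !inE; apply/negP=> /andP[/andP[nC Ex]].
  rewrite (negPf nC) orbF => Sx.
  by have /pred0P/(_ x)/= := wf_disjoint wfG; rewrite Ex Sx.
- rewrite /= cover_setU cover_ends // cover_edgesD // -(wf_cover wfG).
  apply/setP=> x; rewrite !inE; case: (boolP (x \in cover C)) => //= xC.
    have [e Ce ex] := bigcupP xC; rewrite orbT; apply/esym/orP; left.
    by apply/bigcupP; exists e; rewrite ?sC.
  by rewrite orbF.
- rewrite /= SE cover_edgesD //.
  set SC := [set s in _ | _] in covS *.
  by rewrite -covS; apply: partitionD (wf_strands wfG) _; apply/subsetP=> s /setIdP[].
- move=> s; rewrite /= inE => /andP[Ss /forallP sC'].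
  have [e eE [se ep]] := wf_strand wfG Ss; exists e => //.
  rewrite inE eE andbT; apply/negP=> Ce; move: (sC' e); by rewrite Ce se.
- by move=> s x y /setIdP[Ss _]; apply: (wf_strand_col wfG).
Qed.

End Edge.

End WellFormed.

(** * Contraction of an edge *)

Section Mates.

Variables (T : finType) (col : T -> 'I_4 * 'I_4) (G : sgraph T).
Hypothesis wfG : wf col G.

Notation chi := (mate (chords G)).
Notation sig := (mate (strands G)).
Let cP := wf_chords wfG.
Let c2 := wf_chords2 wfG.
Let sP := wf_strands wfG.
Let s2 := wf_strands2 wfG.
Let pP := wf_pedges wfG.

Lemma chiK : involutive chi. Proof. exact: mateK cP c2. Qed.
Lemma sigK : involutive sig. Proof. exact: mateK sP s2. Qed.
Lemma chi_in x : (chi x \in vpts G) = (x \in vpts G).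
Proof. exact: (mate_in cP c2). Qed.
Lemma chi_neq x : x \in vpts G -> chi x != x.
Proof. exact: (mate_neq cP c2). Qed.

Lemma colors_chi x : colors col (chi x) = colors col x.
Proof.
case: (boolP (x \in vpts G)) => Vx; last by rewrite (mate_notin cP).
by apply: (wf_chord_colors wfG (mate_pair cP c2 Vx)); rewrite !inE eqxx ?orbT.
Qed.

Lemma col_sig x : col (sig x) = col x.
Proof.
case: (boolP (x \in cover (edges G))) => Ex; last by rewrite (mate_notin sP).
by apply: (wf_strand_col wfG (mate_pair sP s2 Ex)); rewrite !inE eqxx ?orbT.
Qed.

Lemma colors_sig x : colors col (sig x) = colors col x.
Proof. by rewrite /colors col_sig. Qed.

Lemma cover_edges_vpts x : x \in cover (edges G) -> x \in vpts G.
Proof. by rewrite -(wf_cover wfG) inE => ->. Qed.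

Lemma sig_in x : (sig x \in vpts G) = (x \in vpts G).
Proof.
case: (boolP (x \in cover (edges G))) => Ex; last by rewrite (mate_notin sP).
by rewrite !cover_edges_vpts ?(mate_in sP s2).
Qed.

Lemma chi_color_points t x : (chi x \in color_points col t G) = (x \in color_points col t G).
Proof. by rewrite !color_pointsE !inE chi_in colors_chi. Qed.

Lemma sig_color_points t x : (sig x \in color_points col t G) = (x \in color_points col t G).
Proof. by rewrite !color_pointsE !inE sig_in colors_sig. Qed.

(** The first colour is constant on a pre-edge, so the unordered pair determines the second colour
    and with it the point. *)
Lemma col_pedge_inj p x y : p \in pedges G -> x \in p -> y \in p ->
  colors col x = colors col y -> x = y.
Proof.
move=> Pp px py exy; apply: (wf_col2 wfG Pp px py); congr (_.2).
have N z : z \in p -> (col z).1 != (col z).2.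
  by move=> pz; apply: (wf_neq wfG (partition_block pP Pp pz)).
exact: colors_inj (wf_col1 wfG Pp px py) (N _ px) (N _ py) exy.
Qed.

Lemma edge_uniq e f x : e \in edges G -> f \in edges G -> x \in e -> x \in f -> e = f.
Proof.
by move=> eE fE ex fx; rewrite -(def_pblock (wf_trivIset wfG) eE ex) (def_pblock (wf_trivIset wfG) fE fx).
Qed.

Lemma edge_cover e x : e \in edges G -> x \in e -> x \in cover (edges G).
Proof. by move=> eE ex; apply/bigcupP; exists e. Qed.

Lemma sig_edge e x : e \in edges G -> (sig x \in e) = (x \in e).
Proof.
move=> eE; have key y : y \in e -> sig y \in e.
  move=> ey; have Sy := mate_pair sP s2 (edge_cover eE ey).
  have [f fE [/subsetP sf _]] := wf_strand wfG Sy.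
  have -> : e = f by apply: (edge_uniq eE fE ey); apply: sf; rewrite !inE eqxx.
  by apply: sf; rewrite !inE eqxx orbT.
by apply/idP/idP => [/key|/key//]; rewrite sigK.
Qed.

Lemma sig_neq x : x \in cover (edges G) -> sig x != x.
Proof. exact: (mate_neq sP s2). Qed.

Lemma strand_sub e s x : e \in edges G -> s \in strands G -> x \in s -> x \in e -> s \subset e.
Proof.
move=> eE Ss sx ex; have [f fE [sf _]] := wf_strand wfG Ss.
by rewrite (edge_uniq eE fE ex (subsetP sf _ sx)).
Qed.

Lemma pedge_uniq p q x : p \in pedges G -> q \in pedges G -> x \in p -> x \in q -> p = q.
Proof. by move=> Pp Pq px qx; apply: partition_eq pP Pp Pq px qx. Qed.

End Mates.

(** The ends are named once for all: strands of [e] are indexed by their points in [p], and the same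
    [p] and [q] serve in every cut of [G] that keeps [e]. *)
Record edge_spec (T : finType) (col : T -> 'I_4 * 'I_4) (G : sgraph T)
    (e p q : {set T}) : Prop := EdgeSpec {
  es_wf : wf col G;
  es_edge : e \in edges G;
  es_p : p \in pedges G;
  es_q : q \in pedges G;
  es_neq : p != q;
  es_ends : ends G e = [set p; q];
  es_eq : e = p :|: q
}.

Section Contract.

Variables (T : finType) (col : T -> 'I_4 * 'I_4) (G : sgraph T) (e p q : {set T}).
Hypothesis H : edge_spec col G e p q.

Let wfG := es_wf H.
Let eE := es_edge H.
Let Pp := es_p H.
Let Pq := es_q H.
Let npq := es_neq H.
Let endsE := es_ends H.
Let eU := es_eq H.

Notation chi := (mate (chords G)).
Notation sig := (mate (strands G)).
Let cP := wf_chords wfG.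
Let c2 := wf_chords2 wfG.
Let sP := wf_strands wfG.
Let s2 := wf_strands2 wfG.
Let pP := wf_pedges wfG.

Lemma end_p_edge x : x \in p -> x \in e. Proof. by rewrite eU inE => ->. Qed.
Lemma end_q_edge x : x \in q -> x \in e. Proof. by rewrite eU inE orbC => ->. Qed.

Lemma edge_in_vpts x : x \in e -> x \in vpts G.
Proof. by move=> ex; apply: (cover_edges_vpts wfG); apply: edge_cover ex. Qed.

Lemma ends_disjoint x : x \in p -> x \notin q.
Proof. by move=> px; apply: contra npq => qx; rewrite (pedge_uniq wfG Pp Pq px qx). Qed.

Lemma sig_end x : x \in e -> (sig x \in p) = (x \in q).
Proof.
move=> ex; have Sx := mate_pair sP s2 (edge_cover eE ex).
have [f fE [sf sp]] := wf_strand wfG Sx.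
have ef : e = f by apply: (edge_uniq wfG eE fE ex); apply: (subsetP sf); rewrite !inE eqxx.
subst f; have [p1 q1] : #|[set x; sig x] :&: p| = 1 /\ #|[set x; sig x] :&: q| = 1.
  by split; apply: sp; rewrite endsE !inE eqxx ?orbT.
have nxs : x != sig x by rewrite eq_sym (sig_neq wfG) // (edge_cover eE).
have es : sig x \in e by rewrite (sig_edge wfG).
have two (r : {set T}) : x \in r -> sig x \in r -> #|[set x; sig x] :&: r| <> 1.
  move=> rx rs; rewrite (setIidPl _) ?cards2 ?nxs //.
  by apply/subsetP=> z /set2P[]->.
move: ex es; rewrite eU !inE; case: (boolP (x \in p)) => /= [px _|px qx].
  rewrite (negPf (ends_disjoint px)).
  by case: (boolP (sig x \in p)) => // ps; case: (two _ px ps).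
rewrite qx; case: (boolP (sig x \in p)) => //= _ qs; by case: (two _ qx qs).
Qed.

Lemma edge_col1 x y : x \in e -> y \in e -> (col x).1 = (col y).1.
Proof.
have key z : z \in e -> exists2 w, w \in p & (col z).1 = (col w).1.
  rewrite {1}eU inE => /orP[pz|qz]; first by exists z.
  exists (sig z); last by rewrite (col_sig wfG).
  by rewrite sig_end ?end_q_edge.
move=> /key[w pw ->] /key[w' pw' ->]; exact: (wf_col1 wfG Pp).
Qed.

(** Each end has at most one point of a given colour pair, and a strand preserves colours while
    exchanging the ends. *)
Lemma edge_colors x y : x \in e -> y \in e -> colors col x = colors col y ->
  y = x \/ y = sig x.
Proof.
move=> ex ey exy.
have key r : r \in pedges G -> x \in r -> y \in r -> y = x.
  by move=> Pr rx ry; apply: (col_pedge_inj wfG Pr).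
have keys r : r \in pedges G -> sig x \in r -> y \in r -> y = sig x.
  by move=> Pr rx ry; apply: (col_pedge_inj wfG Pr) => //; rewrite (colors_sig wfG).
move: (ex) (ey); rewrite {1 2}eU !inE => /orP[px|qx] /orP[py|qy].
- by left; apply: key px py.
- have es : sig x \in e by rewrite (sig_edge wfG).
  by right; apply: (keys q) => //; rewrite -(sig_end es) (sigK wfG).
- by right; apply: (keys p) => //; rewrite sig_end.
- by left; apply: key qx qy.
Qed.

(** A chord preserves the unordered pair, so inside [e] it can only lead to the other end of the
    strand. Hence an inner face is one strand doubled by one chord, and p-inner means that p of the
    three strands are doubled. *)
Lemma inner_chord x : x \in e -> chi x \in e -> chi x = sig x.
Proof.
move=> ex ecx; have := edge_colors ex ecx; rewrite (colors_chi wfG) => /(_ erefl)[] // e'.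
by have := chi_neq wfG (edge_in_vpts ex); rewrite e' eqxx.
Qed.

Lemma chi_sig_edge x : x \in e -> (chi (sig x) \in e) = (chi x \in e).
Proof.
have key y : y \in e -> chi y \in e -> chi (sig y) \in e.
  by move=> ey ecy; rewrite -(inner_chord ey ecy) (chiK wfG).
move=> ex; apply/idP/idP => [|/(key _ ex)//].
by move=> h; have := key (sig x); rewrite (sig_edge wfG) // (sigK wfG); apply.
Qed.

Lemma cover_edge_strands : cover (edge_strands G e) = e.
Proof.
apply/setP=> x; apply/bigcupP/idP => [[s /setIdP[_ /subsetP se] /se//]|ex].
have Ex := edge_cover eE ex; exists [set x; sig x]; last by rewrite !inE eqxx.
rewrite inE (mate_pair sP s2 Ex); apply/subsetP=> z /set2P[]->//.
by rewrite (sig_edge wfG).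
Qed.

Lemma edge_chordsE c : (c \in edge_chords G e) = (c \in chords G) && meets c e.
Proof. by rewrite inE cover_edge_strands. Qed.

Let sc := edge_strands G e :|: edge_chords G e.

Lemma joined_edge_strands x y : joined (edge_strands G e) x y =
  (x \in e) && ((y == x) || (y == sig x)).
Proof.
apply/joinedP/andP => [[s /setIdP[Ss /subsetP se] [sx sy]]|[ex yx]].
  split; first exact: se.
  by move: sy; rewrite (block_mate sP s2 Ss sx) !inE.
exists [set x; sig x]; last by rewrite !inE eqxx.
rewrite inE (mate_pair sP s2) ?(edge_cover eE) //=; apply/subsetP=> z /set2P[]->//.
by rewrite (sig_edge wfG).
Qed.

Lemma joined_edge_chords x y : joined (edge_chords G e) x y =
  ((x \in e) || (chi x \in e)) && ((y == x) || (y == chi x)).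
Proof.
apply/joinedP/andP => [[c + [cx cy]]|[exc yx]].
  rewrite edge_chordsE => /andP[Cc /meetsP[z cz ez]].
  have cE := block_mate cP c2 Cc cx; split; last by move: cy; rewrite cE !inE.
  by move: cz; rewrite cE => /set2P[] <-; rewrite ez ?orbT.
exists [set x; chi x]; last by rewrite !inE eqxx.
rewrite edge_chordsE; apply/andP; split.
  apply: (mate_pair cP c2); case/orP: exc => [|/edge_in_vpts]; first exact: edge_in_vpts.
  by rewrite (chi_in wfG).
by apply/meetsP; case/orP: exc => ez; [exists x | exists (chi x)]; rewrite // !inE eqxx ?orbT.
Qed.

(** Component of strands and chords at [x]: the path with successive points [chi x], [x], [sig x],
    [chi (sig x)]. For an inner face it collapses to the two points of the strand. *)
Definition edge_block x : {set T} := x |: (sig x |: (chi x |: [set chi (sig x)])).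

Lemma cover_sc x : (x \in cover sc) = (x \in e) || (chi x \in e).
Proof.
rewrite cover_setU inE cover_edge_strands; case: (boolP (x \in e)) => //= nx.
have := joined_edge_chords x x; rewrite eqxx (negPf nx) /= andbT => <-.
by apply/bigcupP/joinedP => [[c cc cx]|[c cc [cx _]]]; exists c.
Qed.

Lemma edge_block_cls x : x \in e -> cls (joined sc) (cover sc) x = edge_block x.
Proof.
move=> ex; have es : sig x \in e by rewrite (sig_edge wfG).
have cov : {in edge_block x, forall z, z \in cover sc}.
  move=> z; rewrite !inE cover_sc => /or4P[] /eqP->; rewrite ?ex ?es ?(chiK wfG) ?ex ?es ?orbT //.
have js u : u \in e -> joined sc u (sig u).
  by move=> eu; rewrite joined_setU joined_edge_strands eu eqxx orbT.
have jc u : u \in e -> joined sc u (chi u).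
  by move=> eu; rewrite joined_setU joined_edge_chords eu eqxx !orbT.
have cx : x \in cover sc by rewrite cover_sc ex.
have csx : sig x \in cover sc by rewrite cover_sc es.
have ccx : chi x \in cover sc by rewrite cover_sc (chiK wfG) ex orbT.
have ccsx : chi (sig x) \in cover sc by rewrite cover_sc (chiK wfG) es orbT.
have xsx : conn (joined sc) (cover sc) x (sig x) by apply: conn1 => //; apply: js.
apply/setP=> z; apply/idP/idP => [/setIdP[_ cxz]|zK]; last first.
  rewrite inE cov //=; move: zK; rewrite !inE => /or4P[]/eqP->.
  - exact: conn_refl.
  - exact: xsx.
  - by apply: conn1 => //; apply: jc.
  - by apply: conn_trans xsx _; apply: conn1 => //; apply: jc.
apply: (conn_closed _ cxz); last by rewrite !inE eqxx.
move=> u v _ _; rewrite joined_setU joined_edge_strands joined_edge_chords.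
move=> /orP[/andP[eu /orP[]/eqP->//]|/andP[_ /orP[]/eqP->//]].
  move: eu => /[swap]; rewrite !inE => /or4P[]/eqP-> eu; rewrite ?(sigK wfG) ?eqxx ?orbT //.
    by rewrite (inner_chord ex eu) (sigK wfG) eqxx.
  have := inner_chord es eu; rewrite (sigK wfG) => ->; by rewrite eqxx orbT.
by rewrite !inE => /or4P[]/eqP->; rewrite ?(chiK wfG) ?eqxx ?orbT.
Qed.

Lemma edge_compsE : edge_comps G e = [set edge_block x | x in e].
Proof.
apply/setP=> K; apply/imsetP/imsetP => [[x cx ->]|[x ex ->]].
  rewrite -/sc in cx *; move: (cx); rewrite cover_sc => /orP[ex|ecx].
    by exists x => //; rewrite -edge_block_cls.
  exists (chi x) => //; rewrite -edge_block_cls // -/(cls (joined sc) (cover sc) x).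
  apply/eqP; rewrite eq_in_cls ?cover_sc ?ecx ?orbT //; last exact: joined_sym.
  apply: conn1; rewrite ?cover_sc ?ecx ?orbT //.
  by rewrite joined_setU joined_edge_chords ecx eqxx !orbT.
exists x; first by rewrite -/sc cover_sc ex.
by rewrite -edge_block_cls.
Qed.

Lemma edge_block_inner x : x \in e -> (edge_block x \subset e) = (chi x \in e).
Proof.
move=> ex; rewrite !subUset !sub1set ex (sig_edge wfG) // ex (chi_sig_edge ex).
by rewrite andbb.
Qed.

Lemma edge_block_innerE x : x \in e -> chi x \in e -> edge_block x = [set x; sig x].
Proof.
move=> ex ecx; have es : sig x \in e by rewrite (sig_edge wfG).
apply/setP=> z; rewrite !inE (inner_chord ex ecx) (inner_chord es) ?chi_sig_edge //.
by rewrite (sigK wfG); case: (z == x); case: (z == sig x).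
Qed.

Lemma edge_block_outerE x : x \in e -> chi x \notin e ->
  edge_block x :\: e = [set chi x; chi (sig x)].
Proof.
move=> ex ecx; have es : sig x \in e by rewrite (sig_edge wfG).
have ecs : chi (sig x) \notin e by rewrite chi_sig_edge.
apply/setP=> z; rewrite !inE; case: (eqVneq z x) => [->|nx] /=.
  rewrite ex /=; apply/esym/negP=> /orP[]/eqP h; [move: ecx|move: ecs]; by rewrite -h ex.
case: (eqVneq z (sig x)) => [->|ns] /=.
  rewrite es /=; apply/esym/negP=> /orP[]/eqP h; [move: ecx|move: ecs]; by rewrite -h es.
by case: (eqVneq z (chi x)) => [->|_] /=; [rewrite ecx | case: (eqVneq z (chi (sig x))) => [->|]; rewrite ?ecs ?andbF].
Qed.

Lemma edge_block_sig x : edge_block (sig x) = edge_block x.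
Proof.
apply/setP=> z; rewrite !inE (sigK wfG).
by case: (z == x); case: (z == sig x); case: (z == chi x); case: (z == chi (sig x)).
Qed.

Definition inner_points : {set T} := [set x in p | chi x \in e].
Definition outer_points : {set T} := [set x in p | chi x \notin e].

Lemma edge_block_imset : [set edge_block x | x in e] = [set edge_block x | x in p].
Proof.
apply/setP=> K; apply/imsetP/imsetP => [[x ex ->]|[x px ->]]; last first.
  by exists x => //; apply: end_p_edge.
case: (boolP (x \in p)) => [px|np]; first by exists x.
exists (sig x); last by rewrite edge_block_sig.
by rewrite sig_end //; move: ex; rewrite eU inE (negPf np).
Qed.

Lemma edge_block_inj : {in p &, injective edge_block}.
Proof.
move=> x y px py exy; apply: (col_pedge_inj wfG Pp) => //.
have : x \in edge_block y by rewrite -exy !inE eqxx.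
by rewrite !inE => /or4P[]/eqP->; rewrite ?(colors_chi wfG) ?(colors_sig wfG).
Qed.

Lemma inner_facesE : inner_faces G e = [set edge_block x | x in inner_points].
Proof.
apply/setP=> K; rewrite inE edge_compsE edge_block_imset.
apply/andP/imsetP => [[/imsetP[x px ->]]|[x /setIdP[px ecx] ->]].
  by rewrite (edge_block_inner (end_p_edge px)) => ecx; exists x; rewrite // inE px.
by rewrite imset_f // (edge_block_inner (end_p_edge px)).
Qed.

Lemma outer_pathsE : outer_paths G e = [set edge_block x | x in outer_points].
Proof.
apply/setP=> K; rewrite inE edge_compsE edge_block_imset.
apply/andP/imsetP => [[/imsetP[x px ->]]|[x /setIdP[px ecx] ->]].
  by rewrite (edge_block_inner (end_p_edge px)) => ecx; exists x; rewrite // inE px.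
by rewrite imset_f // (edge_block_inner (end_p_edge px)).
Qed.

Lemma inner_numberE : inner_number G e = #|inner_points|.
Proof.
rewrite /inner_number inner_facesE card_in_imset // => x y /setIdP[px _] /setIdP[py _].
exact: edge_block_inj.
Qed.

Lemma card_inner_outer : #|inner_points| + #|outer_points| = 3.
Proof.
rewrite -(wf_card wfG Pp) -(cardsID [set x | chi x \in e] p).
by congr (_ + _); apply: eq_card => x; rewrite !inE // andbC.
Qed.

(** Partner of [x] for the chords of the contraction: a chord that enters [e] is continued along the
    strand and out by the chord at its other end. One passage suffices, since by [chi_sig_edge] that
    chord leaves [e] when [x] is outside [e]. *)
Definition chi' x := if chi x \in e then chi (sig (chi x)) else chi x.

Lemma chi'_notin x : x \in vpts G :\: e -> chi' x \in vpts G :\: e.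
Proof.
move=> /setDP[Vx nx]; rewrite /chi'; case: ifP => ecx.
  by rewrite inE chi_sig_edge // (chiK wfG) nx (chi_in wfG) (sig_in wfG) (chi_in wfG).
by rewrite inE ecx (chi_in wfG).
Qed.

Lemma chi'K x : x \in vpts G :\: e -> chi' (chi' x) = x.
Proof.
move=> /setDP[Vx nx]; rewrite /chi'; case: (boolP (chi x \in e)) => ecx.
  by rewrite (chiK wfG) (sig_edge wfG) // ecx (sigK wfG) (chiK wfG).
by rewrite (chiK wfG) (negPf nx).
Qed.

Lemma chi'_neq x : x \in vpts G :\: e -> chi' x != x.
Proof.
move=> /setDP[Vx nx]; rewrite /chi'; case: ifP => ecx; last exact: (chi_neq wfG Vx).
apply/eqP=> /(congr1 chi); rewrite (chiK wfG) => /eqP.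
by apply/negP; rewrite (sig_neq wfG) // (edge_cover eE).
Qed.

Lemma contract_chordsE :
  chords (contract G e) = [set [set x; chi' x] | x in vpts G :\: e].
Proof.
apply/setP=> c; rewrite inE; apply/orP/imsetP.
  case=> [/setDP[Cc]|/imsetP[K]].
    rewrite edge_chordsE Cc /= => nce; have [x cx] := partition_nonempty cP Cc.
    have Vx := partition_block cP Cc cx; have cE := block_mate cP c2 Cc cx.
    have nx : x \notin e by apply: contra nce => ex; apply/meetsP; exists x.
    have ncx : chi x \notin e.
      by apply: contra nce => ex; apply/meetsP; exists (chi x); rewrite // cE !inE eqxx orbT.
    by exists x; rewrite ?inE ?nx // /chi' (negPf ncx).
  rewrite outer_pathsE => /imsetP[x /setIdP[px ecx] ->] ->.
  have ex := end_p_edge px.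
  exists (chi x); first by rewrite inE ecx (chi_in wfG) edge_in_vpts.
  by rewrite /chi' (chiK wfG) ex edge_block_outerE.
move=> [x xV ->]; rewrite /chi'; have [Vx nx] := setDP xV; case: ifP => ecx.
  right; apply/imsetP; exists (edge_block (chi x)); last first.
    by rewrite edge_block_outerE ?(chiK wfG).
  rewrite outer_pathsE; case: (boolP (chi x \in p)) => [pcx|npcx].
    by apply/imsetP; exists (chi x); rewrite // inE pcx (chiK wfG).
  apply/imsetP; exists (sig (chi x)); last by rewrite edge_block_sig.
  rewrite inE chi_sig_edge // (chiK wfG) nx andbT sig_end //.
  by move: ecx; rewrite eU inE (negPf npcx).
left; rewrite inE (mate_pair cP c2) // edge_chordsE (mate_pair cP c2) //= andbT.
by apply/negP=> /meetsP[z /set2P[]->]; rewrite ?(negPf nx) ?ecx.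
Qed.

Lemma contract_chords_partition : partition (chords (contract G e)) (vpts G :\: e) /\
  (forall c, c \in chords (contract G e) -> #|c| = 2).
Proof.
rewrite contract_chordsE; apply: invol_partition => x; first exact: chi'_notin.
  exact: chi'K.
exact: chi'_neq.
Qed.

Lemma chi'E x : x \in vpts G :\: e -> mate (chords (contract G e)) x = chi' x.
Proof.
move=> xV; have [cP' c2'] := contract_chords_partition.
have C : [set x; chi' x] \in chords (contract G e).
  by rewrite contract_chordsE; apply/imsetP; exists x.
have xx : x \in [set x; chi' x] by rewrite !inE eqxx.
have := set22 x (chi' x); rewrite (block_mate cP' c2' C xx) !inE.
by rewrite (negPf (chi'_neq xV)) => /eqP.
Qed.

Lemma joined_contract_chords x y : joined (chords (contract G e)) x y =
  (x \in vpts G :\: e) && ((y == x) || (y == chi' x)).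
Proof.
have [cP' c2'] := contract_chords_partition.
by rewrite (joined_mate cP' c2'); apply: andb_id2l => xV; rewrite chi'E.
Qed.

Lemma contract_ends f : f \in edges G -> f != e -> ends (contract G e) f = ends G f.
Proof.
move=> fE nfe; apply/setP=> r; rewrite !inE; case: (boolP (r \in pedges G)) => //= Pr.
rewrite andbT; case: (boolP (r \subset f)) => rf; rewrite ?andbF ?andbT //.
apply/negP=> re; have [x rx] := partition_nonempty pP Pr.
by case/eqP: nfe; apply: (edge_uniq wfG fE eE (subsetP rf _ rx) (subsetP re _ rx)).
Qed.

Lemma cover_shes_notin x : x \in cover (shes G) -> x \notin e.
Proof.
move=> Sx; apply/negP=> ex; have /pred0P/(_ x)/= := wf_disjoint wfG.
by rewrite Sx (edge_cover eE).
Qed.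

Lemma contract_wf : wf col (contract G e).
Proof.
have [cP' c2'] := contract_chords_partition.
have [_ cE] := wf_ends wfG eE.
have sE : [set e] \subset edges G by rewrite sub1set.
have cov1 : cover [set e] = e by rewrite /cover big_set1.
split=> //=.
- rewrite -{2}cE; apply: partitionD pP _; by apply/subsetP=> r /setIdP[].
- by apply: trivIsetS (wf_trivIset wfG); apply: subsetDl.
- by move=> f /setD1P[nfe fE]; rewrite contract_ends //; apply: (wf_ends wfG).
- apply/subsetP=> s Ss; have Ps := subsetP (wf_shes wfG) _ Ss.
  rewrite !inE Ps !andbT; apply/negP=> se; have [x sx] := partition_nonempty pP Ps.
  have Sx : x \in cover (shes G) by apply/bigcupP; exists s.
  by have := cover_shes_notin Sx; rewrite (subsetP se _ sx).
- by apply: disjointWl (wf_disjoint wfG); rewrite (cover_edgesD wfG) // subsetDl.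
- rewrite (cover_edgesD wfG) // cov1 -(wf_cover wfG); apply/setP=> x; rewrite !inE.
  case: (boolP (x \in e)) => //= ex; apply/negP=> /cover_shes_notin; by rewrite ex.
- rewrite (cover_edgesD wfG) // cov1 -{2}cover_edge_strands.
  by apply: partitionD sP _; apply/subsetP=> s /setIdP[].
- move=> s /setDP[Ss]; rewrite inE Ss /= => nse; have [f fE [sf sp]] := wf_strand wfG Ss.
  have nfe : f != e by apply: contraNneq nse => <-.
  exists f; first by rewrite !inE nfe.
  by split=> // r; rewrite contract_ends //; apply: sp.
- by move=> r x y /setDP[Pr _]; apply: (wf_col1 wfG).
- by move=> r x y /setDP[Pr _]; apply: (wf_col2 wfG).
- by move=> r /setDP[Pr _]; apply: (wf_card wfG).
- by move=> x /setDP[Vx _]; apply: (wf_neq wfG).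
- move=> c x y Cc cx cy; have xV := partition_block cP' Cc cx.
  move: cy; rewrite (block_mate cP' c2' Cc cx) chi'E // => /set2P[]->//.
  by rewrite /chi'; case: ifP => _; rewrite !(colors_chi wfG, colors_sig wfG).
- by move=> s x y /setDP[Ss _]; apply: (wf_strand_col wfG).
Qed.

End Contract.

Lemma edge_specP (T : finType) (col : T -> 'I_4 * 'I_4) G e :
  wf col G -> e \in edges G -> exists p q, edge_spec col G e p q.
Proof.
move=> wfG eE; have [p [q [Pp Pq npq endsE eU]]] := edge_two_ends wfG eE.
by exists p, q.
Qed.

Lemma wcolored_wf (T : finType) (col : T -> 'I_4 * 'I_4) G :
  wcolored (D := 3) col G -> wf col G.
Proof.
elim=> [G0|G0 e _ wf0 eE]; first exact: hectg_wf.
have [p [q H]] := edge_specP wf0 eE; exact: contract_wf H.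
Qed.

(** * Parity *)

Section Parity.

Variables (T : finType) (col : T -> 'I_4 * 'I_4) (G : sgraph T).
Hypothesis wfG : wf col G.

Notation chi := (mate (chords G)).
Notation sig := (mate (strands G)).
Notation cpts t := (color_points col t G).

Lemma color_pointsT : cpts setT = vpts G.
Proof. by apply/setP=> x; rewrite inE !in_setT !andbT. Qed.

Lemma color_points_vpts t x : x \in cpts t -> x \in vpts G.
Proof. by rewrite inE => /andP[]. Qed.

Lemma pedge_vpts p x : p \in pedges G -> x \in p -> x \in vpts G.
Proof. exact: partition_block (wf_pedges wfG). Qed.

(** The three points of [p] share their first colour and have distinct second colours, which
    therefore run through the three others. For a triple [t] this is the value 0 or 2 on which
    parity rests. *)
Lemma card_pedge_color_points p x t : p \in pedges G -> x \in p ->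
  #|p :&: cpts t| = if (col x).1 \in t then #|t|.-1 else 0.
Proof.
move=> Pp px; set j := (col x).1.
have pj y : y \in p -> (col y).1 = j by move=> py; apply: (wf_col1 wfG Pp).
case: ifP => jt; last first.
  apply/eqP; rewrite cards_eq0; apply/eqP/setP=> y; rewrite !inE.
  by apply/negP=> /and3P[py _ /andP[]]; rewrite pj // jt.
have injp : {in p &, injective (fun y => (col y).2)}.
  by move=> y z py pz /(wf_col2 wfG Pp py pz).
have imp : [set (col y).2 | y in p] = [set~ j].
  apply/eqP; rewrite eqEcard card_in_imset // (wf_card wfG Pp) cardsC1 card_ord leqnn andbT.
  apply/subsetP=> _ /imsetP[y py ->]; rewrite !inE -(pj _ py) eq_sym.
  exact: (wf_neq wfG (pedge_vpts Pp py)).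
rewrite (cardsD1 j t) jt /= -(card_in_imset (f := fun y => (col y).2) (D := p :&: cpts t)); last first.
  by move=> y z /setIP[py _] /setIP[pz _]; apply: injp.
apply: eq_card => b; rewrite !inE; apply/imsetP/andP.
  move=> [y /setIP[py]]; rewrite !inE => /and3P[Vy _ bt] ->; split=> //.
  by rewrite -(pj _ py) eq_sym (wf_neq wfG).
move=> [bj bt]; have : b \in [set~ j] by rewrite !inE.
rewrite -imp => /imsetP[y py ey]; exists y => //.
by rewrite !inE py (pedge_vpts Pp py) pj // jt -ey.
Qed.

(* The points with colours in a set of three colours meet every pre-edge in 0 or
   2 points, and chords and strands match them up: so [K] contains an even
   number of the two such points of [p]. *)
Lemma parity (p : {set T}) Q t (K : {set T}) x y : p \in pedges G -> trivIset (p |: Q) -> p \notin Q ->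
  (forall B, B \in Q -> B \in pedges G \/ B \in strands G) ->
  K \subset cpts t -> K \subset cover (p |: Q) ->
  (forall z, z \in K -> chi z \in K) ->
  (forall B z w, B \in Q -> z \in B -> w \in B -> w \in cpts t ->
     z \in K -> w \in K) ->
  x \in p -> x \in K -> y \in p -> y \in cpts t -> y \in K.
Proof.
move=> Pp tQ nQ PSQ /subsetP Kt KQ chiKK QK px Kx py ty.
apply: contraT => Ky.
have nxy : x != y by apply: contraNneq Ky => <-.
have e1 : (col x).1 = (col y).1 by apply: (wf_col1 wfG Pp).
have n2 : (col x).2 != (col y).2.
  by apply: contra nxy => /eqP/(wf_col2 wfG Pp px py) ->.
have Vx := pedge_vpts Pp px; have Vy := pedge_vpts Pp py.
(* The two pairs share the colour of [p], so their union is a triple, for which [x] and [y] are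
   exactly the two points of [p]. If [K] contained only [x], it would have an odd number of points
   in [p] with colours in this triple. *)
pose t' := colors col x :|: colors col y.
have t3 : #|t'| = 3.
  have -> : t' = (col x).1 |: [set (col x).2; (col y).2].
    apply/setP=> i; rewrite !inE -e1.
    by case: (i == _); case: (i == (col x).2).
  rewrite cardsU1 !inE negb_or (wf_neq wfG Vx) cards2 n2.
  by have := wf_neq wfG Vy; rewrite -e1 => ->.
have t't : t' \subset t.
  rewrite subUset; have := Kt x Kx; move: ty; rewrite !color_pointsE !inE.
  by move=> /andP[_ ->] /andP[_ ->].
have ctt z : z \in cpts t' -> z \in cpts t.
  rewrite !color_pointsE !inE => /andP[-> /= zt']; exact: subset_trans t't.
set Z := K :&: cpts t'.
have evZ : ~~ odd #|Z|.
  have [/eqP covc tc _] := and3P (wf_chords wfG).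
  apply: (even_trivIset tc).
    by rewrite covc; apply/subsetP=> z /setIP[_ /color_points_vpts].
  move=> c Cc; case: (set_0Vmem (c :&: Z)) => [->|[z /setIP[cz]]]; first by rewrite cards0.
  move=> /setIP[Kz zt]; rewrite (setIidPl _) ?(wf_chords2 wfG Cc) //.
  rewrite (block_mate (wf_chords wfG) (wf_chords2 wfG) Cc cz).
  by apply/subsetP=> w /set2P[]->; rewrite inE ?Kz // chiKK // (chi_color_points wfG).
have ZQ : Z \subset cover (p |: Q) by apply: subset_trans KQ; apply: subsetIl.
(* The whole of [Z] is even by chords and every block of [Q] contributes an even number, so the one
   remaining block [p] does too. *)
have evp : ~~ odd #|p :&: Z|.
  move: evZ; rewrite (card_trivIset_cover tQ ZQ) big_setU1 //= oddD.
  rewrite (_ : odd (\sum_(B in Q) _) = false) ?addbF //; apply/negbTE.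
  apply: (big_ind (fun n => ~~ odd n)) => // [m n|B QB].
    by rewrite oddD => /negPf-> /negPf->.
  case: (set_0Vmem (B :&: Z)) => [->|[z /setIP[Bz /setIP[Kz zt]]]]; first by rewrite cards0.
  case: (PSQ B QB) => [PB|SB].
    have -> : B :&: Z = B :&: cpts t'.
      apply/setP=> w; rewrite !inE; case: (boolP (w \in B)) => //= Bw.
      case: (boolP (w \in cpts t')) => wt; last by move: wt; rewrite !inE => /negPf->; rewrite andbF.
      by rewrite (QK B z w) ?ctt.
    by rewrite (card_pedge_color_points _ PB Bz) t3; case: ifP.
  rewrite (setIidPl _) ?(wf_strands2 wfG SB) //.
  have BE := block_mate (wf_strands wfG) (wf_strands2 wfG) SB Bz.
  rewrite BE; apply/subsetP=> w /set2P[]->; rewrite inE ?Kz //.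
  have st : sig z \in cpts t' by rewrite (sig_color_points wfG).
  by rewrite st andbT (QK B z) ?ctt // BE !inE eqxx orbT.
have xt : x \in cpts t' by rewrite color_pointsE inE Vx subsetUl.
have yt : y \in cpts t' by rewrite color_pointsE inE Vy subsetUr.
suff pZ : p :&: Z = [set x] by rewrite pZ cards1 in evp.
have pt : p :&: cpts t' = [set x; y].
  apply/esym/eqP; rewrite eqEcard (card_pedge_color_points _ Pp px) t3 cards2 nxy.
  rewrite ifT; last by rewrite !inE eqxx.
  by rewrite andbT; apply/subsetP=> z /set2P[]->; rewrite inE ?px ?py.
apply/setP=> z; rewrite /Z setICA pt !inE.
case: (eqVneq z x) => [->|_] /=; first by rewrite Kx.
by case: (eqVneq z y) => [->|_]; rewrite ?(negPf Ky) ?andbF.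
Qed.

(** [parity] is applied to the class of [x], with the other pre-edges as [Q]. The case [setT]
    concerns vertices, smaller sets of colours concern bubbles. *)
Lemma pedge_not_cut p t x y : p \in pedges G -> x \in p -> y \in p ->
  x \in cpts t -> y \in cpts t ->
  conn (joined (chords G :|: (pedges G :\ p))) (cpts t) x y.
Proof.
move=> Pp px py tx ty; set r := joined _.
suff : y \in cls r (cpts t) x by rewrite inE => /andP[].
have [/eqP covp tp _] := and3P (wf_pedges wfG).
have pE : p |: (pedges G :\ p) = pedges G by rewrite setD1K.
apply: (parity (p := p) (Q := pedges G :\ p) (t := t) (x := x)) => //.
- by rewrite pE.
- by rewrite !inE eqxx.
- by move=> B /setD1P[_]; left.
- by apply/subsetP=> z; rewrite inE => /andP[].
- by rewrite pE covp; apply/subsetP=> z; rewrite inE => /andP[/color_points_vpts].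
- move=> z; rewrite !inE -!andbA => /and4P[Vz t1 t2 cz].
  have zt : z \in cpts t by rewrite !inE Vz t1.
  have czt : chi z \in cpts t by rewrite (chi_color_points wfG).
  move: (czt); rewrite !inE => /and3P[-> -> ->]; apply: conn_trans cz _.
  by apply: conn1 => //; rewrite /r joined_setU (joined_mate (wf_chords wfG) (wf_chords2 wfG)) Vz eqxx orbT.
- move=> B z w QB Bz Bw wt /setIdP[zt cz]; rewrite inE wt; apply: conn_trans cz _.
  by apply: conn1 => //; rewrite /r joined_setU; apply/orP; right; apply/joinedP; exists B.
- exact: mem_cls.
Qed.

End Parity.

(** * Classes near an edge, before and after its contraction *)

Section ContractCount.

Variables (T : finType) (col : T -> 'I_4 * 'I_4) (G : sgraph T) (e p q : {set T}).
Hypothesis H : edge_spec col G e p q.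
Let wfG := es_wf H.
Let eE := es_edge H.
Let Pp := es_p H.
Let Pq := es_q H.

Notation chi := (mate (chords G)).
Notation sig := (mate (strands G)).
Notation cpts t := (color_points col t G).
Notation G' := (contract G e).
Notation cpts' t := (color_points col t G').
Implicit Types (Q : {set {set T}}) (t : {set 'I_4}).

(** Contraction removes from the pre-edges, the strands and the edges exactly the blocks inside [e],
    so one operation serves the three families. For a saturated family the blocks that remain do not
    touch [e]. *)
Definition prune Q := [set B in Q | ~~ (B \subset e)].
Definition saturated Q := forall B x, B \in Q -> x \in B -> x \in e -> B \subset e.

Lemma pruneU Q1 Q2 : prune (Q1 :|: Q2) = prune Q1 :|: prune Q2.
Proof. by apply/setP=> B; rewrite !inE andb_orl. Qed.

Lemma saturatedU Q1 Q2 : saturated Q1 -> saturated Q2 -> saturated (Q1 :|: Q2).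
Proof. by move=> s1 s2 B x /setUP[QB|QB] Bx ex; [apply: (s1 B x) | apply: (s2 B x)]. Qed.

Lemma pedges_prune : pedges G' = prune (pedges G).
Proof. by apply/setP=> r; rewrite !inE; case: (r \in pedges G); rewrite ?andbF ?andbT. Qed.

Lemma strands_prune : strands G' = prune (strands G).
Proof. by apply/setP=> r; rewrite !inE; case: (r \in strands G); rewrite ?andbF ?andbT. Qed.

Lemma edges_prune : edges G' = prune (edges G).
Proof.
apply/setP=> f; rewrite !inE andbC; case: (boolP (f \in edges G)) => //= fE.
congr (~~ _); apply/eqP/idP => [->//|fe].
have [_ cE] := wf_ends wfG fE; have [/eqP e2 _] := wf_ends wfG fE.
have : 0 < #|ends G f| by rewrite (eqP e2).
case/card_gt0P=> r /setIdP[Pr rf]; have [x rx] := partition_nonempty (wf_pedges wfG) Pr.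
by apply: (edge_uniq wfG fE eE (subsetP rf _ rx)); apply/(subsetP fe)/(subsetP rf).
Qed.

Lemma saturated_pedges : saturated (pedges G).
Proof.
move=> B x PB Bx; rewrite (es_eq H) inE => /orP[px|qx].
  by rewrite (pedge_uniq wfG PB Pp Bx px) subsetUl.
by rewrite (pedge_uniq wfG PB Pq Bx qx) subsetUr.
Qed.

Lemma saturated_edges : saturated (edges G).
Proof. by move=> B x fE Bx ex; rewrite (edge_uniq wfG fE eE Bx ex). Qed.

Lemma saturated_strands : saturated (strands G).
Proof. by move=> B x SB Bx ex; apply: (strand_sub wfG eE SB Bx ex). Qed.

Lemma joined_prune Q x y : saturated Q -> x \notin e ->
  joined (prune Q) x y = joined Q x y /\ (joined Q x y -> y \notin e).
Proof.
move=> sQ nx; split; last first.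
  by move=> /joinedP[B QB [Bx By]]; apply: contra nx => /(sQ B y QB By)/subsetP; apply.
apply/joinedP/joinedP => [[B /setIdP[QB _] BB]|[B QB [Bx By]]]; exists B => //.
by rewrite inE QB; apply: contra nx => /subsetP; apply.
Qed.

Lemma cpts'E t : cpts' t = cpts t :\: e.
Proof. by apply/setP=> x; rewrite !inE /= -!andbA. Qed.

(* Outside [dirty], the blocks through a point are the same in [G] and [G']. *)
Definition dirty : {set T} := [set x | (x \in e) || (chi x \in e)].

Notation conn0 Q t := (conn (joined (chords G :|: Q)) (cpts t)).
Notation conn' Q t := (conn (joined (chords G' :|: prune Q)) (cpts' t)).
Notation comps0 Q t := (comps (joined (chords G :|: Q)) (cpts t)).
Notation comps' Q t := (comps (joined (chords G' :|: prune Q)) (cpts' t)).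

Lemma contract_clean Q t : saturated Q ->
  [set K in comps0 Q t | ~~ meets K dirty] = [set K in comps' Q t | ~~ meets K dirty].
Proof.
move=> sQ; apply: comps_clean; try exact: joined_sym.
  apply/setP=> x; rewrite cpts'E !inE negb_or.
  by case: (x \in e); rewrite ?andbF ?andbT.
move=> x y; rewrite inE negb_or => /andP[nx ncx] tx.
have Vx := color_points_vpts tx; have xV : x \in vpts G :\: e by rewrite inE nx.
have [eQ nQ] := joined_prune y sQ nx.
rewrite joined_setU [joined (chords G' :|: _) _ _]joined_setU eQ (joined_contract_chords H) xV.
rewrite cpts'E [y \in _ :\: _]inE.
rewrite (joined_mate (wf_chords wfG) (wf_chords2 wfG)) Vx /chi' (negPf ncx) /=.
rewrite -andbA andbCA; apply: andb_id2l => _; apply/idP/andP => [h|[]//]; split=> //.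
by case/orP: h => [/orP[]/eqP->|/nQ].
Qed.

Lemma contract_count Q t n n' : saturated Q ->
  #|[set K in comps0 Q t | meets K dirty]| = n ->
  #|[set K in comps' Q t | meets K dirty]| = n' ->
  #|comps0 Q t| + n' = #|comps' Q t| + n.
Proof.
move=> sQ dn dn'; rewrite (card_compsD _ _ dirty) (card_compsD (joined (chords G' :|: _)) _ dirty).
by rewrite -contract_clean // dn dn' -addnA (addnC n) addnA.
Qed.

Lemma conn_chi Q t x : x \in cpts t -> conn0 Q t x (chi x).
Proof.
move=> tx; apply: conn1 => //; first by rewrite (chi_color_points wfG).
rewrite joined_setU (joined_mate (wf_chords wfG) (wf_chords2 wfG)) (color_points_vpts tx).
by rewrite eqxx orbT.
Qed.

Lemma conn'_chi Q t x : x \in cpts t -> x \in e -> chi x \notin e ->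
  conn' Q t (chi x) (chi (sig x)).
Proof.
move=> tx ex ncx; apply: conn1; rewrite ?cpts'E 1?inE ?ncx ?(chi_sig_edge H) ?ncx //=
  ?(chi_color_points wfG) ?(sig_color_points wfG) //.
rewrite joined_setU (joined_contract_chords H) inE ncx (chi_in wfG) (color_points_vpts tx).
by rewrite /chi' (chiK wfG) ex eqxx orbT.
Qed.

Lemma contract_dirty1 Q t x0 : x0 \in e -> x0 \in cpts t ->
  (forall y, y \in e -> y \in cpts t -> conn0 Q t x0 y) ->
  #|[set K in comps0 Q t | meets K dirty]| = 1.
Proof.
move=> ex0 tx0 all0; rewrite (card_comps_meets (S := [set x0])) ?cards1 ?sub1set //.
- exact: joined_sym.
- move=> x /set1P->; exists x0; last exact: conn_refl.
  by rewrite inE ex0.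
- by move=> x y /set1P-> /set1P->.
move=> d; rewrite inE => /orP[ed|ecd] td; exists x0; rewrite ?set11 //.
  exact: all0.
have tcd : chi d \in cpts t by rewrite (chi_color_points wfG).
apply: conn_trans (all0 _ ecd tcd) _.
by rewrite -{2}[d](chiK wfG); apply: conn_chi.
Qed.

Lemma contract_dirty0 Q t : (forall y, y \in p -> y \notin cpts t) ->
  #|[set K in comps0 Q t | meets K dirty]| = 0 /\
  #|[set K in comps' Q t | meets K dirty]| = 0.
Proof.
move=> np; have ne y : y \in e -> y \notin cpts t.
  rewrite (es_eq H) inE => /orP[/np//|qy].
  rewrite -(sig_color_points wfG); apply: np; by rewrite (sig_end H) ?(end_q_edge H).
have nd y : y \in dirty -> y \notin cpts t.
  rewrite inE => /orP[/ne//|/ne]; by rewrite (chi_color_points wfG).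
by split; apply/eqP; rewrite cards_eq0; apply/eqP/setP=> K; rewrite inE in_set0;
  apply/negP=> /andP[cK /meetsP[d Kd /nd/negP[]]];
  have [] := comps_cls (@joined_sym _ _) cK Kd; rewrite ?cpts'E // => /setDP[].
Qed.

(** A dirty point of the contraction is an end of an outer path, and the new chord joins the two
    ends of a path. So the ends [chi x], with [x] an outer point of [p], represent all dirty
    classes. *)
Lemma contract_dirty_outer Q t :
  (forall x y, x \in outer_points G e p -> y \in outer_points G e p ->
     x \in cpts t -> y \in cpts t -> conn' Q t (chi x) (chi y) -> x = y) ->
  #|[set K in comps' Q t | meets K dirty]| = #|outer_points G e p :&: cpts t|.
Proof.
move=> inj; rewrite (card_comps_meets (S := chi @: (outer_points G e p :&: cpts t))).
- by rewrite card_imset //; apply: inv_inj; apply: (chiK wfG).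
- exact: joined_sym.
- apply/subsetP=> _ /imsetP[x /setIP[/setIdP[px ncx] tx] ->].
  by rewrite cpts'E inE ncx (chi_color_points wfG).
- move=> _ /imsetP[x /setIP[/setIdP[px ncx] tx] ->]; exists (chi x); last exact: conn_refl.
  by rewrite inE (chiK wfG) (end_p_edge H px) orbT.
- move=> _ _ /imsetP[x /setIP[Ox tx] ->] /imsetP[y /setIP[Oy ty] ->] cxy.
  by rewrite (inj x y).
move=> d; rewrite inE cpts'E => ded /setDP[td nd]; move: ded; rewrite (negPf nd) /= => ecd.
have tcd : chi d \in cpts t by rewrite (chi_color_points wfG).
move: (ecd); rewrite {1}(es_eq H) inE => /orP[pcd|qcd].
  exists d; last exact: conn_refl.
  by apply/imsetP; exists (chi d); rewrite ?(chiK wfG) // inE tcd andbT inE pcd (chiK wfG).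
(* The chord of [d] enters [e] on the side of [q]; the representative is the other end of the outer
   path, whose chord enters on the side of [p]. *)
have esd : sig (chi d) \in e by rewrite (sig_edge wfG).
exists (chi (sig (chi d))).
  apply/imsetP; exists (sig (chi d)) => //.
  by rewrite inE (sig_color_points wfG) tcd andbT inE (sig_end H) // qcd (chi_sig_edge H) // (chiK wfG).
have c : conn' Q t (chi (sig (chi d))) (chi (sig (sig (chi d)))).
  apply: conn'_chi => //; first by rewrite (sig_color_points wfG).
  by rewrite (chi_sig_edge H) // (chiK wfG).
by rewrite (sigK wfG) (chiK wfG) cpts'E in c.
Qed.

End ContractCount.

(** * Vertices, components and bubbles of a contraction *)

Section Underlying.

Variables (T : finType) (G : sgraph T).

Let rV := joined (pedges G :|: chords G).
Let rU := joined (chords G :|: (pedges G :|: edges G)).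

Lemma ug_adj_sym : symmetric (ug_adj G).
Proof. by move=> v w; apply: eq_existsb => f; rewrite [(v \in _) && _]andbC. Qed.

Lemma conn_ug_adj : connect (ug_adj G) =2 conn (ug_adj G) (vertices G).
Proof.
apply: eq_connect => v w; apply/idP/and3P => [vw|[]//]; split=> //.
  by move: vw => /existsP[f /and3P[_ /setIdP[]]].
by move: vw => /existsP[f /and3P[_ _ /setIdP[]]].
Qed.

Lemma vertices_sub_conn x y : conn rV (vpts G) x y -> conn rU (vpts G) x y.
Proof.
apply: conn_sub => u v Vu Vv ruv; apply: conn1 => //.
by move: ruv; rewrite /rU /rV !joined_setU => /orP[]->; rewrite ?orbT.
Qed.

(** The nodes of the underlying graph are sets of points. Taking edges as additional blocks brings
    its connectivity back to points, so that its components are counted by the same lemmas as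
    vertices and bubbles. *)
Lemma conn_underlying x y : x \in vpts G -> y \in vpts G ->
  conn rU (vpts G) x y = conn (ug_adj G) (vertices G) (cls rV (vpts G) x) (cls rV (vpts G) y).
Proof.
move=> Vx Vy; have cV z : z \in vpts G -> cls rV (vpts G) z \in vertices G by apply: mem_comps.
have symV : symmetric rV by apply: joined_sym.
apply/idP/idP => [cxy|cvw].
  pose K := [set z in vpts G | conn (ug_adj G) (vertices G) (cls rV (vpts G) x) (cls rV (vpts G) z)].
  suff : y \in K by rewrite inE => /andP[].
  apply: (conn_closed _ cxy); last by rewrite inE Vx conn_refl.
  move=> u v Vu Vv ruv; rewrite !inE Vv => /andP[_]; move: ruv.
  rewrite /rU !joined_setU orbA => /orP[ruv|/joinedP[f fE [fu fv]]] cu; last first.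
    apply: conn_trans cu _; apply: conn1; rewrite ?cV //.
    by apply/existsP; exists f; rewrite fE !inE !cV //=; apply/andP; split;
      apply/meetsP; [exists u | exists v]; rewrite ?mem_cls.
  suff -> : cls rV (vpts G) v = cls rV (vpts G) u by [].
  apply/eqP; rewrite eq_sym eq_in_cls //; apply: conn1 => //.
  by rewrite /rV joined_setU orbC.
pose K := [set w : {set T} | [forall z in w, conn rU (vpts G) x z]].
suff : cls rV (vpts G) y \in K.
  by rewrite inE => /forallP/(_ y); rewrite mem_cls.
apply: (conn_closed _ cvw); last first.
  by rewrite inE; apply/forallP=> z; apply/implyP=> /setIdP[_ /vertices_sub_conn].
move=> v w Vv Vw /existsP[f /and3P[fE /setIdP[_ /meetsP[a va fa]] /setIdP[_ /meetsP[b wb fb]]]].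
rewrite !inE => /forallP/(_ a); rewrite va /= => cxa.
apply/forallP=> z; apply/implyP=> wz.
have [Vb wE] := comps_cls symV Vw wb; have [Va _] := comps_cls symV Vv va.
apply: conn_trans cxa _; apply: (@conn_trans _ _ _ b).
  by apply: conn1 => //; rewrite /rU !joined_setU; apply/or3P/Or33/joinedP; exists f.
by apply: vertices_sub_conn; move: wz; rewrite wE inE => /andP[].
Qed.

Lemma card_ug_comps : #|ug_comps G| = #|comps rU (vpts G)|.
Proof.
apply/esym/(card_comps_map (g := cls rV (vpts G))).
- exact: joined_sym.
- exact: ug_adj_sym.
- by move=> x; apply: mem_comps.
- by move=> x y Vx Vy; apply: conn_underlying.
- by move=> _ /imsetP[x Vx ->]; exists x => //; apply: conn_refl.
Qed.

End Underlying.

Section ContractStats.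

Variables (T : finType) (col : T -> 'I_4 * 'I_4) (G : sgraph T) (e p q : {set T}).
Hypothesis H : edge_spec col G e p q.
Let wfG := es_wf H.
Let eE := es_edge H.
Let Pp := es_p H.
Let Pq := es_q H.

Notation chi := (mate (chords G)).
Notation sig := (mate (strands G)).
Notation cpts t := (color_points col t G).
Notation G' := (contract G e).
Notation cpts' t := (color_points col t G').
Notation conn0 Q t := (conn (joined (chords G :|: Q)) (cpts t)).
Notation conn' Q t := (conn (joined (chords G' :|: prune e Q)) (cpts' t)).
Notation comps0 Q t := (comps (joined (chords G :|: Q)) (cpts t)).
Notation comps' Q t := (comps (joined (chords G' :|: prune e Q)) (cpts' t)).
Notation dirty := (dirty G e).

Lemma card_p_pos : exists x, x \in p.
Proof. exact: partition_nonempty (wf_pedges wfG) Pp. Qed.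

Lemma sig_p_q x : x \in p -> sig x \in q.
Proof.
move=> px; have ex := end_p_edge H px.
by rewrite -(sig_end H) ?(sigK wfG) // (sig_edge wfG).
Qed.

Lemma conn_pedge (Q : {set {set T}}) t r x y : r \in Q -> x \in r -> y \in r -> x \in cpts t -> y \in cpts t ->
  conn0 Q t x y.
Proof.
move=> Qr rx ry tx ty; apply: conn1 => //; rewrite joined_setU; apply/orP; right.
by apply/joinedP; exists r.
Qed.

Lemma loopP x y : x \in p -> y \in q -> loop G e = conn0 (pedges G) setT x y.
Proof.
move=> px qy; rewrite color_pointsT setUC; set r := joined _.
have sym : symmetric r by apply: joined_sym.
have Vx := edge_in_vpts H (end_p_edge H px); have Vy := edge_in_vpts H (end_q_edge H qy).
have rp u v : u \in p -> v \in p -> conn r (vpts G) u v.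
  move=> pu pv; apply: conn1; try by apply: (pedge_vpts wfG Pp).
  by rewrite /r joined_setU; apply/orP; left; apply/joinedP; exists p.
have rq u v : u \in q -> v \in q -> conn r (vpts G) u v.
  move=> pu pv; apply: conn1; try by apply: (pedge_vpts wfG Pq).
  by rewrite /r joined_setU; apply/orP; left; apply/joinedP; exists q.
have -> : conn r (vpts G) x y = (cls r (vpts G) x == cls r (vpts G) y).
  by rewrite eq_in_cls.
rewrite /loop; have -> : end_vertices G e = [set cls r (vpts G) x; cls r (vpts G) y].
  apply/setP=> v; rewrite !inE; apply/andP/orP => [[Vv /meetsP[z vz]]|].
    have [Vz ->] := comps_cls sym Vv vz.
    rewrite (es_eq H) inE => /orP[pz|qz]; [left|right]; rewrite eq_in_cls //.
      exact: rp.
    exact: rq.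
  case=> /eqP->; split; try exact: mem_comps; apply/meetsP.
    by exists x; [apply: mem_cls | apply: (end_p_edge H)].
  by exists y; [apply: mem_cls | apply: (end_q_edge H)].
by rewrite cards2; case: (cls r (vpts G) x == _).
Qed.

(** An inner chord would join the two ends inside one vertex. *)
Lemma nonloop_outer x : ~~ loop G e -> x \in p -> chi x \notin e.
Proof.
move=> nl px; apply: contra nl => ecx; have ex := end_p_edge H px.
rewrite (loopP px (sig_p_q px)) -(inner_chord H ex ecx).
by apply: (conn_chi H); rewrite color_pointsT (edge_in_vpts H).
Qed.

Lemma nonloop_inner : ~~ loop G e -> inner_number G e = 0.
Proof.
move=> nl; rewrite (inner_numberE H); apply/eqP; rewrite cards_eq0; apply/eqP/setP=> x.
by rewrite !inE; apply/negP=> /andP[/(nonloop_outer nl)/negPf->].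
Qed.

Lemma conn'_sub (Q1 Q2 : {set {set T}}) (t1 t2 : {set 'I_4}) :
  (forall B, B \in prune e Q1 -> exists2 B', B' \in prune e Q2 & B \subset B') ->
  t1 \subset t2 -> subrel (conn' Q1 t1) (conn' Q2 t2).
Proof.
move=> sQ /subsetP st; have sub u : u \in cpts' t1 -> u \in cpts' t2.
  by rewrite !inE => /andP[-> /andP[/st-> /st->]].
apply: conn_sub => u v tu tv ruv; apply: conn1; rewrite ?sub //.
move: ruv; rewrite joined_setU [joined (chords G' :|: _) u v]joined_setU.
case/orP=> [->//|/joinedP[B QB [Bu Bv]]]; apply/orP; right.
have [B' QB' /subsetP sB] := sQ B QB; apply/joinedP; exists B' => //.
by split; apply: sB.
Qed.

Lemma conn'_subset (Q1 Q2 : {set {set T}}) t : Q1 \subset Q2 ->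
  subrel (conn' Q1 t) (conn' Q2 t).
Proof.
move=> /subsetP sQ; apply: conn'_sub => // B /setIdP[/sQ QB nB].
by exists B; rewrite // inE QB.
Qed.

(* Removing a pre-edge does not disconnect its vertex, whence all the outer
   paths of a non-loop are joined in the contraction. *)
Lemma nonloop_conn' t x y : ~~ loop G e -> x \in p -> y \in p ->
  x \in cpts t -> y \in cpts t -> conn' (pedges G) t (chi x) (chi y).
Proof.
move=> nl px py tx ty; have c0 := pedge_not_cut wfG Pp px py tx ty.
(* Invariant of a path in [G] that avoids the pre-edge [p]. A point of [e] has no counterpart in the
   contraction and is represented by its chord partner. The condition that [z] is in the vertex of
   [x] ensures that the path meets [e] only in [p], because [e] is not a loop. *)
pose K := [set z in cpts t | conn0 (pedges G) setT x z &
  if z \in e then conn' (pedges G) t (chi x) (chi z) else conn' (pedges G) t (chi x) z].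
have Kp z : z \in K -> z \in e -> z \in p.
  rewrite inE => /and3P[_ cxz _]; rewrite (es_eq H) inE => /orP[//|qz].
  by case/negP: nl; rewrite (loopP px qz).
suff : y \in K by rewrite inE (end_p_edge H py) => /and3P[].
apply: (conn_closed _ c0); last by rewrite inE tx (end_p_edge H px) !conn_refl.
move=> u v tu tv ruv Ku.
have cxv : conn0 (pedges G) setT x v.
  move: Ku; rewrite inE => /and3P[_ cxu _]; apply: conn_trans cxu _.
  apply: conn1; rewrite ?color_pointsT ?(color_points_vpts tu) ?(color_points_vpts tv) //.
  move: ruv; rewrite joined_setU [joined (chords G :|: _) u v]joined_setU.
  case/orP=> [->//|/joinedP[B /setD1P[_ PB] BB]]; apply/orP; right.
  by apply/joinedP; exists B.
have vp : v \in e -> v \in p.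
  rewrite (es_eq H) inE => /orP[//|qv]; by case/negP: nl; rewrite (loopP px qv).
rewrite inE tv cxv /=.
have [eu|nu] := boolP (u \in e).
  have pu := Kp _ Ku eu; move: Ku; rewrite inE eu => /and3P[_ _ cu].
  move: ruv; rewrite joined_setU (joined_mate (wf_chords wfG) (wf_chords2 wfG)).
  case/orP=> [/andP[_ /orP[]/eqP->]|/joinedP[B /setD1P[nB PB] [Bu Bv]]].
  - by rewrite eu.
  - by rewrite (negPf (nonloop_outer nl pu)).
  - by rewrite (pedge_uniq wfG PB Pp Bu pu) eqxx in nB.
move: Ku; rewrite inE (negPf nu) => /and3P[_ _ cu].
have u' : u \in cpts' t by rewrite cpts'E inE nu.
move: ruv; rewrite joined_setU (joined_mate (wf_chords wfG) (wf_chords2 wfG)).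
case/orP=> [/andP[Vu /orP[]/eqP ev]|/joinedP[B /setD1P[nB PB] [Bu Bv]]].
- by rewrite ev (negPf nu).
- rewrite ev; case: (boolP (chi u \in e)) => ecu; first by rewrite (chiK wfG).
  apply: conn_trans cu _; apply: conn1 => //.
    by rewrite cpts'E inE ecu (chi_color_points wfG).
  rewrite joined_setU (joined_contract_chords H) inE nu Vu /=.
  by rewrite /chi' (negPf ecu) eqxx orbT.
have nv : v \notin e.
  apply/negP=> ev; have pv := vp ev; by rewrite (pedge_uniq wfG PB Pp Bv pv) eqxx in nB.
rewrite (negPf nv); apply: conn_trans cu _; apply: conn1 => //.
  by rewrite cpts'E inE nv.
rewrite joined_setU; apply/orP; right; apply/joinedP; exists B => //.
by rewrite inE PB; apply: contra nv => /subsetP; apply.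
Qed.

Lemma nonloop_dirty' (Q : {set {set T}}) t x0 : ~~ loop G e -> pedges G \subset Q ->
  x0 \in p -> x0 \in cpts t -> #|[set K in comps' Q t | meets K dirty]| = 1.
Proof.
move=> nl sQ px0 tx0; have sub := conn'_subset (t := t) sQ.
have nx0 := nonloop_outer nl px0.
have cx0 : chi x0 \in cpts' t by rewrite cpts'E inE nx0 (chi_color_points wfG).
rewrite (card_comps_meets (S := [set chi x0])) ?cards1 ?sub1set //.
- exact: joined_sym.
- move=> _ /set1P->; exists (chi x0); last exact: conn_refl.
  by rewrite inE (chiK wfG) (end_p_edge H px0) orbT.
- by move=> x y /set1P-> /set1P->.
move=> d dd td'; have := td'; rewrite {1}cpts'E => /setDP[td nd]; exists (chi x0); first exact: set11.
move: dd; rewrite inE (negPf nd) /= => ecd.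
have tcd : chi d \in cpts t by rewrite (chi_color_points wfG).
move: (ecd); rewrite {1}(es_eq H) inE => /orP[pcd|qcd].
  by rewrite -[d](chiK wfG); apply/sub/nonloop_conn'.
have psd : sig (chi d) \in p by rewrite (sig_end H).
have tsd : sig (chi d) \in cpts t by rewrite (sig_color_points wfG).
have c1 : conn' Q t (chi x0) (chi (sig (chi d))) by apply/sub/nonloop_conn'.
apply: conn_trans c1 _.
have := conn'_chi H Q tsd (end_p_edge H psd) (nonloop_outer nl psd).
by rewrite (sigK wfG) (chiK wfG).
Qed.

Lemma edge_conn (Q : {set {set T}}) t x0 y : pedges G \subset Q -> conn0 Q t x0 (sig x0) ->
  x0 \in p -> x0 \in cpts t -> y \in e -> y \in cpts t -> conn0 Q t x0 y.
Proof.
move=> /subsetP sQ c0 px0 tx0; rewrite (es_eq H) inE => /orP[py|qy] ty.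
  by apply: conn_pedge px0 py _ _ => //; apply: sQ.
apply: conn_trans c0 _; have := sig_p_q px0 => qs.
by apply: conn_pedge qs qy _ _; rewrite ?(sig_color_points wfG) ?sQ.
Qed.

(** The vertices at [p] and at [q] are two dirty classes, which contraction merges into one. *)
Lemma nonloop_vertices : ~~ loop G e -> #|vertices G| = #|vertices G'|.+1.
Proof.
move=> nl; have [x0 px0] := card_p_pos.
have Vx0 := edge_in_vpts H (end_p_edge H px0).
have tx0 : x0 \in cpts setT by rewrite color_pointsT.
have tsx0 : sig x0 \in cpts setT by rewrite (sig_color_points wfG).
have d' := nonloop_dirty' nl (subxx _) px0 tx0.
have nc : conn0 (pedges G) setT x0 (sig x0) = false.
  by rewrite -(loopP px0 (sig_p_q px0)) (negPf nl).
have symr := joined_sym (chords G :|: pedges G).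
have d0 : #|[set K in comps0 (pedges G) setT | meets K dirty]| = 2.
  rewrite (card_comps_meets (S := [set x0; sig x0])) //.
  - by rewrite cards2 eq_sym (sig_neq wfG) // (edge_cover eE (end_p_edge H px0)).
  - by apply/subsetP=> z /set2P[]->.
  - move=> z zS; exists z; last exact: conn_refl.
    have ex0 := end_p_edge H px0.
    by case/set2P: zS => ->; rewrite inE ?(sig_edge wfG) // ex0.
  - move=> z w /set2P[]-> /set2P[]-> //; first by rewrite nc.
    by rewrite conn_sym // nc.
  move=> d dd td.
  have key z : z \in e -> z \in cpts setT -> exists2 x, x \in [set x0; sig x0] & conn0 (pedges G) setT x z.
    rewrite (es_eq H) inE => /orP[pz|qz] tz.
      by exists x0; rewrite ?set21 //; apply: conn_pedge px0 pz _ _.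
    exists (sig x0); rewrite ?set22 //.
    by apply: conn_pedge (sig_p_q px0) qz _ _.
  move: dd; rewrite inE => /orP[ed|ecd]; first exact: key.
  have tcd : chi d \in cpts setT by rewrite (chi_color_points wfG).
  have [x xS cx] := key _ ecd tcd; exists x => //; apply: conn_trans cx _.
  by rewrite -{2}[d](chiK wfG); apply: (conn_chi H).
have := contract_count H (@saturated_pedges _ _ _ _ _ _ H) d0 d'.
rewrite /vertices !color_pointsT setUC (setUC (pedges G')) (pedges_prune) => /eqP.
by rewrite addn1 addn2 eqSS => /eqP.
Qed.

(** There is one dirty class on each side: [Q] joins the two ends before contraction, and the outer
    paths are joined to each other after it. When no point of [e] has its colours in [t], both
    numbers are zero. *)
Lemma nonloop_count (Q : {set {set T}}) t : ~~ loop G e -> pedges G \subset Q -> saturated e Q ->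
  (forall x, x \in p -> x \in cpts t -> conn0 Q t x (sig x)) ->
  #|comps0 Q t| = #|comps' Q t|.
Proof.
move=> nl sQ satQ cQ; case: (set_0Vmem (p :&: cpts t)) => [p0|[x0 /setIP[px0 tx0]]].
  have [|d0 d'] := contract_dirty0 H Q (t := t).
    by move=> y py; apply/negP=> ty; have := in_set0 y; rewrite -p0 inE py ty.
  by have := contract_count H satQ d0 d'; rewrite !addn0.
have d' := nonloop_dirty' nl sQ px0 tx0.
have d0 : #|[set K in comps0 Q t | meets K dirty]| = 1.
  apply: (contract_dirty1 H (end_p_edge H px0)) => // y ey ty.
  by apply: edge_conn => //; apply: cQ.
by have := contract_count H satQ d0 d'; rewrite !addn1 => -[].
Qed.

Lemma conn_sig_edges t x : x \in p -> x \in cpts t ->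
  conn0 (pedges G :|: edges G) t x (sig x).
Proof.
move=> px tx; have ex := end_p_edge H px.
have Qe : e \in pedges G :|: edges G by rewrite inE eE orbT.
have es : sig x \in e by rewrite (sig_edge wfG).
have ts : sig x \in cpts t by rewrite (sig_color_points wfG).
exact: conn_pedge Qe ex es tx ts.
Qed.

Lemma conn_sig_strands t x : x \in p -> x \in cpts t ->
  conn0 (strands G :|: pedges G) t x (sig x).
Proof.
move=> px tx; have ex := end_p_edge H px.
have Qs : [set x; sig x] \in strands G :|: pedges G.
  by rewrite inE (mate_pair (wf_strands wfG) (wf_strands2 wfG)) ?(edge_cover eE).
have ts : sig x \in cpts t by rewrite (sig_color_points wfG).
exact: conn_pedge Qs (set21 _ _) (set22 _ _) tx ts.
Qed.

Let satU : saturated e (pedges G :|: edges G).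
Proof. by apply: saturatedU; [apply: saturated_pedges H | apply: saturated_edges H]. Qed.

Let satB : saturated e (strands G :|: pedges G).
Proof. by apply: saturatedU; [apply: saturated_strands H | apply: saturated_pedges H]. Qed.

Let pruneUE : pedges G' :|: edges G' = prune e (pedges G :|: edges G).
Proof. by rewrite pruneU pedges_prune (edges_prune H). Qed.

Let pruneBE : strands G' :|: pedges G' = prune e (strands G :|: pedges G).
Proof. by rewrite pruneU pedges_prune strands_prune. Qed.

Lemma nonloop_ug_comps : ~~ loop G e -> #|ug_comps G| = #|ug_comps G'|.
Proof.
move=> nl; rewrite !card_ug_comps -!(color_pointsT col) pruneUE.
by apply: nonloop_count => //; [apply: subsetUl | apply: conn_sig_edges].
Qed.

Lemma nonloop_bubbles t : ~~ loop G e -> #|bubbles col t G| = #|bubbles col t G'|.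
Proof.
move=> nl; rewrite /bubbles -setUA -[chords G' :|: _ :|: _]setUA pruneBE; apply: nonloop_count => //.
  exact: subsetUr.
exact: conn_sig_strands.
Qed.

(** Point form of the condition on trivial loops: distinct outer paths end in distinct components of
    the underlying graph of the contraction. The same separation follows for vertices and bubbles,
    whose blocks lie inside pre-edges or edges. *)
Definition unlinked : Prop := forall x y,
  x \in outer_points G e p -> y \in outer_points G e p ->
  conn' (pedges G :|: edges G) setT (chi x) (chi y) -> x = y.

(** The single class touching [e] is replaced by one class for each outer path with colours in [t].
    The boolean covers the case where [t] misses all points of [e]. *)
Lemma loop_count (Q : {set {set T}}) t : unlinked -> saturated e Q -> pedges G \subset Q ->
  (forall x, x \in p -> x \in cpts t -> conn0 Q t x (sig x)) ->
  (forall B, B \in prune e Q -> exists2 B', B' \in prune e (pedges G :|: edges G) & B \subset B') ->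
  #|comps0 Q t| + #|outer_points G e p :&: cpts t| = #|comps' Q t| + (p :&: cpts t != set0).
Proof.
move=> unl satQ sQ cQ subQ; case: (set_0Vmem (p :&: cpts t)) => [p0|[x0 /setIP[px0 tx0]]].
  have [|d0 d'] := contract_dirty0 H Q (t := t).
    by move=> y py; apply/negP=> ty; have := in_set0 y; rewrite -p0 inE py ty.
  have -> : outer_points G e p :&: cpts t = set0.
    apply/eqP; rewrite -subset0 -p0; apply: setSI; by apply/subsetP=> x /setIdP[].
  by have := contract_count H satQ d0 d'; rewrite p0 eqxx cards0 !addn0.
have d0 : #|[set K in comps0 Q t | meets K dirty]| = 1.
  apply: (contract_dirty1 H (end_p_edge H px0)) => // y ey ty.
  by apply: edge_conn => //; apply: cQ.
have -> : p :&: cpts t != set0 by apply/set0Pn; exists x0; rewrite inE px0.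
apply: (contract_count H satQ d0); apply: (contract_dirty_outer H) => x y Ox Oy tx ty cxy.
by apply: unl => //; apply: conn'_sub cxy; rewrite ?subsetT.
Qed.

Lemma outer_pointsT : outer_points G e p :&: cpts setT = outer_points G e p.
Proof.
rewrite color_pointsT; apply/setIidPl/subsetP=> x /setIdP[px _].
exact: (pedge_vpts wfG Pp).
Qed.

Lemma p_pointsT : p :&: cpts setT != set0.
Proof.
have [x0 px0] := card_p_pos; apply/set0Pn; exists x0.
by rewrite color_pointsT inE px0 (pedge_vpts wfG Pp).
Qed.

Lemma loop_vertices : loop G e -> unlinked ->
  #|vertices G| + #|outer_points G e p| = #|vertices G'|.+1.
Proof.
move=> lp unl; have := @loop_count (pedges G) setT unl (@saturated_pedges _ _ _ _ _ _ H) (subxx _).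
rewrite outer_pointsT p_pointsT !color_pointsT addn1 => h.
rewrite /vertices setUC (setUC (pedges G')) pedges_prune; apply: h.
- move=> x px _; have := loopP px (sig_p_q px); by rewrite lp color_pointsT.
- move=> B /setIdP[PB nB]; exists B => //; by rewrite !inE PB nB.
Qed.

Lemma loop_ug_comps : unlinked ->
  #|ug_comps G| + #|outer_points G e p| = #|ug_comps G'|.+1.
Proof.
move=> unl; have := @loop_count (pedges G :|: edges G) setT unl satU (subsetUl _ _).
rewrite outer_pointsT p_pointsT -pruneUE !color_pointsT addn1 => h.
rewrite !card_ug_comps; apply: h.
- by move=> x px; have := @conn_sig_edges setT x px; rewrite color_pointsT; apply.
- by move=> B QB; exists B.
Qed.

Lemma loop_bubbles t : unlinked ->
  #|bubbles col t G| + #|outer_points G e p :&: cpts t| =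
  #|bubbles col t G'| + (p :&: cpts t != set0).
Proof.
move=> unl; rewrite /bubbles -setUA -[chords G' :|: _ :|: _]setUA pruneBE; apply: loop_count => //.
- exact: subsetUr.
- exact: conn_sig_strands.
move=> B; rewrite pruneU => /setUP[/setIdP[SB nB]|/setIdP[PB nB]]; last first.
  by exists B; rewrite // !inE PB nB.
have [f fE [sf _]] := wf_strand wfG SB; exists f => //; rewrite !inE fE orbT.
by apply: contra nB; apply: subset_trans.
Qed.

End ContractStats.

(** * Faces and boundary of a contraction *)

Section Faces.

Variables (T : finType) (col : T -> 'I_4 * 'I_4) (G : sgraph T).
Hypothesis wfG : wf col G.

Notation chi := (mate (chords G)).
Notation sig := (mate (strands G)).
Notation cpts t := (color_points col t G).

Definition face_conn : rel T := conn (joined (chords G :|: strands G)) (vpts G).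

Lemma face_step u v : u \in vpts G -> joined (chords G :|: strands G) u v ->
  [\/ v = u, v = chi u | v = sig u /\ u \in cover (edges G)].
Proof.
move=> Vu; rewrite joined_setU (joined_mate (wf_chords wfG) (wf_chords2 wfG)).
rewrite (joined_mate (wf_strands wfG) (wf_strands2 wfG)) Vu /=.
by case/orP=> [/orP[]/eqP->|/andP[Eu /orP[]/eqP->]];
  [constructor 1|constructor 2|constructor 1|constructor 3].
Qed.

Lemma face_chi x : x \in vpts G -> face_conn x (chi x).
Proof.
move=> Vx; apply: conn1; rewrite ?(chi_in wfG) // joined_setU.
by rewrite (joined_mate (wf_chords wfG) (wf_chords2 wfG)) Vx eqxx orbT.
Qed.

Lemma face_sig x : x \in cover (edges G) -> face_conn x (sig x).
Proof.
move=> Ex; have Vx := cover_edges_vpts wfG Ex.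
apply: conn1; rewrite ?(sig_in wfG) // joined_setU.
by rewrite (joined_mate (wf_strands wfG) (wf_strands2 wfG)) Ex eqxx !orbT.
Qed.

Lemma face_colors x y : face_conn x y -> colors col x = colors col y.
Proof.
move=> cxy; suff : y \in [set z | colors col z == colors col x] by rewrite inE => /eqP->.
apply: (conn_closed _ cxy); last by rewrite inE.
move=> u v Vu _ /(face_step Vu); rewrite !inE => -[->//|->|[-> _]].
  by rewrite (colors_chi wfG).
by rewrite (colors_sig wfG).
Qed.

Lemma face_colors_in K x y : K \in faces G -> x \in K -> y \in K -> colors col x = colors col y.
Proof.
move=> FK Kx; have [_ ->] := comps_cls (@joined_sym _ _) FK Kx.
by rewrite inE => /andP[_ /face_colors].
Qed.

Lemma face_vpts K x : K \in faces G -> x \in K -> x \in vpts G.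
Proof. by move=> FK Kx; have [] := comps_cls (@joined_sym _ _) FK Kx. Qed.

Lemma face_uniq K L x : K \in faces G -> L \in faces G -> x \in K -> x \in L -> K = L.
Proof.
move=> FK FL Kx Lx; have [_ ->] := comps_cls (@joined_sym _ _) FK Kx.
by have [_ ->] := comps_cls (@joined_sym _ _) FL Lx.
Qed.

Lemma face_exists x : x \in vpts G ->
  cls (joined (chords G :|: strands G)) (vpts G) x \in faces G.
Proof. exact: mem_comps. Qed.

Lemma face_color_points K x t : K \in faces G -> x \in K ->
  (K \subset cpts t) = (x \in cpts t).
Proof.
move=> FK Kx; apply/subsetP/idP => [|xt y Ky]; first exact.
move: xt; rewrite !color_pointsE !inE (face_colors_in FK Kx Ky) => /andP[_ ->].
by rewrite (face_vpts FK Ky).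
Qed.

Lemma she_pedge s : s \in shes G -> s \in pedges G.
Proof. exact: (subsetP (wf_shes wfG)). Qed.

Lemma she_cover s x : s \in shes G -> x \in s -> x \in cover (shes G).
Proof. by move=> Ss sx; apply/bigcupP; exists s. Qed.

Lemma she_vpts s x : s \in shes G -> x \in s -> x \in vpts G.
Proof. move=> Ss; exact: (pedge_vpts wfG (she_pedge Ss)). Qed.

Lemma bd_edgesT : bd_edges col setT G = open_faces G.
Proof.
apply/setP=> K; rewrite inE (color_pointsT col); case: (boolP (K \in open_faces G)) => //= /setIdP[FK _].
by apply/subsetP=> x; apply: face_vpts.
Qed.

Lemma open_face_she s x : s \in shes G -> x \in s ->
  cls (joined (chords G :|: strands G)) (vpts G) x \in open_faces G.
Proof.
move=> Ss sx; have Vx := she_vpts Ss sx.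
rewrite inE face_exists //; apply/meetsP; exists x; [exact: mem_cls|exact: she_cover Ss sx].
Qed.

Lemma mem_bd_vertices t s :
  s \in shes G -> [exists K in bd_edges col t G, meets K s] = meets s (cpts t).
Proof.
move=> Ss; apply/existsP/meetsP.
  move=> [K /andP[/setIdP[oK /subsetP sK] /meetsP[x Kx sx]]]; exists x => //; exact: sK.
move=> [x sx tx]; have oF := open_face_she Ss sx.
have Vx := she_vpts Ss sx.
exists (cls (joined (chords G :|: strands G)) (vpts G) x).
apply/andP; split; last by apply/meetsP; exists x; rewrite ?mem_cls.
by rewrite inE oF (face_color_points _ (face_exists Vx) (mem_cls _ Vx)).
Qed.

Lemma num_bd_compsE : num_bd_comps G = #|bd_faces col setT G|.
Proof.
rewrite /num_bd_comps /bd_faces bd_edgesT; congr #|pred_of_set (comps _ _)|.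
apply/setP=> s; rewrite inE; case: (boolP (s \in shes G)) => //= Ss.
rewrite -bd_edgesT mem_bd_vertices // color_pointsT; apply/esym/meetsP.
have [x sx] := partition_nonempty (wf_pedges wfG) (she_pedge Ss).
by exists x => //; apply: she_vpts Ss sx.
Qed.

End Faces.

Lemma bd_adj_sym (T : finType) (F : {set {set T}}) : symmetric (bd_adj F).
Proof. by move=> a b; apply: eq_existsb => K; rewrite [meets K a && _]andbC. Qed.

Section ContractFaces.

Variables (T : finType) (col : T -> 'I_4 * 'I_4) (G : sgraph T) (e p q : {set T}).
Hypothesis H : edge_spec col G e p q.
Let wfG := es_wf H.
Let wfG' := contract_wf H.
Let eE := es_edge H.

Notation chi := (mate (chords G)).
Notation sig := (mate (strands G)).
Notation G' := (contract G e).

Lemma contract_face_conn x y : x \in vpts G' -> y \in vpts G' ->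
  face_conn G x y = face_conn G' x y.
Proof.
move=> V'x V'y; have [Vx nx] := setDP V'x; have [Vy ny] := setDP V'y.
apply/idP/idP => [cxy|]; last first.
  apply: conn_sub => u v /setDP[Vu nu] /setDP[Vv nv].
  rewrite joined_setU (joined_contract_chords H) inE nu Vu /=.
  case/orP=> [/orP[]/eqP->|/joinedP[s /setDP[Ss _] [su sv]]]; first exact: conn_refl.
    rewrite /chi'; case: ifP => ecu; last exact: (face_chi wfG).
    have Ecu := edge_cover eE ecu.
    apply: conn_trans (face_chi wfG Vu) _; apply: conn_trans (face_sig wfG Ecu) _.
    by apply: (face_chi wfG); rewrite (sig_in wfG) (chi_in wfG).
  by apply: conn1 => //; rewrite joined_setU; apply/orP; right; apply/joinedP; exists s.
(* A point of [e] is represented by the end [chi z] of its outer path; crossing the strand then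
   becomes a step along the new chord. The condition on [chi z] excludes inner faces, which a path
   starting outside [e] never enters. *)
pose K := [set z in vpts G | if z \in e then (chi z \notin e) && face_conn G' x (chi z)
                             else face_conn G' x z].
suff : y \in K by rewrite inE (negPf ny) => /andP[].
apply: (conn_closed _ cxy); last by rewrite inE Vx (negPf nx) /= /face_conn conn_refl.
move=> u v Vu Vv /(face_step wfG Vu) [->//|->|[-> Eu]].
  rewrite !inE Vu (chi_in wfG) Vu /=; have [eu|nu] := boolP (u \in e).
    by case/andP=> ncu cu; rewrite (negPf ncu).
  case: (boolP (chi u \in e)) => ecu cxu; first by rewrite (chiK wfG) nu.
  have V'u : u \in vpts G' by rewrite inE nu.
  apply: conn_trans cxu _; apply: conn1 => //; first by rewrite inE ecu (chi_in wfG).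
  by rewrite joined_setU (joined_contract_chords H) V'u /chi' (negPf ecu) eqxx orbT.
rewrite !inE Vu (sig_in wfG) Vu (sig_edge wfG) //=; have [eu|nu] := boolP (u \in e).
  rewrite (chi_sig_edge H) // => /andP[ncu cu]; rewrite ncu /=; apply: conn_trans cu _.
  have V1 : chi u \in vpts G' by rewrite inE ncu (chi_in wfG).
  apply: conn1 => //; first by rewrite inE (chi_sig_edge H) // ncu (chi_in wfG) (sig_in wfG).
  by rewrite joined_setU (joined_contract_chords H) V1 /chi' (chiK wfG) eu eqxx orbT.
move=> cxu; apply: conn_trans cxu _; apply: conn1.
- by rewrite inE nu.
- by rewrite inE (sig_edge wfG) // nu (sig_in wfG).
rewrite joined_setU; apply/orP; right; apply/joinedP; exists [set u; sig u]; last by rewrite set21 set22.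
rewrite inE (mate_pair (wf_strands wfG) (wf_strands2 wfG)) // andbT.
by apply: contra nu => /setIdP[_ /subsetP]; apply; rewrite set21.
Qed.

Lemma contract_face_cls x : x \in vpts G' ->
  cls (joined (chords G' :|: strands G')) (vpts G') x =
  cls (joined (chords G :|: strands G)) (vpts G) x :\: e.
Proof.
move=> V'x; apply/setP=> y; rewrite [RHS]inE !(inE, in_set) /=.
case: (boolP (y \in e)) => //= ny; apply: andb_id2l => Vy.
by rewrite -/(face_conn G' x y) -/(face_conn G x y) contract_face_conn // inE ny.
Qed.

Lemma contract_faces : faces G' = [set K :\: e | K in [set K in faces G | ~~ (K \subset e)]].
Proof.
apply/setP=> K; apply/imsetP/imsetP => [[x V'x ->]|[L /setIdP[FL /subsetPn[x Lx nx]] ->]].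
  have [Vx nx] := setDP V'x.
  exists (cls (joined (chords G :|: strands G)) (vpts G) x); last exact: contract_face_cls.
  by rewrite inE face_exists //; apply/subsetPn; exists x; rewrite ?mem_cls.
have [Vx LE] := comps_cls (@joined_sym _ _) FL Lx.
have V'x : x \in vpts G' by rewrite inE nx.
by exists x; rewrite // {1}LE; apply/esym/contract_face_cls.
Qed.

(** A face contains the chord partner of each of its points, so a face inside [e] closes up after
    one strand and one chord. Contraction exchanges these faces for as many trivial circles, which
    keeps the number of closed faces. *)
Lemma inner_faces_faces : [set K in faces G | K \subset e] = inner_faces G e.
Proof.
have key x : x \in e -> chi x \in e ->
    cls (joined (chords G :|: strands G)) (vpts G) x = edge_block G x.
  move=> ex ecx; have Vx := edge_in_vpts H ex; rewrite (edge_block_innerE H) //.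
  have ci := inner_chord H ex ecx.
  apply/setP=> y; apply/idP/set2P => [/setIdP[_ cxy]|]; last first.
    case=> ->; first exact: mem_cls.
    by rewrite inE (sig_in wfG) Vx; apply: (face_sig wfG); apply: edge_cover ex.
  apply/set2P; apply: (conn_closed _ cxy); last by rewrite set21.
  move=> u v Vu _ /(face_step wfG Vu) [->//|->|[-> _]] /set2P[]->; apply/set2P.
  - by right.
  - by left; rewrite -ci (chiK wfG).
  - by right.
  - by left; rewrite (sigK wfG).
apply/setP=> K; rewrite inE (inner_facesE H); apply/andP/imsetP.
  move=> [/imsetP[x Vx ->] sK].
  have ex : x \in e by apply: (subsetP sK); rewrite mem_cls.
  have ecx : chi x \in e.
    by apply: (subsetP sK); rewrite inE (chi_in wfG) Vx; apply: (face_chi wfG).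
  case: (boolP (x \in p)) => [px|np].
    by exists x; [rewrite inE px | apply: key].
  exists (sig x); last by rewrite (edge_block_sig H) -key.
  by rewrite inE (sig_end H) // (chi_sig_edge H) // ecx andbT; move: ex; rewrite (es_eq H) inE (negPf np).
move=> [x /setIdP[px ecx] ->]; have ex := end_p_edge H px.
by rewrite -key // face_exists ?(edge_in_vpts H) // key // (edge_block_inner H) // ecx.
Qed.

Lemma meets_setD K (S : {set T}) : (forall x, x \in S -> x \notin e) ->
  meets (K :\: e) S = meets K S.
Proof.
move=> nS; apply/meetsP/meetsP => -[x]; first by case/setDP; exists x.
by move=> Kx Sx; exists x; rewrite // inE nS.
Qed.

Lemma setD_face_inj : {in [set K in faces G | ~~ (K \subset e)] &, injective (fun K => K :\: e)}.
Proof.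
move=> K L /setIdP[FK /subsetPn[x Kx nx]] /setIdP[FL _] eKL.
apply: (face_uniq FK FL Kx); have : x \in K :\: e by rewrite inE nx.
by rewrite eKL => /setDP[].
Qed.

Lemma she_notin s x : s \in shes G -> x \in s -> x \notin e.
Proof. by move=> Ss sx; apply/(cover_shes_notin H)/(she_cover Ss sx). Qed.

Lemma open_face_not_sub K : K \in open_faces G -> ~~ (K \subset e).
Proof.
move=> /setIdP[_ /meetsP[x Kx Sx]]; apply/subsetPn; exists x => //.
exact: (cover_shes_notin H).
Qed.

Lemma contract_open_faces : open_faces G' = [set K :\: e | K in open_faces G].
Proof.
apply/setP=> K; rewrite inE contract_faces; apply/andP/imsetP.
  move=> [/imsetP[L /setIdP[FL _] ->]]; rewrite meets_setD; last exact: (cover_shes_notin H).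
  by move=> oL; exists L; rewrite // inE FL.
move=> [L oL ->]; have nL := open_face_not_sub oL; have [FL mL] := setIdP oL.
rewrite meets_setD; last exact: (cover_shes_notin H).
by split=> //; apply/imsetP; exists L; rewrite // inE FL.
Qed.

Lemma contract_num_bd_edges : num_bd_edges G' = num_bd_edges G.
Proof.
rewrite /num_bd_edges contract_open_faces card_in_imset // => K L oK oL.
by apply: setD_face_inj; rewrite inE open_face_not_sub // andbT; [case/setIdP: oK|case/setIdP: oL].
Qed.

Lemma contract_num_closed_faces : num_closed_faces G' = num_closed_faces G.
Proof.
suff h : #|faces G :\: open_faces G| = inner_number G e + #|faces G' :\: open_faces G'|.
  by rewrite /num_closed_faces h [inner_number G e + _]addnC -addnA [inner_number G e + _]addnC.
rewrite /inner_number -inner_faces_faces.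
rewrite -(cardsID [set K : {set T} | K \subset e] (faces G :\: open_faces G)).
congr (_ + _).
  apply: eq_card => K; apply/setIP/setIdP => [[/setDP[FK _]]|[FK Ke]]; first by rewrite inE.
  split; last by rewrite inE.
  by rewrite inE FK andbT; apply: contraL Ke; apply: open_face_not_sub.
rewrite -(card_in_imset (f := fun K => K :\: e) (D := faces G :\: open_faces G :\: _)); last first.
  move=> K L KI LI; apply: setD_face_inj.
    by move: KI => /setDP[/setDP[FK _]]; rewrite !inE FK => ->.
  by move: LI => /setDP[/setDP[FL _]]; rewrite !inE FL => ->.
apply/esym; apply: eq_card => K; rewrite inE contract_open_faces contract_faces; apply/andP/imsetP.
  move=> [nK /imsetP[L /setIdP[FL nL] eK]]; exists L => //.
  rewrite !inE nL FL andbT /=; apply: contra nK => mL; apply/imsetP; exists L => //.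
  by rewrite inE FL.
move=> [L /setDP[/setDP[FL noL] nL] ->]; rewrite inE in nL; split; last first.
  by apply/imsetP; exists L; rewrite // inE FL.
apply: contra noL => /imsetP[L' oL' /setD_face_inj ->] //; first by rewrite inE FL.
by rewrite inE open_face_not_sub // andbT; case/setIdP: oL'.
Qed.

Lemma contract_bd_edges t :
  bd_edges col t G' = [set K :\: e | K in bd_edges col t G].
Proof.
have key L : L \in open_faces G ->
  (L :\: e \subset color_points col t G') = (L \subset color_points col t G).
  move=> oL; have [FL /meetsP[x Lx Sx]] := setIdP oL.
  have nx := cover_shes_notin H Sx; have xL : x \in L :\: e by rewrite inE nx.
  have oL' : L :\: e \in open_faces G' by rewrite contract_open_faces; apply/imsetP; exists L.
  have [FL' _] := setIdP oL'.
  by rewrite (face_color_points wfG' _ FL' xL) (face_color_points wfG _ FL Lx) cpts'E inE nx.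
apply/setP=> K; rewrite inE contract_open_faces; apply/andP/imsetP.
  by move=> [/imsetP[L oL ->]]; rewrite key // => sL; exists L; rewrite // inE oL.
by move=> [L /setIdP[oL sL] ->]; rewrite key //; split=> //; apply/imsetP; exists L.
Qed.

(** Open faces lose only points of [e], and no sHE touches [e], so all incidences persist. Boundary
    faces are sets of sHEs, hence literally the same sets. *)
Lemma contract_bd_faces t : bd_faces col t G' = bd_faces col t G.
Proof.
have key s : s \in shes G -> forall K, meets (K :\: e) s = meets K s.
  by move=> Ss K; apply: meets_setD => x; apply: she_notin.
have keyE (P Q : pred {set T}) : (forall K, P (K :\: e) = Q K) ->
    [exists K in bd_edges col t G', P K] = [exists K in bd_edges col t G, Q K].
  move=> PQ; rewrite contract_bd_edges; apply/existsP/existsP.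
    move=> [_ /andP[/imsetP[K bK ->]]]; rewrite PQ => QK; exists K; exact/andP.
  move=> [K /andP[bK QK]]; exists (K :\: e); rewrite PQ QK andbT; apply/imsetP; by exists K.
rewrite /bd_faces; set A' := [set _ in shes G' | _]; set A := [set _ in shes G | _].
have -> : A' = A.
  by apply/setP=> s; rewrite !inE; apply: andb_id2l => Ss; apply: keyE => K; apply: key.
apply: eq_comps_conn; apply: eq_conn => a b /setIdP[Sa _] /setIdP[Sb _].
by apply: keyE => K; rewrite !key.
Qed.

Lemma contract_num_bd_comps : num_bd_comps G' = num_bd_comps G.
Proof. by rewrite (num_bd_compsE wfG) (num_bd_compsE wfG') contract_bd_faces. Qed.

Lemma contract_num_bd_faces : num_bd_faces col G' = num_bd_faces col G.
Proof. by apply: eq_bigr => t _; rewrite contract_bd_faces. Qed.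

End ContractFaces.

(** * Cutting a bridge *)

Lemma trivIset_uniq (U : finType) (P : {set {set U}}) :
  (forall A B x, A \in P -> B \in P -> x \in A -> x \in B -> A = B) -> trivIset P.
Proof.
move=> uP; apply/trivIsetP=> A B PA PB; apply: contraR => /meetsP[x Ax Bx].
by apply/eqP; apply: uP PA PB Ax Bx.
Qed.

Section CutEdge.

Variables (T : finType) (col : T -> 'I_4 * 'I_4) (G : sgraph T) (e p q : {set T}).
Hypothesis H : edge_spec col G e p q.
Let wfG := es_wf H.
Let eE := es_edge H.
Let Pp := es_p H.
Let Pq := es_q H.

Notation chi := (mate (chords G)).
Notation sig := (mate (strands G)).
Notation cpts t := (color_points col t G).
Notation Gc := (cut G [set e]).
Notation conn0 Q t := (conn (joined (chords G :|: Q)) (cpts t)).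
Notation comps0 Q t := (comps (joined (chords G :|: Q)) (cpts t)).
Implicit Types (Q : {set {set T}}).

Lemma cut_edge_wf : wf col Gc.
Proof. by apply: cut_wf => //; rewrite sub1set. Qed.
Let wfC := cut_edge_wf.

Lemma cut_edges1 : edges Gc = prune e (edges G).
Proof. exact: (edges_prune H). Qed.

Lemma cut_strands1 : strands Gc = prune e (strands G).
Proof.
apply/setP=> s; rewrite !inE; apply: andb_id2l => _.
apply/forallP/idP => [/(_ e)|ns f]; first by rewrite set11.
by apply/implyP=> /set1P->.
Qed.

Lemma cut_shes1 : shes Gc = shes G :|: [set p; q].
Proof. by rewrite /= big_set1 (es_ends H). Qed.

Lemma cover_cut_shes1 x : (x \in cover (shes Gc)) = (x \in cover (shes G)) || (x \in e).
Proof.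
rewrite cut_shes1 cover_setU inE; congr (_ || _); rewrite -(es_ends H).
by have [_ ->] := wf_ends wfG eE.
Qed.

(** Cutting leaves all chords in place, so the zone of change is [e] alone, without the chord
    partners that contraction had to include. *)
Lemma cut_clean Q Q' t : (forall x y, x \notin e -> joined Q x y = joined Q' x y) ->
  [set K in comps0 Q t | ~~ meets K e] = [set K in comps0 Q' t | ~~ meets K e].
Proof.
move=> eQ; apply: comps_clean => //; try exact: joined_sym.
move=> x y nx tx; rewrite joined_setU [joined (chords G :|: Q') x y]joined_setU.
by rewrite eQ.
Qed.

Lemma cut_dirty1 Q t x0 : x0 \in e -> x0 \in cpts t ->
  (forall y, y \in e -> y \in cpts t -> conn0 Q t x0 y) ->
  #|[set K in comps0 Q t | meets K e]| = 1.
Proof.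
move=> ex0 tx0 all0; rewrite (card_comps_meets (S := [set x0])) ?cards1 ?sub1set //.
- exact: joined_sym.
- by move=> x /set1P->; exists x0; last exact: conn_refl.
- by move=> x y /set1P-> /set1P->.
by move=> d ed td; exists x0; rewrite ?set11 //; apply: all0.
Qed.

Lemma cut_dirty2 Q t x0 : pedges G \subset Q -> x0 \in p -> x0 \in cpts t ->
  ~~ conn0 Q t x0 (sig x0) -> #|[set K in comps0 Q t | meets K e]| = 2.
Proof.
move=> /subsetP sQ px0 tx0 nc; have ex0 := end_p_edge H px0.
have tsx0 : sig x0 \in cpts t by rewrite (sig_color_points wfG).
have symr := joined_sym (chords G :|: Q).
rewrite (card_comps_meets (S := [set x0; sig x0])) //.
- by rewrite cards2 eq_sym (sig_neq wfG) // (edge_cover eE).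
- by apply/subsetP=> z /set2P[]->.
- move=> z zS; exists z; last exact: conn_refl.
  by case/set2P: zS => ->; rewrite ?(sig_edge wfG).
- move=> z w /set2P[]-> /set2P[]-> //; first by rewrite (negPf nc).
  by rewrite conn_sym // (negPf nc).
move=> d; rewrite (es_eq H) inE => /orP[pd|qd] td.
  exists x0; rewrite ?set21 //; exact: conn_pedge (sQ _ Pp) px0 pd tx0 td.
exists (sig x0); rewrite ?set22 //.
exact: conn_pedge (sQ _ Pq) (sig_p_q H px0) qd tsx0 td.
Qed.

Lemma cut_dirty0 Q t : p :&: cpts t = set0 -> #|[set K in comps0 Q t | meets K e]| = 0.
Proof.
move=> p0; have np y : y \in p -> y \notin cpts t.
  by move=> py; apply/negP=> ty; have := in_set0 y; rewrite -p0 inE py ty.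
apply/eqP; rewrite cards_eq0; apply/eqP/setP=> K; rewrite inE in_set0.
apply/negP=> /andP[cK /meetsP[d Kd]].
have [td _] := comps_cls (@joined_sym _ _) cK Kd.
rewrite (es_eq H) inE => /orP[/np|qd]; first by rewrite td.
have /np : sig d \in p by rewrite (sig_end H) // (end_q_edge H).
by rewrite (sig_color_points wfG) td.
Qed.

(** [Q] stands for the blocks before the cut, joining the ends of [e], and [Q'] for those after it:
    one dirty class splits in two, unless [t] misses [e]. *)
Lemma cut_count Q Q' t : (forall x y, x \notin e -> joined Q x y = joined Q' x y) ->
  pedges G \subset Q -> pedges G \subset Q' ->
  (forall x, x \in p -> x \in cpts t -> conn0 Q t x (sig x)) ->
  (forall x, x \in p -> x \in cpts t -> ~~ conn0 Q' t x (sig x)) ->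
  #|comps0 Q' t| = #|comps0 Q t| + (p :&: cpts t != set0).
Proof.
move=> eQ sQ sQ' cQ nQ'; rewrite (card_compsD _ _ e) (card_compsD (joined (_ :|: Q)) _ e).
rewrite -(cut_clean t eQ) -addnA; congr (_ + _).
case: (set_0Vmem (p :&: cpts t)) => [p0|[x0 /setIP[px0 tx0]]].
  by rewrite !cut_dirty0 // p0 eqxx.
have -> : p :&: cpts t != set0 by apply/set0Pn; exists x0; rewrite inE px0.
rewrite (cut_dirty2 sQ' px0 tx0) ?nQ' // (cut_dirty1 (end_p_edge H px0) tx0) //.
by move=> y ey ty; apply: (edge_conn H) => //; apply: cQ.
Qed.

(** Connectivity of the underlying graph after the cut, on points as in [conn_underlying]. A bridge
    is an edge whose two ends it does not relate. *)
Definition connUc := conn (joined (chords G :|: (pedges G :|: edges Gc))) (vpts G).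

Lemma connUc_sub (Q : {set {set T}}) t :
  (forall B, B \in Q -> exists2 B', B' \in pedges G :|: edges Gc & B \subset B') ->
  subrel (conn0 Q t) connUc.
Proof.
move=> sQ; apply: conn_sub => u v /color_points_vpts Vu /color_points_vpts Vv ruv.
apply: conn1 => //; move: ruv.
rewrite joined_setU [joined (chords G :|: (_ :|: _)) u v]joined_setU.
case/orP=> [->//|/joinedP[B QB [Bu Bv]]]; apply/orP; right.
have [B' QB' /subsetP sB] := sQ B QB; apply/joinedP; exists B' => //.
by split; apply: sB.
Qed.

Lemma sub_pedges B : B \in pedges G -> exists2 B', B' \in pedges G :|: edges Gc & B \subset B'.
Proof. by move=> PB; exists B; rewrite // inE PB. Qed.

Lemma sub_strands B : B \in strands Gc -> exists2 B', B' \in pedges G :|: edges Gc & B \subset B'.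
Proof.
move=> SB; have [f fE [sf _]] := wf_strand wfC SB; exists f => //.
by rewrite inE fE orbT.
Qed.

Lemma connUc_pedge r x y : r \in pedges G -> x \in r -> y \in r -> connUc x y.
Proof.
move=> Pr rx ry; apply: conn1; rewrite ?(pedge_vpts wfG Pr) // !joined_setU.
by apply/or3P/Or32/joinedP; exists r.
Qed.

Lemma connUc_sym : symmetric connUc.
Proof. by apply: conn_sym; apply: joined_sym. Qed.

Lemma connUc_face : subrel (face_conn Gc) connUc.
Proof.
move=> x y cxy; apply: (connUc_sub (Q := strands Gc) (t := setT)) => [B|]; first exact: sub_strands.
by rewrite (color_pointsT col G).
Qed.

Let eqU x y : x \notin e -> joined (pedges G :|: edges G) x y = joined (pedges G :|: edges Gc) x y.
Proof.
move=> nx; rewrite !joined_setU cut_edges1.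
by have [-> _] := joined_prune y (saturated_edges H) nx.
Qed.

Let eqB x y : x \notin e -> joined (strands G :|: pedges G) x y = joined (strands Gc :|: pedges G) x y.
Proof.
move=> nx; rewrite !joined_setU cut_strands1.
by have [-> _] := joined_prune y (saturated_strands H) nx.
Qed.

(** Every step through [e] can be rerouted along the connection that remains. *)
Lemma cut_ug_comps_conn x : x \in p -> connUc x (sig x) -> #|ug_comps Gc| = #|ug_comps G|.
Proof.
move=> px cx; rewrite !card_ug_comps /=; congr #|pred_of_set _|.
apply: eq_comps_conn => a b; apply/idP/idP; apply: conn_sub => u v Vu Vv ruv.
  apply: conn1 => //; move: ruv; rewrite !joined_setU => /or3P[->|->|]; rewrite ?orbT //.
  by move=> /joinedP[f /setDP[fE _] ff]; apply/or3P/Or33/joinedP; exists f.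
move: ruv; rewrite joined_setU; case/orP=> [ruv|].
  by apply: conn1; rewrite // joined_setU ruv.
case: (boolP (u \in e)) => [eu|nu]; last first.
  by rewrite eqU // => ruv; apply: conn1; rewrite // joined_setU ruv orbT.
rewrite joined_setU => /orP[ruv|].
  by apply: conn1; rewrite // !joined_setU ruv !orbT.
move=> /joinedP[f fE [fu fv]]; have ef := edge_uniq wfG fE eE fu eu; subst f.
have key z : z \in e -> connUc x z.
  rewrite (es_eq H) inE => /orP[pz|qz]; first exact: connUc_pedge px pz.
  by apply: conn_trans cx _; apply: connUc_pedge (sig_p_q H px) qz.
by apply: conn_trans (key _ fv); rewrite -/(connUc u x) connUc_sym; apply: key.
Qed.

Lemma loop_connUc x : loop G e -> x \in p -> connUc x (sig x).
Proof.
move=> lp px; have := loopP H px (sig_p_q H px); rewrite lp => /esym.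
by apply: connUc_sub => B; apply: sub_pedges.
Qed.

(** The bridge condition in a form inherited by every spanning subgraph that keeps [e], since
    cutting further edges only shrinks [connUc]. *)
Hypothesis nlink : forall x, x \in p -> ~~ connUc x (sig x).

Lemma nlink_pq x y : x \in p -> y \in q -> ~~ connUc x y.
Proof.
move=> px qy; apply: contra (nlink px) => cxy; apply: conn_trans cxy _.
exact: connUc_pedge Pq qy (sig_p_q H px).
Qed.

Lemma cut_ug_comps : #|ug_comps Gc| = #|ug_comps G|.+1.
Proof.
rewrite !card_ug_comps /=.
have := @cut_count (pedges G :|: edges G) (pedges G :|: edges Gc) setT eqU (subsetUl _ _) (subsetUl _ _).
rewrite (p_pointsT H) addn1 !(color_pointsT col G); apply.
  by move=> x px; have := @conn_sig_edges _ _ _ _ _ _ H setT x px; rewrite (color_pointsT col G).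
by move=> x px _; apply: nlink.
Qed.

Lemma cut_bubbles t : #|bubbles col t Gc| = #|bubbles col t G| + (p :&: cpts t != set0).
Proof.
rewrite /bubbles -setUA -[chords G :|: strands G :|: _]setUA.
apply: (cut_count eqB (subsetUr _ _) (subsetUr _ _)); first exact: (conn_sig_strands H).
move=> x px tx; apply: contra (nlink px); apply: connUc_sub => B /setUP[]; first exact: sub_strands.
exact: sub_pedges.
Qed.

Lemma face_cut_conn : subrel (face_conn Gc) (face_conn G).
Proof.
apply: conn_sub => u v Vu Vv ruv; apply: conn1 => //; move: ruv.
rewrite !joined_setU => /orP[->//|/joinedP[s /setIdP[Ss _] ss]].
by apply/orP; right; apply/joinedP; exists s.
Qed.

Lemma clean_faces : [set K in faces G | ~~ meets K e] = [set K in faces Gc | ~~ meets K e].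
Proof.
have := @cut_clean (strands G) (strands Gc) setT; rewrite !(color_pointsT col G).
apply=> x y nx; rewrite cut_strands1.
by have [-> _] := joined_prune y (saturated_strands H) nx.
Qed.

(** Faces preserve the colour pair, and the points of [p] have distinct pairs, so the three strands
    lie on three different faces. *)
Lemma card_dirty_faces : #|[set K in faces G | meets K e]| = 3.
Proof.
rewrite -(wf_card wfG Pp); apply: card_comps_meets; first exact: joined_sym.
- by apply/subsetP=> x; apply: (pedge_vpts wfG Pp).
- by move=> x px; exists x; [apply: (end_p_edge H) | apply: conn_refl].
- by move=> x y px py /(face_colors wfG); apply: (col_pedge_inj wfG Pp).
move=> d; rewrite {1}(es_eq H) inE => /orP[pd|qd] Vd; first by exists d; rewrite ?conn_refl.
have ed := end_q_edge H qd.
exists (sig d); first by rewrite (sig_end H).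
have := @face_sig _ _ _ wfG (sig d); rewrite (sigK wfG); apply.
by apply: edge_cover eE _; rewrite (sig_edge wfG).
Qed.

(** By colours, two points of [e] on one face are the ends of a strand, but these lie on different
    sides of the bridge. So the six points of [e] are on six faces. *)
Lemma card_cut_dirty_faces : #|[set K in faces Gc | meets K e]| = 6.
Proof.
have e6 : #|e| = 6.
  rewrite (es_eq H) cardsU (_ : p :&: q = set0) ?cards0 ?(wf_card wfG) //.
  apply/eqP/set0Pn=> -[x /setIP[px]]; apply/negP; exact: (ends_disjoint H).
rewrite -e6; apply: card_comps_meets; first exact: joined_sym.
- by apply/subsetP=> x; apply: (edge_in_vpts H).
- by move=> x ex; exists x; rewrite ?conn_refl.
- move=> x y ex ey cxy; have := face_colors wfC cxy => exy.
  have /= [->//|ysx] := edge_colors H ex ey exy.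
  have cU := connUc_face cxy; move: ex; rewrite (es_eq H) inE => /orP[px|qx].
    by rewrite ysx (negPf (nlink px)) in cU.
  have psx : sig x \in p by rewrite (sig_end H) // (end_q_edge H).
  rewrite ysx connUc_sym in cU; have := nlink psx; by rewrite (sigK wfG) cU.
by move=> d ed Vd; exists d; rewrite ?conn_refl.
Qed.

Lemma cut_card_faces : #|faces Gc| = #|faces G| + 3.
Proof.
rewrite (card_compsD _ _ e) (card_compsD (joined (chords G :|: strands G)) _ e).
by rewrite -/(faces Gc) -/(faces G) -clean_faces card_dirty_faces card_cut_dirty_faces -addnA.
Qed.

(* A closed face would contain some but not all points of [p], on the side of
   [p], and be closed under chords and strands, against parity. *)
Lemma bridge_face_open K : K \in faces G -> meets K e -> meets K (cover (shes G)).
Proof.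
move=> FK /meetsP[x0 Kx0 ex0].
have [x Kx px] : exists2 x, x \in K & x \in p.
  move: (ex0); rewrite {1}(es_eq H) inE => /orP[|qx0]; first by exists x0.
  exists (sig x0); last by rewrite (sig_end H).
  have [Vx0 ->] := comps_cls (@joined_sym _ _) FK Kx0.
  by rewrite inE (sig_in wfG) Vx0; apply: (face_sig wfG); apply: edge_cover ex0.
apply: contraT => nK.
have nS z : z \in K -> z \notin cover (shes G).
  by move=> Kz; apply: contra nK => Sz; apply/meetsP; exists z.
have [Vx KE] := comps_cls (@joined_sym _ _) FK Kx.
(* The part of [K] still connected to [x] after the cut. By colours [x] is its only point in [p],
   whereas parity forces every other point of [p] into it. *)
pose F := cls (joined (chords Gc :|: strands Gc)) (vpts Gc) x.
have sFK z : z \in F -> z \in K.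
  by rewrite KE !inE => /andP[-> /face_cut_conn].
have FF : F \in faces Gc by apply: face_exists.
have Fx : x \in F by apply: mem_cls.
have Fclosed u v : u \in F -> v \in vpts G -> joined (chords Gc :|: strands Gc) u v -> v \in F.
  rewrite !inE => /andP[Vu cu] Vv ruv; rewrite Vv; apply: conn_trans cu _; exact: conn1.
have [sP s2] := (wf_strands wfC, wf_strands2 wfC).
have ncov z : z \in p -> z \notin cover (strands Gc).
  move=> pz; have [/eqP-> _ _] := and3P sP.
  apply/negP=> Ez; have /pred0P/(_ z)/= := wf_disjoint wfC.
  by rewrite Ez cover_cut_shes1 (end_p_edge H pz) orbT.
have [y py nxy] : exists2 y, y \in p & y != x.
  have : 0 < #|p :\ x| by have := cardsD1 x p; rewrite (wf_card wfG Pp) px add1n => -[<-].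
  by case/card_gt0P=> y /setD1P[]; exists y.
suff Fy : y \in F.
  case/eqP: nxy; apply/esym/(col_pedge_inj wfG Pp px py).
  exact: (face_colors_in wfC FF Fx Fy).
have Vy := pedge_vpts wfG Pp py.
apply: (@parity _ col Gc wfC p (strands Gc) setT F x y) => //.
- apply: trivIset_uniq => A B z; rewrite !in_setU1 => /orP[/eqP->|SA] /orP[/eqP->|SB] Az Bz //.
  + by case/negP: (ncov _ Az); apply/bigcupP; exists B.
  + by case/negP: (ncov _ Bz); apply/bigcupP; exists A.
  + exact: partition_eq sP SA SB Az Bz.
- by apply/negP=> SP; case/negP: (ncov _ px); apply/bigcupP; exists p.
- by move=> B SB; right.
- by rewrite (color_pointsT col Gc); apply/subsetP=> z; rewrite inE => /andP[].
(* A point of [F] is on no original sHE because [K] is closed, and not in [q] because of the bridge;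
   it is then in [p] or on a strand that was not cut. *)
- apply/subsetP=> z Fz; have Kz := sFK _ Fz; have Vz := face_vpts FK Kz.
  have := Vz; rewrite -[vpts G]/(vpts Gc) -(wf_cover wfC) inE cover_cut_shes1 (negPf (nS _ Kz)) /=.
  have cp : cover [set p] = p by rewrite /cover big_set1.
  rewrite cover_setU inE cp; have [/eqP-> _ _] := and3P sP.
  case/orP=> [->|ez]; rewrite ?orbT //; apply/orP; left.
  move: ez; rewrite (es_eq H) inE => /orP[//|qz].
  case/negP: (nlink_pq px qz); apply: connUc_face.
  by move: Fz; rewrite inE => /andP[].
- move=> z Fz; have Vz : z \in vpts Gc by move: Fz; rewrite inE => /andP[].
  apply: (Fclosed z) => //; first by rewrite (chi_in wfG).
  by rewrite joined_setU (joined_mate (wf_chords wfG) (wf_chords2 wfG)) Vz eqxx orbT.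
- move=> B z w SB Bz Bw; rewrite (color_pointsT col Gc) => Vw Fz.
  by apply: (Fclosed z) => //; rewrite joined_setU; apply/orP; right; apply/joinedP; exists B.
- by rewrite (color_pointsT col Gc).
Qed.

Lemma open_faces_sub K : K \in faces G -> K \notin open_faces G -> ~~ meets K e.
Proof. by move=> FK; rewrite inE FK /=; apply: contra; apply: bridge_face_open. Qed.

Lemma meets_cover_cut K : ~~ meets K e -> meets K (cover (shes Gc)) = meets K (cover (shes G)).
Proof.
move=> nK; apply/meetsP/meetsP => -[x Kx]; last first.
  by move=> Sx; exists x; rewrite // cover_cut_shes1 Sx.
rewrite cover_cut_shes1 => /orP[Sx|ex]; first by exists x.
by case/negP: nK; apply/meetsP; exists x.
Qed.

Lemma cut_closed_faces : faces Gc :\: open_faces Gc = faces G :\: open_faces G.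
Proof.
apply/setP=> K; apply/setDP/setDP => -[FK nK].
  have nKe : ~~ meets K e.
    apply: contra nK => /meetsP[x Kx ex]; rewrite inE FK; apply/meetsP; exists x => //.
    by rewrite cover_cut_shes1 ex orbT.
  have : K \in [set K in faces G | ~~ meets K e] by rewrite clean_faces inE FK.
  case/setIdP=> FK' _; split=> //; move: nK; rewrite !inE FK FK' /=.
  by rewrite meets_cover_cut.
have nKe := open_faces_sub FK nK.
have : K \in [set K in faces Gc | ~~ meets K e] by rewrite -clean_faces inE FK.
case/setIdP=> FK' _; split=> //; move: nK; rewrite !inE FK FK' /=.
by rewrite meets_cover_cut.
Qed.

(** The closed faces are the same before and after the cut, so the three additional faces are
    open. *)
Lemma cut_num_bd_edges : num_bd_edges Gc = num_bd_edges G + 3.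
Proof.
have key (A : sgraph T) : #|faces A| = #|open_faces A| + #|faces A :\: open_faces A|.
  rewrite -(cardsID (open_faces A) (faces A)); congr (#|pred_of_set _| + _).
  by apply/setIidPr/subsetP=> K /setIdP[].
apply/eqP; rewrite -(eqn_add2r #|faces G :\: open_faces G|) -{1}cut_closed_faces -key.
by rewrite cut_card_faces addnAC -key.
Qed.

End CutEdge.

(** * Boundary after cutting a bridge *)

Section CutBoundary.

Variables (T : finType) (col : T -> 'I_4 * 'I_4) (G : sgraph T) (e p q : {set T}).
Hypothesis H : edge_spec col G e p q.
Let wfG := es_wf H.
Let wfC := cut_edge_wf H.
Let eE := es_edge H.
Let Pp := es_p H.
Let Pq := es_q H.

Notation chi := (mate (chords G)).
Notation sig := (mate (strands G)).
Notation cpts t := (color_points col t G).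
Notation Gc := (cut G [set e]).
Hypothesis nlink : forall x, x \in p -> ~~ connUc G e x (sig x).

Let face x := cls (joined (chords G :|: strands G)) (vpts G) x.
Let facec x := cls (joined (chords Gc :|: strands Gc)) (vpts Gc) x.

(* Parity on the side of [p]: no boundary component of that side, once [e] is
   cut, is attached to only some of the points of [p]. *)
Lemma boundary_side_conn t x y : x \in p -> y \in p -> x \in cpts t -> y \in cpts t ->
  conn (joined (chords G :|: (shes G :|: strands Gc))) (cpts t) x y.
Proof.
move=> px py tx ty; set r := joined _.
suff : y \in cls r (cpts t) x by rewrite inE => /andP[].
have disj z : z \in cover (edges Gc) -> z \notin cover (shes Gc).
  by move=> Ez; apply/negP=> Sz; have /pred0P/(_ z)/= := wf_disjoint wfC; rewrite Ez Sz.
have covS z s : s \in strands Gc -> z \in s -> z \in cover (edges Gc).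
  by move=> Ss sz; apply: partition_block (wf_strands wfC) Ss sz.
have covp z : z \in p -> z \in cover (shes Gc).
  by move=> pz; rewrite (cover_cut_shes1 H) (end_p_edge H pz) orbT.
have covH z s : s \in shes G -> z \in s -> z \in cover (shes Gc).
  by move=> Ss sz; rewrite (cover_cut_shes1 H) (she_cover Ss sz).
have pnH : p \notin shes G.
  by apply/negP=> Sp; have := she_notin H Sp px; rewrite (end_p_edge H px).
have sub : subrel (conn r (cpts t)) (connUc G e).
  apply: connUc_sub => // B /setUP[SB|]; last exact: (sub_strands H).
  by apply: sub_pedges; apply: (she_pedge wfG).
apply: (@parity _ col Gc wfC p (shes G :|: strands Gc) t _ x y) => //.
- apply: trivIset_uniq => A B z; rewrite !in_setU1 !in_setU.
  have sp A1 B1 : A1 \in strands Gc -> (B1 == p) || (B1 \in shes G) -> z \in A1 -> z \in B1 -> A1 = B1.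
    move=> SA hB Az Bz; case/negP: (disj _ (covS _ _ SA Az)).
    by case/orP: hB Bz => [/eqP->|SB]; [apply: covp | apply: covH].
  have pg A1 : (A1 == p) || (A1 \in shes G) -> A1 \in pedges G.
    by case/orP=> [/eqP->//|]; apply: (she_pedge wfG).
  rewrite !orbA => /orP[hA|SA] /orP[hB|SB] Az Bz.
  + exact: (pedge_uniq wfG (pg _ hA) (pg _ hB) Az Bz).
  + by apply/esym; apply: sp SB hA Bz Az.
  + exact: sp SA hB Az Bz.
  + exact: partition_eq (wf_strands wfC) SA SB Az Bz.
- rewrite inE negb_or pnH /=; apply/negP=> Sp.
  by case/negP: (disj _ (covS _ _ Sp px)); apply: covp.
- by move=> B /setUP[SB|SB]; [left; apply: (she_pedge wfG) | right].
- by apply/subsetP=> z; rewrite inE => /andP[].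
- apply/subsetP=> z /setIdP[tz cz]; have Vz := color_points_vpts tz.
  have := Vz; rewrite -[vpts G]/(vpts Gc) -(wf_cover wfC) inE (cover_cut_shes1 H).
  have [/eqP covs _ _] := and3P (wf_strands wfC).
  rewrite !cover_setU !inE covs => /or3P[->|->|]; rewrite ?orbT // (es_eq H) inE => /orP[pz|qz].
    by apply/orP; left; apply/bigcupP; exists p; rewrite ?set11.
  by case/negP: (nlink_pq H nlink px qz); apply: sub.
- move=> z; rewrite !inE -!andbA => /and4P[Vz t1 t2 cz].
  have tz : z \in cpts t by rewrite !inE Vz t1.
  have czt : chi z \in cpts t by rewrite (chi_color_points wfG).
  move: (czt); rewrite !inE => /and3P[-> -> ->]; apply: conn_trans cz _.
  by apply: conn1 => //; rewrite /r joined_setU (joined_mate (wf_chords wfG) (wf_chords2 wfG)) Vz eqxx orbT.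
- move=> B z w QB Bz Bw wt /setIdP[zt cz]; rewrite inE wt; apply: conn_trans cz _.
  by apply: conn1 => //; rewrite /r joined_setU; apply/orP; right; apply/joinedP; exists B.
- exact: mem_cls.
Qed.

Let F t := bd_edges col t G.
Let Fc t := bd_edges col t Gc.
Let A t := [set s in shes G | [exists K in F t, meets K s]].
Let Ac t := [set s in shes Gc | [exists K in Fc t, meets K s]].
(** Zone of change of the boundary graph: a boundary edge at any other sHE avoids [e] and is the
    same set before and after the cut. *)
Let D t : {set {set T}} := [set s | (s \in [set p; q]) || [exists K in F t, meets K s && meets K e]].

Lemma mem_A t s : (s \in A t) = (s \in shes G) && meets s (cpts t).
Proof. by rewrite inE; apply: andb_id2l => Ss; apply: (mem_bd_vertices wfG). Qed.

Lemma mem_Ac t s : (s \in Ac t) = (s \in shes Gc) && meets s (cpts t).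
Proof. by rewrite inE; apply: andb_id2l => Ss; apply: (mem_bd_vertices wfC). Qed.

Lemma pq_she : p \in shes Gc /\ q \in shes Gc.
Proof. by rewrite (cut_shes1 H) !inE !eqxx !orbT. Qed.

Lemma bd_edges_clean t K : ~~ meets K e -> (K \in F t) = (K \in Fc t).
Proof.
move=> nK; rewrite !inE (meets_cover_cut H nK).
have : (K \in [set K in faces G | ~~ meets K e]) = (K \in [set K in faces Gc | ~~ meets K e]).
  by rewrite (clean_faces H).
by rewrite !inE nK !andbT => ->.
Qed.

Lemma facec_sub K x : K \in faces Gc -> x \in K -> K \subset face x /\ face x \in faces G.
Proof.
move=> FK Kx; have [Vx ->] := comps_cls (@joined_sym _ _) FK Kx; split; last exact: face_exists.
apply/subsetP=> z; rewrite !inE => /andP[-> cz]; exact: face_cut_conn cz.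
Qed.

Lemma face_bd_edges t x K : K \in Fc t -> x \in K -> meets K e -> face x \in F t.
Proof.
move=> /setIdP[/setIdP[FK _] sK] Kx /meetsP[z Kz ez]; have [sKf FF] := facec_sub FK Kx.
have Vx := face_vpts FK Kx.
have Fx : x \in face x by apply: mem_cls.
rewrite inE (face_color_points wfG t FF Fx); apply/andP; split.
  rewrite inE FF; apply: (bridge_face_open H nlink FF); apply/meetsP; exists z => //.
  exact: (subsetP sKf).
by rewrite (face_color_points wfC t FK Kx) in sK.
Qed.

Lemma bd_clean t : 
  [set C in comps (bd_adj (F t)) (A t) | ~~ meets C (D t)] =
  [set C in comps (bd_adj (Fc t)) (Ac t) | ~~ meets C (D t)].
Proof.
apply: comps_clean; try exact: bd_adj_sym.
  apply/setP=> s; rewrite in_setD [RHS]in_setD; apply: andb_id2l.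
  rewrite inE negb_or => /andP[npq _]; rewrite mem_A mem_Ac (cut_shes1 H) in_setU.
  by rewrite (negPf npq) orbF.
move=> s s'; rewrite inE negb_or => /andP[npq /existsPn nD] As.
have nDK K : K \in F t -> meets K s -> ~~ meets K e.
  by move=> FK Ks; have := nD K; rewrite FK Ks.
have Ss : s \in shes G by case/setIdP: As.
apply/andP/andP => -[As' /existsP[K /and3P[FK Ks Ks']]].
  have nKe := nDK _ FK Ks; split.
    move: As'; rewrite mem_A mem_Ac (cut_shes1 H) in_setU => /andP[-> ->]; by [].
  by apply/existsP; exists K; rewrite -bd_edges_clean // FK Ks.
have nKe : ~~ meets K e.
  apply/negP=> Ke; have [x Kx sx] := meetsP _ _ Ks.
  have FF := face_bd_edges FK Kx Ke.
  have FKc : K \in faces Gc by case/setIdP: FK => /setIdP[].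
  have [/subsetP sK _] := facec_sub FKc Kx.
  have fs : meets (face x) s by apply/meetsP; exists x; rewrite ?sK.
  have [z Kz ez] := meetsP _ _ Ke.
  by case/negP: (nDK _ FF fs); apply/meetsP; exists z; rewrite ?sK.
split; last by apply/existsP; exists K; rewrite bd_edges_clean // FK Ks.
move: As'; rewrite mem_A mem_Ac (cut_shes1 H) in_setU => /andP[/orP[->->//|spq] _].
have [x Kx s'x] := meetsP _ _ Ks'; case/negP: nKe; apply/meetsP; exists x => //.
by move: spq s'x => /set2P[]-> ; [apply: (end_p_edge H) | apply: (end_q_edge H)].
Qed.

Lemma bd_edge_color t K x : K \in F t -> x \in K -> x \in cpts t.
Proof. by move=> /setIdP[_ /subsetP sK] /sK. Qed.

Lemma bd_edge_p t K : K \in F t -> meets K e -> exists2 x, x \in K & x \in p.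
Proof.
move=> /setIdP[/setIdP[FK _] _] /meetsP[x0 Kx0 ex0].
move: (ex0); rewrite {1}(es_eq H) inE => /orP[|qx0]; first by exists x0.
exists (sig x0); last by rewrite (sig_end H).
have [Vx0 ->] := comps_cls (@joined_sym _ _) FK Kx0.
by rewrite inE (sig_in wfG) Vx0; apply: (face_sig wfG); apply: edge_cover ex0.
Qed.

Lemma bd_dirty0 t : p :&: cpts t = set0 ->
  #|[set C in comps (bd_adj (F t)) (A t) | meets C (D t)]| = 0 /\
  #|[set C in comps (bd_adj (Fc t)) (Ac t) | meets C (D t)]| = 0.
Proof.
move=> p0; have np x : x \in p -> x \notin cpts t.
  by move=> px; apply/negP=> tx; have := in_set0 x; rewrite -p0 inE px tx.
have nq x : x \in q -> x \notin cpts t.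
  move=> qx; have ex := end_q_edge H qx.
  by rewrite -(sig_color_points wfG) np // (sig_end H).
have noD s : s \in D t -> s \in [set p; q].
  rewrite inE => /orP[//|/existsP[K /and3P[FK _ Ke]]].
  by have [x Kx px] := bd_edge_p FK Ke; case/negP: (np _ px); apply: bd_edge_color Kx.
have nopq s : s \in [set p; q] -> ~~ meets s (cpts t).
  by case/set2P=> ->; apply/negP=> /meetsP[x xs]; apply/negP; [apply: np | apply: nq].
split; apply/eqP; rewrite cards_eq0; apply/eqP/setP=> C; rewrite inE in_set0;
  apply/negP=> /andP[cC /meetsP[s Cs /noD/nopq/negP[]]];
  have [] := comps_cls (@bd_adj_sym _ _) cC Cs.
  by rewrite mem_A => /andP[].
by rewrite mem_Ac => /andP[].
Qed.

(** A boundary path runs along faces and inside sHEs, hence within one component of the underlying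
    graph. This is what separates [p] from [q] in the boundary. *)
Lemma bd_cut_conn t s s' x y : conn (bd_adj (Fc t)) (Ac t) s s' -> s \in Ac t ->
  x \in s -> y \in s' -> connUc G e x y.
Proof.
move=> css' Acs sx s'y.
have Ps : s \in pedges G by move: Acs; rewrite mem_Ac => /andP[/(she_pedge wfC)].
pose K := [set u : {set T} | [forall y in u, connUc G e x y]].
suff : s' \in K by rewrite inE => /forallP/(_ y); rewrite s'y.
apply: (conn_closed _ css'); last first.
  rewrite inE; apply/forallP=> z; apply/implyP=> sz; exact: (connUc_pedge H Ps sx sz).
move=> u v Au Av /existsP[L /and3P[FL /meetsP[a La ua] /meetsP[b Lb vb]]].
rewrite !inE => /forallP/(_ a); rewrite ua /= => cxa.
have Pv : v \in pedges G by move: Av; rewrite mem_Ac => /andP[/(she_pedge wfC)].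
apply/forallP=> z; apply/implyP=> vz; apply: conn_trans cxa _.
apply: (@conn_trans _ _ _ b); last exact: (connUc_pedge H Pv vb vz).
have FL' : L \in faces Gc by case/setIdP: FL => /setIdP[].
have [_ LE] := comps_cls (@joined_sym _ _) FL' La.
by move: Lb; rewrite LE inE => /andP[_]; apply: (connUc_face H).
Qed.

(** The new sHEs [p] and [q] are the representatives: when a face through [e] meets an old sHE, the
    piece of it at that sHE ends in [p] or [q] after the cut. *)
Lemma bd_cut_dirty t x1 : x1 \in p -> x1 \in cpts t ->
  #|[set C in comps (bd_adj (Fc t)) (Ac t) | meets C (D t)]| = 2.
Proof.
move=> px1 tx1; have [Sp Sq] := pq_she.
have tsx1 : sig x1 \in cpts t by rewrite (sig_color_points wfG).
have qsx1 := sig_p_q H px1.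
have Ap : p \in Ac t by rewrite mem_Ac Sp; apply/meetsP; exists x1.
have Aq : q \in Ac t by rewrite mem_Ac Sq; apply/meetsP; exists (sig x1).
have nc : conn (bd_adj (Fc t)) (Ac t) p q = false.
  apply/negP=> cpq; case/negP: (nlink px1); exact: bd_cut_conn cpq Ap px1 qsx1.
rewrite (card_comps_meets (S := [set p; q])).
- by rewrite cards2 (es_neq H).
- exact: bd_adj_sym.
- by apply/subsetP=> s /set2P[]->.
- by move=> s spq; exists s; rewrite ?conn_refl // inE spq.
- move=> s s' /set2P[]-> /set2P[]->; rewrite ?nc // conn_sym ?nc //; exact: bd_adj_sym.
move=> s; rewrite inE => /orP[spq|/existsP[K /and3P[FK /meetsP[a Ka sa] /meetsP[z Kz ez]]]] As.
  by exists s; rewrite ?conn_refl.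
have FKG : K \in faces G by case/setIdP: FK => /setIdP[].
have [Va KE] := comps_cls (@joined_sym _ _) FKG Ka.
have Fa : facec a \in faces Gc by apply: face_exists.
have faa : a \in facec a by apply: mem_cls.
have [sfa _] := facec_sub Fa faa.
(* A piece avoiding [e] would be a whole face of [G], namely [K], which does meet [e]. *)
have [z' fz' ez'] : exists2 z', z' \in facec a & z' \in e.
  apply/meetsP; apply: contraT => nfe.
  have : facec a \in [set K in faces G | ~~ meets K e] by rewrite (clean_faces H) inE Fa.
  case/setIdP=> FaG _; case/negP: nfe; apply/meetsP; exists z => //.
  by rewrite (face_uniq FaG FKG faa Ka).
have ta := bd_edge_color FK Ka.
have Fca : facec a \in Fc t.
  rewrite inE (face_color_points wfC t Fa faa) inE Fa; apply/andP; split=> //=.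
  apply/meetsP; exists z' => //; by rewrite (cover_cut_shes1 H) ez' orbT.
have fin r : r \in [set p; q] -> z' \in r -> exists2 r, r \in [set p; q] & conn (bd_adj (Fc t)) (Ac t) r s.
  move=> rpq rz'; exists r => //; apply: conn1 => //; first by case/set2P: rpq => ->.
  by apply/existsP; exists (facec a); rewrite Fca /=; apply/andP; split; apply/meetsP; [exists z' | exists a].
move: ez'; rewrite (es_eq H) inE => /orP[pz'|qz'].
  by apply: (fin p) => //; rewrite set21.
by apply: (fin q) => //; rewrite set22.
Qed.

(** The boundary edges through the bridge have to be connected without using [p] itself.
    [boundary_side_conn] joins their points in [p] by a path of chords, sHEs and uncut strands,
    which is then read as a path of boundary edges. *)
Lemma bd_dirty t x1 : x1 \in p -> x1 \in cpts t ->
  #|[set C in comps (bd_adj (F t)) (A t) | meets C (D t)]| = 1.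
Proof.
move=> px1 tx1; have Vx1 := pedge_vpts wfG Pp px1.
have open_p x : x \in p -> face x \in open_faces G.
  move=> px; have Vx := pedge_vpts wfG Pp px; rewrite inE face_exists //.
  apply: (bridge_face_open H nlink); first exact: face_exists.
  by apply/meetsP; exists x; [apply: mem_cls | apply: (end_p_edge H)].
have F_p x : x \in p -> x \in cpts t -> face x \in F t.
  move=> px tx; have Vx := pedge_vpts wfG Pp px.
  by rewrite inE open_p // (face_color_points wfG t (face_exists Vx) (mem_cls _ Vx)).
have face_e x : x \in p -> meets (face x) e.
  move=> px; have Vx := pedge_vpts wfG Pp px.
  by apply/meetsP; exists x; [apply: mem_cls | apply: (end_p_edge H)].
have AK s K : s \in shes G -> K \in F t -> meets K s -> s \in A t.
  by move=> Ss FK Ks; rewrite inE Ss; apply/existsP; exists K; rewrite FK.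
have [_ /meetsP[a fa /bigcupP[h1 Sh1 h1a]]] := setIdP (open_p _ px1).
have m1 : meets (face x1) h1 by apply/meetsP; exists a.
have A1 := AK _ _ Sh1 (F_p _ px1 tx1) m1.
have D1 : h1 \in D t.
  by rewrite inE; apply/orP; right; apply/existsP; exists (face x1); rewrite F_p // m1 face_e.
rewrite (card_comps_meets (S := [set h1])) ?cards1 ?sub1set //.
- exact: bd_adj_sym.
- by move=> s /set1P->; exists h1; rewrite ?conn_refl.
- by move=> s s' /set1P-> /set1P->.
move=> s; rewrite inE => /orP[spq|/existsP[K /and3P[FK Ks Ke]]] As.
  have /setIdP[Ss _] := As; have [x sx] := partition_nonempty (wf_pedges wfG) (she_pedge wfG Ss).
  case/negP: (she_notin H Ss sx).
  by case/set2P: spq sx => ->; [apply: (end_p_edge H) | apply: (end_q_edge H)].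
exists h1; first exact: set11.
have [z Kz pz] := bd_edge_p FK Ke; have tz := bd_edge_color FK Kz.
have c := boundary_side_conn px1 pz tx1 tz.
(* Every sHE on the face of [w] is to be connected to [h1]. Chords and strands do not change the
   face; a step inside an sHE moves to another boundary edge at the same boundary vertex. *)
pose W := [set w in cpts t | [forall h, (h \in shes G) && meets (face w) h ==>
              conn (bd_adj (F t)) (A t) h1 h]].
have FKG : K \in faces G by case/setIdP: FK => /setIdP[].
suff : z \in W.
  rewrite inE => /andP[_ /forallP/(_ s)]; have /setIdP[-> _] := As.
  by have [_ KE] := comps_cls (@joined_sym _ _) FKG Kz; rewrite -[face z]KE Ks.
apply: (conn_closed _ c); last first.
  rewrite inE tx1; apply/forallP=> h; apply/implyP=> /andP[Sh mh].
  apply: conn1 => //; first exact: AK Sh (F_p _ px1 tx1) mh.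
  by apply/existsP; exists (face x1); rewrite F_p // m1.
move=> u v tu tv ruv Wu; have Vu := color_points_vpts tu; have Vv := color_points_vpts tv.
have same : face_conn G u v -> v \in W.
  move=> cuv; move: Wu; rewrite !inE => /andP[_].
  have -> : face v = face u by apply: cls_eq; [apply: joined_sym | | rewrite inE Vv].
  by move=> ->; rewrite andbT; move: tv; rewrite inE.
move: ruv; rewrite !joined_setU => /or3P[ruv|/joinedP[h [Sh [hu hv]]]|/joinedP[st Sst [su sv]]].
- by apply: same; apply: conn1; rewrite // joined_setU ruv.
- rewrite inE tv; apply/forallP=> h'; apply/implyP=> /andP[Sh' mh'].
  have mhu : meets (face u) h by apply/meetsP; exists u; rewrite // mem_cls.
  have mhv : meets (face v) h by apply/meetsP; exists v; rewrite // mem_cls.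
  have Fv : face v \in F t.
    rewrite inE (open_face_she wfG Sh hv).
    by rewrite (face_color_points wfG t (face_exists Vv) (mem_cls _ Vv)).
  move: Wu; rewrite inE => /andP[_ /forallP/(_ h)]; rewrite Sh mhu /= => ch.
  apply: conn_trans ch _; apply: conn1; [exact: AK Sh Fv mhv|exact: AK Sh' Fv mh'|].
  by apply/existsP; exists (face v); rewrite Fv mhv.
- apply: same; apply: conn1 => //; rewrite joined_setU; apply/orP; right.
  by apply/joinedP; exists st => //; move: Sst; rewrite inE => /andP[].
Qed.

Lemma cut_bd_faces t : #|bd_faces col t Gc| = #|bd_faces col t G| + (p :&: cpts t != set0).
Proof.
rewrite /bd_faces -/(F t) -/(Fc t) -/(A t) -/(Ac t).
rewrite (card_compsD _ _ (D t)) (card_compsD _ (A t) (D t)) -bd_clean -addnA; congr (_ + _).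
case: (set_0Vmem (p :&: cpts t)) => [p0|[x0 /setIP[px0 tx0]]].
  by have [-> ->] := bd_dirty0 p0; rewrite p0 eqxx.
rewrite (bd_cut_dirty px0 tx0) (bd_dirty px0 tx0).
by have -> : p :&: cpts t != set0 by apply/set0Pn; exists x0; rewrite inE px0.
Qed.

Lemma cut_num_bd_comps : num_bd_comps Gc = (num_bd_comps G).+1.
Proof.
by rewrite (num_bd_compsE wfG) (num_bd_compsE wfC) cut_bd_faces (p_pointsT H) addn1.
Qed.

Lemma cut_num_shes : num_shes Gc = num_shes G + 2.
Proof.
rewrite /num_shes (cut_shes1 H) cardsU cards2 (es_neq H).
rewrite (_ : shes G :&: _ = set0) ?cards0 ?subn0 //.
apply/setP=> s; rewrite in_set0; apply/negP=> /setIP[Ss spq].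
have [x sx] := partition_nonempty (wf_pedges wfG) (she_pedge wfG Ss).
case/negP: (she_notin H Ss sx).
by case/set2P: spq sx => ->; [apply: (end_p_edge H) | apply: (end_q_edge H)].
Qed.

End CutBoundary.

(** * Counting over colours and edge sets *)

Lemma sum_bool_card (I : finType) (b : pred I) : \sum_(i : I) (b i : nat) = #|[set i | b i]|.
Proof. by rewrite -sum1dep_card [RHS]big_mkcond; apply: eq_bigr => i _; case: (b i). Qed.

(** Triples are indexed by the colour they omit, which turns sums over triples into counts of
    colours. *)
Lemma sum_color_triples (F : {set 'I_4} -> nat) :
  \sum_(t : {set 'I_4} | #|t| == 3) F t = \sum_(c : 'I_4) F [set~ c].
Proof.
rewrite (eq_bigl (fun t => t \in [set [set~ c] | c : 'I_4])); last first.
  move=> t; apply/idP/imsetP => [t3|[c _ ->]]; last by rewrite cardsC1 card_ord.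
  have /cards1P[c ec] : #|~: t| == 1.
    by rewrite -(eqn_add2l #|t|) cardsC card_ord (eqP t3).
  by exists c; rewrite // -ec setCK.
rewrite big_imset /=; first by apply: eq_bigl.
by move=> c d _ _ /setC_inj/set1_inj.
Qed.

Section ColorTriples.

Variables (T : finType) (col : T -> 'I_4 * 'I_4) (G : sgraph T) (e p q : {set T}).
Hypothesis H : edge_spec col G e p q.
Let wfG := es_wf H.
Notation cpts t := (color_points col t G).

(** A triple sees the points of [p] when it contains the colour of [p]; three of the four triples
    do. *)
Lemma sum_end_triples : \sum_(t : {set 'I_4} | #|t| == 3) (p :&: cpts t != set0) = 3.
Proof.
rewrite sum_color_triples; have [x px] := card_p_pos H; set j := (col x).1.
rewrite (eq_bigr (fun c => (c != j) : nat)); last first.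
  move=> c _; congr nat_of_bool; rewrite -card_gt0 (card_pedge_color_points wfG _ (es_p H) px) cardsC1 card_ord.
  by rewrite in_setC1 eq_sym -/j; case: (c == j).
rewrite sum_bool_card (_ : [set i | _] = [set~ j]) ?cardsC1 ?card_ord //.
by apply/setP=> c; rewrite in_setC1 inE.
Qed.

(** A pair of colours is contained in exactly two triples; the sums over triples and over points are
    exchanged. *)
Lemma sum_outer_triples : \sum_(t : {set 'I_4} | #|t| == 3) #|outer_points G e p :&: cpts t|
  = 2 * #|outer_points G e p|.
Proof.
rewrite sum_color_triples.
rewrite (eq_bigr (fun c => \sum_(x in outer_points G e p) (c \notin colors col x : nat))); last first.
  move=> c _; rewrite -sum1_card big_mkcond [RHS]big_mkcond; apply: eq_bigr => x _.
  rewrite inE; case: (boolP (x \in outer_points G e p)) => //= /setIdP[px _].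
  by rewrite color_pointsE inE (pedge_vpts wfG (es_p H) px) subsetC sub1set inE; case: (c \in _).
rewrite exchange_big /= mulnC -sum_nat_const; apply: eq_bigr => x /setIdP[px _].
rewrite sum_bool_card (_ : [set i | _] = ~: colors col x); last by apply/setP=> c; rewrite !inE.
apply/eqP; rewrite -(eqn_add2l #|colors col x|) cardsC card_ord cards2.
by rewrite (wf_neq wfG (pedge_vpts wfG (es_p H) px)).
Qed.

End ColorTriples.

(** * Cutting and contracting commute *)

Section CutContract.

Variables (T : finType) (col : T -> 'I_4 * 'I_4).
Implicit Types (G : sgraph T) (C : {set {set T}}).

Lemma cut_cut G C1 C2 : cut (cut G C1) C2 = cut G (C1 :|: C2).
Proof.
rewrite /cut /=; congr SGraph; first exact: setDDl.
  by rewrite bigcup_setU setUA.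
apply/setP=> s; rewrite !inE -andbA; congr (_ && _).
apply/andP/forallP => [[/forallP h1 /forallP h2] f|h].
  by apply/implyP=> /setUP[]; [apply/implyP/h1 | apply/implyP/h2].
by split; apply/forallP=> f; apply/implyP=> Cf; apply: (implyP (h f)); rewrite inE Cf ?orbT.
Qed.

Lemma cut_edge_strands G C e : wf col G -> C \subset edges G -> e \in edges G ->
  e \notin C -> edge_strands (cut G C) e = edge_strands G e.
Proof.
move=> wfG /subsetP CE eE nC; apply/setP=> s; rewrite !inE -andbA.
apply: andb_id2l => Ss; case: (boolP (s \subset e)) => [se|]; rewrite ?andbF ?andbT //.
apply/forallP=> f; apply/implyP=> Cf; apply: contra nC => sf.
have [x sx] := partition_nonempty (wf_strands wfG) Ss.
by rewrite (edge_uniq wfG eE (CE _ Cf) (subsetP se _ sx) (subsetP sf _ sx)).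
Qed.

(** Strands of [e] belong to no other edge, so its chords, inner faces and outer paths are
    unaffected by the cut. This is an equality of graphs, not only of counts, which lets the terms
    of the sums be matched one by one. *)
Lemma contract_cut G C e : wf col G -> C \subset edges G -> e \in edges G ->
  e \notin C -> contract (cut G C) e = cut (contract G e) C.
Proof.
move=> wfG CE eE nC; have [p [q H]] := edge_specP wfG eE.
have ES := cut_edge_strands wfG CE eE nC.
rewrite /contract /inner_number /outer_paths /inner_faces /edge_comps /edge_chords ES.
rewrite /cut /=; congr SGraph.
- by apply/setP=> f; rewrite !inE andbCA.
- congr (_ :|: _); apply: eq_bigr => f Cf; apply/esym/(contract_ends H).
    exact: (subsetP CE).
  by apply: contraNneq nC => <-.
- by apply/setP=> s; rewrite !inE -!andbA andbCA; do !bool_congr.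
Qed.

End CutContract.

(** * Variation of the numbers entering the exponents *)

Section Stats.

Variables (T : finType) (col : T -> 'I_4 * 'I_4).
Implicit Types (G : sgraph T) (C : {set {set T}}).

Definition num_bubbles G := \sum_(t : {set 'I_4} | #|t| == 3) #|bubbles col t G|.

Lemma num_bubblesE G : num_bubbles G = num_closed_bubbles col G + num_open_bubbles col G.
Proof.
rewrite /num_bubbles /num_closed_bubbles -big_split /=; apply: eq_bigr => t _.
rewrite addnC -(cardsID (open_bubbles col t G) (bubbles col t G)); congr (#|pred_of_set _| + _).
by apply/setIidPr/subsetP=> K /setIdP[].
Qed.

Variables (G : sgraph T) (e p q : {set T}).
Hypothesis H : edge_spec col G e p q.
Let wfG := es_wf H.
Let eE := es_edge H.
Notation G' := (contract G e).
Notation Gc := (cut G [set e]).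

Lemma contract_num_edges : num_edges G = (num_edges G').+1.
Proof. by rewrite /num_edges (cardsD1 e) eE. Qed.

Lemma nonloop_num_vertices : ~~ loop G e -> num_vertices G = (num_vertices G').+1.
Proof.
move=> nl; rewrite /num_vertices (nonloop_vertices H nl) /= (nonloop_inner H nl) addn0.
by rewrite addSn.
Qed.

Lemma nonloop_num_comps : ~~ loop G e -> num_comps G' = num_comps G.
Proof.
by move=> nl; rewrite /num_comps (nonloop_ug_comps H nl) /= (nonloop_inner H nl) addn0.
Qed.

Lemma nonloop_num_bubbles : ~~ loop G e -> num_bubbles G' = num_bubbles G.
Proof. by move=> nl; apply: eq_bigr => t _; rewrite (nonloop_bubbles H). Qed.

(** The outer paths contribute their number minus one, the trivial circles the inner number, and the
    two numbers add up to 3. *)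
Lemma loop_num_vertices : loop G e -> unlinked col G e p ->
  num_vertices G' = num_vertices G + 2.
Proof.
move=> lp unl; have := loop_vertices H lp unl; have := card_inner_outer H.
rewrite /num_vertices /= (inner_numberE H); lia.
Qed.

Lemma loop_num_comps : unlinked col G e p -> num_comps G' = num_comps G + 2.
Proof.
move=> unl; have := loop_ug_comps H unl; have := card_inner_outer H.
rewrite /num_comps /= (inner_numberE H); lia.
Qed.

(** Each of the 3 - p outer paths yields a bubble in the two triples containing its pair, while each
    of the three triples containing the colour of [e] loses the bubble through [e]: in total 2(3 -
    p) - 3. *)
Lemma loop_num_bubbles : unlinked col G e p ->
  num_bubbles G' + 2 * inner_number G e = num_bubbles G + 3.
Proof.
move=> unl; have : num_bubbles G + 2 * #|outer_points G e p| = num_bubbles G' + 3.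
  rewrite -(sum_outer_triples H) -[RHS](congr1 (addn _) (sum_end_triples H)).
  by rewrite /num_bubbles -!big_split; apply: eq_bigr => t _; apply: loop_bubbles H t unl.
have := card_inner_outer H; rewrite (inner_numberE H); lia.
Qed.


Lemma bridge_nlink : bridge G e -> forall x, x \in p -> ~~ connUc G e x (mate (strands G) x).
Proof.
move=> br x px; apply: contraL br => cx.
by rewrite /bridge /num_comps (cut_ug_comps_conn H px cx) ltnn.
Qed.

Lemma bridge_nonloop : bridge G e -> ~~ loop G e.
Proof.
move=> br; have [x px] := card_p_pos H; apply: contra (bridge_nlink br px).
by move=> lp; apply: (loop_connUc H).
Qed.

Lemma nlink_num_comps : (forall x, x \in p -> ~~ connUc G e x (mate (strands G) x)) ->
  num_comps Gc = (num_comps G).+1.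
Proof. by move=> nl; rewrite /num_comps (cut_ug_comps H nl). Qed.

Lemma nonbridge_num_comps : ~~ bridge G e -> num_comps Gc = num_comps G.
Proof.
move=> nb; have [x px] := card_p_pos H.
case: (boolP (connUc G e x (mate (strands G) x))) => [cx|ncx].
  by rewrite /num_comps (cut_ug_comps_conn H px cx).
case/negP: nb; rewrite /bridge nlink_num_comps // => y py.
apply: contra ncx => cy; apply: conn_trans (connUc_pedge H (es_p H) px py) _.
by apply: conn_trans cy _; apply: (connUc_pedge H (es_q H)); apply: (sig_p_q H).
Qed.

Section NoLink.

Hypothesis nlink : forall x, x \in p -> ~~ connUc G e x (mate (strands G) x).

Lemma cut_num_closed_faces : num_closed_faces Gc = num_closed_faces G.
Proof. by rewrite /num_closed_faces (cut_closed_faces H nlink). Qed.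

Lemma cut_num_bubbles : num_bubbles Gc = num_bubbles G + 3.
Proof.
rewrite -[RHS](congr1 (addn _) (sum_end_triples H)) -big_split; apply: eq_bigr => t _.
exact: (cut_bubbles H nlink).
Qed.

Lemma cut_num_bd_faces : num_bd_faces col Gc = num_bd_faces col G + 3.
Proof.
rewrite -[RHS](congr1 (addn _) (sum_end_triples H)) -big_split; apply: eq_bigr => t _.
exact: (cut_bd_faces H nlink).
Qed.

End NoLink.

Lemma sectorsE : sectors G e = [set cls (joined (pedges G' :|: chords G')) (vpts G') (mate (chords G) x)
                                | x in outer_points G e p].
Proof.
have block_end x z : x \in e -> mate (chords G) x \notin e -> z \in edge_block G x -> z \notin e ->
    z = mate (chords G) x \/ z = mate (chords G) (mate (strands G) x).
  move=> ex ncx zb nz; apply/set2P; rewrite -(edge_block_outerE H ex ncx) inE nz; exact: zb.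
have symr := joined_sym (pedges G' :|: chords G').
have V' x : x \in p -> mate (chords G) x \notin e -> mate (chords G) x \in vpts G'.
  by move=> px ncx; rewrite inE ncx (chi_in wfG) (pedge_vpts wfG (es_p H) px).
apply/setP=> w; apply/setIdP/imsetP => [[Vw /existsP[K /andP[oK /meetsP[z Kz wz]]]]|[x Ox ->]].
  move: oK; rewrite (outer_pathsE H) => /imsetP[x Ox eK]; exists x => //; subst K.
  have /setIdP[px ncx] := Ox; have ex := end_p_edge H px.
  have [V'z ->] := comps_cls symr Vw wz; have [Vz nz] := setDP V'z.
  apply: cls_eq => //; first exact: V'.
  rewrite inE V'z; case: (block_end _ _ ex ncx Kz nz) => ->; first exact: conn_refl.
  have Vx : x \in color_points col setT G by rewrite color_pointsT (pedge_vpts wfG (es_p H) px).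
  have := conn'_chi H (pedges G) Vx ex ncx.
  by rewrite color_pointsT setUC -pedges_prune.
have /setIdP[px ncx] := Ox; have ex := end_p_edge H px; split; first exact/mem_comps/V'.
apply/existsP; exists (edge_block G x); rewrite (outer_pathsE H) imset_f //.
apply/meetsP; exists (mate (chords G) x); first by rewrite !inE eqxx !orbT.
exact/mem_cls/V'.
Qed.

(** A 2-inner loop has a single outer path and nothing to separate. Otherwise there are as many
    sectors as outer paths, so distinct paths have distinct sectors, which [sectors_unlinked] keeps
    apart. *)
Lemma trivial_loop_unlinked : trivial_loop G e -> inner_number G e <= 2 -> unlinked col G e p.
Proof.
move=> [lp triv] le2 x y Ox Oy; rewrite pruneU -pedges_prune -(edges_prune H) color_pointsT => cxy.
have cIO := card_inner_outer H; rewrite -(inner_numberE H) in cIO.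
have V' z : z \in outer_points G e p -> mate (chords G) z \in vpts G'.
  by move=> /setIdP[pz ncz]; rewrite inE ncz (chi_in wfG) (pedge_vpts wfG (es_p H) pz).
have cS : #|outer_points G e p| = 1 \/ (#|sectors G e| = #|outer_points G e p| /\ sectors_unlinked G e).
  by case: triv => [i3|i2|[i1 s2 su]|[i0 s3 su]]; [lia | left; lia | right; split=> //; lia..].
case: cS => [/eqP/cards1P[z Oz]|[/eqP cS su]].
  by move: Ox Oy; rewrite Oz => /set1P-> /set1P->.
apply/eqP; apply: contraT => nxy; rewrite sectorsE in cS.
have inS z : z \in outer_points G e p ->
    cls (joined (pedges G' :|: chords G')) (vpts G') (mate (chords G) z) \in sectors G e.
  by move=> Oz; rewrite sectorsE; apply/imsetP; exists z.
have := su _ _ (inS _ Ox) (inS _ Oy).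
rewrite conn_ug_adj -conn_underlying ?V' // => /(_ _)/negP[] //.
by apply: contra nxy => /eqP /(imset_injP cS _ _ Ox Oy) ->.
Qed.

End Stats.

Lemma edge_spec_cut (T : finType) (col : T -> 'I_4 * 'I_4) G e p q (C : {set {set T}}) :
  edge_spec col G e p q -> C \subset edges G -> e \notin C -> edge_spec col (cut G C) e p q.
Proof.
move=> H CE nC; split; try by case: H.
  exact: (cut_wf (es_wf H) CE).
by rewrite inE nC (es_edge H).
Qed.

Lemma unlinked_cut (T : finType) (col : T -> 'I_4 * 'I_4) G e p q (C : {set {set T}}) :
  edge_spec col G e p q -> C \subset edges G -> e \notin C ->
  unlinked col G e p -> unlinked col (cut G C) e p.
Proof.
move=> H CE nC unl x y Ox Oy cxy; apply: unl => //.
move: cxy; apply: conn_sub => u v; rewrite (contract_cut (es_wf H) CE (es_edge H) nC) => Vu Vv ruv.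
apply: conn1 => //; move: ruv; rewrite joined_setU [joined (chords (contract G e) :|: _) u v]joined_setU.
case/orP=> [->//|/joinedP[B /setIdP[BQ nB] BB]]; apply/orP; right.
apply/joinedP; exists B => //; rewrite inE nB andbT.
by move: BQ; rewrite !inE => /orP[->//|/andP[_ ->]]; rewrite orbT.
Qed.

Lemma inner_number_cut (T : finType) (col : T -> 'I_4 * 'I_4) G e (C : {set {set T}}) :
  wf col G -> C \subset edges G -> e \in edges G -> e \notin C ->
  inner_number (cut G C) e = inner_number G e.
Proof.
move=> wfG CE eE nC.
by rewrite /inner_number /inner_faces /edge_comps /edge_chords (cut_edge_strands wfG CE eE nC).
Qed.

Lemma nlink_cut (T : finType) (G : sgraph T) e (C : {set {set T}}) x y :
  ~~ connUc G e x y -> ~~ connUc (cut G C) e x y.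
Proof.
apply: contra; apply: conn_sub => u v Vu Vv ruv; apply: conn1 => //; move: ruv.
rewrite !joined_setU => /or3P[->|->|/joinedP[f]]; rewrite ?orbT //= !inE.
move=> /andP[nfe /andP[_ fE]] ff; apply/or3P/Or33/joinedP; exists f => //.
by rewrite !inE nfe.
Qed.

(** * The recursion *)

Import GRing.Theory.
Local Open Scope ring_scope.

Lemma indet_neq0 i : indet i != 0.
Proof.
rewrite /indet tofrac_eq0; apply/eqP=> /(congr1 (mpoly.mcoeff (mpoly.mnm1 i))).
by rewrite mpoly.mcoeff0 mpoly.mcoeffX eqxx.
Qed.

(** The coefficient of the indeterminate is 1. Nonzero bases are what makes integer exponents
    additive in [monomialM]; for x it also allows the final cancellation for bridges. *)
Lemma indet_sub1_neq0 i : indet i - 1 != 0.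
Proof.
rewrite /indet -tofrac1 -tofracB tofrac_eq0; apply/eqP=> h.
have := congr1 (mpoly.mcoeff (mpoly.mnm1 i)) h.
rewrite mpoly.mcoeffB mpoly.mcoeff0 mpoly.mcoeffX eqxx mpoly.mcoeff1.
by rewrite mpoly.mnm1_eq0 subr0.
Qed.

Section Monomials.

Variables (F : fieldType) (x y z s w q t : F).

Definition monomial (a b c : int) (d f g h : nat) : F :=
  x ^ a * y ^ b * z ^ c * s ^+ d * w ^+ f * q ^+ g * t ^+ h.

Lemma monomialM (a a' b b' c c' : int) (d d' f f' g g' h h' : nat) :
  x != 0 -> y != 0 -> z != 0 ->
  monomial (a + a') (b + b') (c + c') (d + d') (f + f') (g + g') (h + h') =
  monomial a b c d f g h * monomial a' b' c' d' f' g' h'.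
Proof.
move=> x0 y0 z0; rewrite /monomial !expfzDr // !exprD.
move: (x ^ a) (x ^ a') (y ^ b) (y ^ b') (z ^ c) (z ^ c') => X X' Y Y' Z Z'.
by ring.
Qed.

Lemma monomial0 : monomial 0 0 0 0 0 0 0 = 1.
Proof. by rewrite /monomial !expr0z !expr0 !mulr1. Qed.

Lemma monomial_bridge : monomial 1 0 8 1 3 3 2 = x * z ^+ 8 * s * (w * q) ^+ 3 * t ^+ 2.
Proof. by rewrite /monomial expr1z expr0z -(exprnP z 8); ring. Qed.

Lemma monomial_x : monomial 1 0 0 0 0 0 0 = x.
Proof. by rewrite /monomial expr1z !expr0z !expr0 !mulr1. Qed.

Lemma monomial_loop c : monomial 0 1 c 0 0 0 0 = y * z ^ c.
Proof. by rewrite /monomial expr1z expr0z !expr0 mul1r !mulr1. Qed.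

End Monomials.

Notation Tmon := (monomial (Tx - 1) (Ty - 1) Tz Ts Tw Tq Tt).

Section Recursion.

Variables (T : finType) (col : T -> 'I_4 * 'I_4).
Implicit Types G A : sgraph T.

Lemma Tmonomial_shift G A G1 A1 (a b c : int) (d f g h : nat) :
  rk G - rk A = a + (rk G1 - rk A1) -> nullity A = b + nullity A1 ->
  z_exponent col A = c + z_exponent col A1 ->
  num_bd_comps A = (d + num_bd_comps A1)%N ->
  num_bd_faces col A = (f + num_bd_faces col A1)%N ->
  num_bd_edges A = (g + num_bd_edges A1)%N ->
  num_shes A = (h + num_shes A1)%N ->
  Tmonomial col G A = Tmon a b c d f g h * Tmonomial col G1 A1.
Proof.
move=> er en ez ed ef eg eh.
rewrite -[Tmonomial col G A]/(Tmon _ _ _ _ _ _ _) er en ez ed ef eg eh.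
apply: monomialM; [exact: indet_sub1_neq0 | exact: indet_sub1_neq0 | exact: indet_neq0].
Qed.

Lemma z_exponentE A : z_exponent col A = 5 * (num_comps A)%:Z
  - (3 * ((num_vertices A)%:Z - (num_edges A)%:Z)
     + 2 * ((num_closed_faces A)%:Z - (num_bubbles col A)%:Z)).
Proof. rewrite /z_exponent num_bubblesE; lia. Qed.

(** Subsets containing [e] are written [e |: C], and cutting such a set means cutting [C] and then
    [e]; both sums thus have the same index set. *)
Lemma Tinv_split G e : e \in edges G -> Tinv col G =
  \sum_(C in powerset (edges G :\ e)) Tmonomial col G (cut (cut G C) [set e])
  + \sum_(C in powerset (edges G :\ e)) Tmonomial col G (cut G C).
Proof.
move=> eE; rewrite /Tinv (bigID (fun C : {set {set T}} => e \in C)) /=; congr (_ + _).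
  rewrite (reindex_onto (fun C => e |: C) (fun C => C :\ e)) /=; last first.
    by move=> C /andP[_ eC]; rewrite setD1K.
  apply: eq_big => [C|C _]; last by rewrite cut_cut setUC.
  rewrite !powersetE setU11 andbT subUset sub1set eE /= subsetD1.
  congr (_ && _); apply/eqP/idP => [<-|nC]; first by rewrite !inE eqxx.
  by rewrite setU1K.
by apply: eq_bigl => C; rewrite !powersetE subsetD1.
Qed.

Lemma Tinv_cut G e : Tinv col (cut G [set e]) =
  \sum_(C in powerset (edges G :\ e)) Tmonomial col (cut G [set e]) (cut (cut G C) [set e]).
Proof. by apply: eq_bigr => C _; rewrite !cut_cut setUC. Qed.

Lemma Tinv_contract G e : wf col G -> e \in edges G -> Tinv col (contract G e) =
  \sum_(C in powerset (edges G :\ e)) Tmonomial col (contract G e) (contract (cut G C) e).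
Proof.
move=> wfG eE; apply: eq_bigr => C; rewrite powersetE subsetD1 => /andP[CE nC].
by rewrite (contract_cut wfG).
Qed.

(** * Comparison of corresponding terms *)

Section Terms.

Variables (G A : sgraph T) (e p q : {set T}).
Hypothesis H : edge_spec col G e p q.
Hypothesis HA : edge_spec col A e p q.
Hypothesis vA : num_vertices A = num_vertices G.

Let vAc : num_vertices (cut A [set e]) = num_vertices A. Proof. by []. Qed.
Let vGc : num_vertices (cut G [set e]) = num_vertices G. Proof. by []. Qed.
Let eAc : num_edges (cut A [set e]) = num_edges (contract A e). Proof. by []. Qed.

Lemma nonloop_term : ~~ loop G e -> ~~ loop A e ->
  Tmonomial col G A = Tmonomial col (contract G e) (contract A e).
Proof.
move=> nl nlA.
rewrite (@Tmonomial_shift G A (contract G e) (contract A e) 0 0 0 0 0 0 0).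
- by rewrite monomial0 mul1r.
- have := nonloop_num_vertices H nl; have := nonloop_num_vertices HA nlA.
  by rewrite /rk (nonloop_num_comps H nl) (nonloop_num_comps HA nlA); lia.
- rewrite /nullity (nonloop_num_vertices HA nlA) (nonloop_num_comps HA nlA).
  by rewrite (contract_num_edges HA); lia.
- rewrite !z_exponentE (nonloop_num_vertices HA nlA) (nonloop_num_comps HA nlA).
  by rewrite (contract_num_edges HA) (nonloop_num_bubbles HA nlA) (contract_num_closed_faces HA); lia.
- by rewrite (contract_num_bd_comps HA).
- by rewrite (contract_num_bd_faces HA).
- by rewrite (contract_num_bd_edges HA).
- by [].
Qed.

Lemma bridge_term : (forall x, x \in p -> ~~ connUc A e x (mate (strands A) x)) ->
  Tmonomial col G (cut A [set e]) =
  (Tx - 1) * Tz ^+ 8 * Ts * (Tw * Tq) ^+ 3 * Tt ^+ 2 * Tmonomial col G A.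
Proof.
move=> nlA; have kAc := nlink_num_comps HA nlA; have eA := contract_num_edges HA.
(* One more component, one edge less and three more bubbles change the exponent of z by 5 - 3 + 6 =
   8; the first two also leave the nullity unchanged. *)
rewrite (@Tmonomial_shift G (cut A [set e]) G A 1 0 8 1 3 3 2).
- by rewrite monomial_bridge.
- by rewrite /rk vAc kAc; lia.
- by rewrite /nullity vAc kAc eAc eA; lia.
- rewrite !z_exponentE vAc kAc eAc eA (cut_num_closed_faces HA nlA).
  by rewrite (cut_num_bubbles HA nlA); lia.
- by rewrite (cut_num_bd_comps HA nlA).
- by rewrite (cut_num_bd_faces HA nlA) addnC.
- by rewrite (cut_num_bd_edges HA nlA) addnC.
- by rewrite (cut_num_shes HA) addnC.
Qed.

(** The subgraph is the same in both terms; only the rank of the ambient graph drops by one. *)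
Lemma bridge_cut_term Ac : bridge G e ->
  Tmonomial col G Ac = (Tx - 1) * Tmonomial col (cut G [set e]) Ac.
Proof.
move=> br; have nl := bridge_nlink H br; have kGc := nlink_num_comps H nl.
rewrite (@Tmonomial_shift G Ac (cut G [set e]) Ac 1 0 0 0 0 0 0) //.
- by rewrite monomial_x.
- by rewrite /rk vGc kGc; lia.
- by rewrite add0r.
- by rewrite add0r.
Qed.

Lemma trivial_loop_term : loop G e -> loop A e ->
  unlinked col G e p -> unlinked col A e p -> inner_number A e = inner_number G e ->
  Tmonomial col G A = (Ty - 1) * Tz ^ (4 * (inner_number G e)%:Z - 7)
                      * Tmonomial col (contract G e) (contract A e).
Proof.
move=> lp lpA unl unlA iA; have bA := loop_num_bubbles HA unlA; rewrite iA in bA.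
(* Relative to the contraction, k is smaller by 2, V - E by 3 and the number of bubbles by 3 - 2p,
   which gives -10 + 9 - 2(3 - 2p) = 4p - 7. *)
rewrite (@Tmonomial_shift G A (contract G e) (contract A e) 0 1 (4 * (inner_number G e)%:Z - 7) 0 0 0 0).
- by rewrite monomial_loop.
- rewrite /rk (loop_num_vertices H lp unl) (loop_num_comps H unl).
  by rewrite (loop_num_vertices HA lpA unlA) (loop_num_comps HA unlA); lia.
- rewrite /nullity (loop_num_vertices HA lpA unlA) (loop_num_comps HA unlA).
  by rewrite (contract_num_edges HA); lia.
- rewrite !z_exponentE (loop_num_vertices HA lpA unlA) (loop_num_comps HA unlA).
  by rewrite (contract_num_edges HA) (contract_num_closed_faces HA); lia.
- by rewrite (contract_num_bd_comps HA).
- by rewrite (contract_num_bd_faces HA).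
- by rewrite (contract_num_bd_edges HA).
- by [].
Qed.

End Terms.

Section OneEdge.

Variables (G : sgraph T) (e p q : {set T}).
Hypothesis H : edge_spec col G e p q.
Let wfG := es_wf H.
Let eE := es_edge H.

Lemma powerset_term (C : {set {set T}}) : C \in powerset (edges G :\ e) ->
  C \subset edges G /\ e \notin C.
Proof. by rewrite powersetE subsetD1 => /andP. Qed.

Lemma nonloop_sum : ~~ loop G e ->
  \sum_(C in powerset (edges G :\ e)) Tmonomial col G (cut G C) = Tinv col (contract G e).
Proof.
move=> nl; rewrite (Tinv_contract wfG eE); apply: eq_bigr => C /powerset_term[CE nC].
exact: (nonloop_term H (edge_spec_cut H CE nC)).
Qed.

(** A term depends on the ambient graph only through its rank, which cutting a non-bridge
    preserves. *)
Lemma nonbridge_sum : ~~ bridge G e ->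
  \sum_(C in powerset (edges G :\ e)) Tmonomial col G (cut (cut G C) [set e]) = Tinv col (cut G [set e]).
Proof.
move=> nb; rewrite Tinv_cut; apply: eq_bigr => C _.
by rewrite /Tmonomial /rk (nonbridge_num_comps H nb).
Qed.

(** A bridge separates its ends in every spanning subgraph as well, so all terms have the same
    factor. *)
Lemma bridge_sum : bridge G e ->
  \sum_(C in powerset (edges G :\ e)) Tmonomial col G (cut (cut G C) [set e]) =
  (Tx - 1) * Tz ^+ 8 * Ts * (Tw * Tq) ^+ 3 * Tt ^+ 2 * Tinv col (contract G e).
Proof.
move=> br; rewrite -nonloop_sum; last exact: (bridge_nonloop H).
rewrite big_distrr; apply: eq_bigr => C /powerset_term[CE nC].
apply: (bridge_term (edge_spec_cut H CE nC)) => // x px; apply: nlink_cut.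
have qs := sig_p_q (edge_spec_cut H CE nC) px.
exact: (nlink_pq H (bridge_nlink H br) px qs).
Qed.

Lemma bridge_cut_sum : bridge G e ->
  \sum_(C in powerset (edges G :\ e)) Tmonomial col G (cut (cut G C) [set e]) =
  (Tx - 1) * Tinv col (cut G [set e]).
Proof.
by move=> br; rewrite Tinv_cut big_distrr; apply: eq_bigr => C _; apply: (bridge_cut_term H).
Qed.

Lemma trivial_loop_sum : trivial_loop G e -> (inner_number G e <= 2)%N ->
  \sum_(C in powerset (edges G :\ e)) Tmonomial col G (cut G C) =
  (Ty - 1) * Tz ^ (4 * (inner_number G e)%:Z - 7) * Tinv col (contract G e).
Proof.
move=> tl le2; have unl := trivial_loop_unlinked H tl le2; have [lp _] := tl.
rewrite (Tinv_contract wfG eE) big_distrr; apply: eq_bigr => C /powerset_term[CE nC].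
apply: (trivial_loop_term H (edge_spec_cut H CE nC)) => //.
  exact: (unlinked_cut H CE nC unl).
exact: (inner_number_cut wfG CE eE nC).
Qed.

End OneEdge.

End Recursion.

Theorem theorem4p32 (T : finType) (col : T -> 'I_4 * 'I_4) (G : sgraph T)
    (e : {set T}) (hG : wcolored (D := 3) col G) (he : e \in edges G) :
  [/\ ordinary G e ->
        Tinv col G = Tinv col (cut G [set e]) + Tinv col (contract G e),
      bridge G e ->
        Tinv col (cut G [set e])
          = Tz ^+ 8 * Ts * (Tw * Tq) ^+ 3 * Tt ^+ 2 * Tinv col (contract G e)
        /\ Tinv col G
          = ((Tx - 1) * Tz ^+ 8 * Ts * (Tw * Tq) ^+ 3 * Tt ^+ 2 + 1)
            * Tinv col (contract G e)
    & forall p : nat, (p <= 2)%N -> trivial_loop G e -> inner_number G e = p ->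
        Tinv col G
          = Tinv col (cut G [set e])
            + (Ty - 1) * Tz ^ (4 * p%:Z - 7) * Tinv col (contract G e)].
Proof.
have wfG := wcolored_wf hG; have [p [q H]] := edge_specP wfG he.
split=> [/andP[nb nl]|br|i le2 tl ei].
- by rewrite (Tinv_split col he) (nonbridge_sum H nb) (nonloop_sum H nl).
- have nl := bridge_nonloop H br; split; last first.
    by rewrite (Tinv_split col he) (bridge_sum H br) (nonloop_sum H nl) [RHS]mulrDl mul1r.
  (* The terms with [e] cut sum to x - 1 times the invariant of the cut graph, and also to the
     bridge factor times that of the contraction. Both contain x - 1, which is cancelled. *)
  apply: (mulfI (indet_sub1_neq0 (inord 0))); rewrite -/Tx.
  by rewrite -(bridge_cut_sum H br) (bridge_sum H br) !mulrA.
- have nb : ~~ bridge G e by apply/negP=> /(bridge_nonloop H); have [-> _] := tl.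
  by rewrite -ei (Tinv_split col he) (nonbridge_sum H nb) (trivial_loop_sum H tl) ?ei.
Qed.
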